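(* Let $G$ be a connected graph. Then $G$ is claw-free and equimatchable if and only if one of the following holds: (i) $G$ is isomorphic to $C_4$; (ii) $G$ is isomorphic to $K_{2p}$ for some $p\ge 1$; (iii) $G$ is odd and $\alpha(G)\le 2$; (iv) $G\in\mathcal{G}_1$; (v) $G\in\mathcal{G}_{21}\cup\mathcal{G}_{22}\cup\mathcal{G}_{23}$ or $G$ is isomorphic to $C_7$; (vi) $G\in\mathcal{G}_3$.
   Context: All graphs are finite and simple. A graph is equimatchable if all its maximal matchings have the same cardinality; it is claw-free if it has no induced subgraph isomorphic to $K_{1,3}$. $G$ is odd (even) if $|V(G)|$ is odd (even). $\alpha(G)$ is the independence number. $K_p,C_p,P_p$ denote the complete graph, cycle and path on $p$ vertices. $N(v)$ is the neighborhood of $v$ and $N_X(v)=N(v)\cap X$. A set $S$ of vertices is independent if its vertices are pairwise non-adjacent. For a connected graph $G$, a cut set is a set $S$ of vertices with $G\setminus S$ disconnected; a 2-cut is a cut set of size 2. A vertex is complete to a vertex set $X$ if it is adjacent to every vertex of $X$. $\mathcal{G}_1$: graphs $G$ having a vertex $v$ such that $G-v$ has exactly two connected components $G_1,G_2$ and for each $i\in\{1,2\}$: $G_i$ is a complete graph on an even number of vertices or is isomorphic to $C_4$; if $G_i$ is a $C_4$ then $N_{V(G_i)}(v)$ consists of exactly two adjacent vertices of $G_i$; and if both $G_1,G_2$ are complete graphs then $v$ has at least one non-neighbor in $G_1$ and at least one non-neighbor in $G_2$. $\mathcal{G}_{21}$: graphs whose vertex set can be partitioned into $V_1,V_2$ such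 that $V_1$ induces $K_{2q+1}$ for some $q\ge1$; $V_2$ induces a 4-cycle $v_1v_2v_3v_4$ (edges $v_1v_2,v_2v_3,v_3v_4,v_4v_1$); $N_{V_1}(v_1)=N_{V_1}(v_2)$; $2\le |N_{V_1}(v_1)|<|V_1|$; and $N_{V_1}(v_3)=N_{V_1}(v_4)=\emptyset$. $\mathcal{G}_{22}$: graphs $G$ having two non-adjacent vertices $s_1,s_2$, $S=\{s_1,s_2\}$, such that $G\setminus S$ has exactly two connected components, $A$ of even order and $B$ of odd order, with $A$ isomorphic to $K_{2p}$ for some $p\ge1$, $B$ isomorphic to $K_{2q+1}$ for some $q\ge 0$, $s_1$ and $s_2$ complete to $B$, $N_A(s_1)\cup N_A(s_2)\subsetneq A$, and $N_A(s_1)\cap N_A(s_2)=\emptyset$. $\mathcal{G}_{23}$: graphs $G$ having two non-adjacent vertices $s_1,s_2$, $S=\{s_1,s_2\}$, such that $G\setminus S$ has exactly two connected components, $A$ of even order and $B$ of odd order, with $A$ isomorphic to $K_2$, $G[S\cup A]$ isomorphic to $P_4$, $B$ isomorphic to $K_{2q+1}$ for some $q\ge1$, and $N_B(s_1)\cup N_B(s_2)=B$. $\mathcal{G}_3$: graphs $G$ having an independent set $S=\{s_1,s_2,s_3\}$ such that $G\setminus S$ has exactly two connected components $A,A'$, each a complete graph on an odd number of at least three vertices, and there exist $a\in A$, $a'\in A'$ with $N(s_1)=A\cup\{a'\}$, $N(s_2)=A'\cup\{a\}$, $N(s_3)=(A\cup A')\setminus\{a,a'\}$. *)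

(* Defs.v *)
From mathcomp Require Import all_boot.

Set Implicit Arguments.
Unset Strict Implicit.
Unset Printing Implicit Defensive.

Record sgraph := SGraph {
  svertex :> finType;
  sedge : rel svertex;
  sedge_sym : symmetric sedge;
  sedge_irrefl : irreflexive sedge
}.

Notation "x -- y" := (sedge x y) (at level 30).

Definition isomorphic (G H : sgraph) : Prop :=
  exists2 f : G -> H, bijective f & forall x y, (f x -- f y) = (x -- y).

Section Induced.
Variables (G : sgraph) (S : {set G}).

Definition induced_rel : rel {x : G | x \in S} := [rel x y | val x -- val y].

Fact induced_sym : symmetric induced_rel.
Proof. by move=> x y; apply: sedge_sym. Qed.

Fact induced_irrefl : irreflexive induced_rel.
Proof. by move=> x; apply: sedge_irrefl. Qed.

Definition induced : sgraph := SGraph induced_sym induced_irrefl.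
End Induced.

Section StandardGraphs.
Variables m n : nat.

Definition complete_rel : rel 'I_n := [rel i j | i != j].

Fact complete_sym : symmetric complete_rel.
Proof. by move=> i j; rewrite /complete_rel /= eq_sym. Qed.

Fact complete_irrefl : irreflexive complete_rel.
Proof. by move=> i; rewrite /complete_rel /= eqxx. Qed.

Definition complete_graph : sgraph := SGraph complete_sym complete_irrefl.

Definition path_rel : rel 'I_n := [rel i j : 'I_n | (i.+1 == j) || (j.+1 == i)].

Fact path_sym : symmetric path_rel.
Proof. by move=> i j; rewrite /path_rel /= orbC. Qed.

Fact path_irrefl : irreflexive path_rel.
Proof. by move=> i; rewrite /path_rel /= orbb gtn_eqF. Qed.

Definition path_graph : sgraph := SGraph path_sym path_irrefl.

(* The first conjunct only matters for n = 1. *)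
Definition cycle_rel : rel 'I_n :=
  [rel i j : 'I_n | (i != j) && ((i.+1 == j %[mod n]) || (j.+1 == i %[mod n]))].

Fact cycle_sym : symmetric cycle_rel.
Proof. by move=> i j; rewrite /cycle_rel /= eq_sym orbC. Qed.

Fact cycle_irrefl : irreflexive cycle_rel.
Proof. by move=> i; rewrite /cycle_rel /= eqxx. Qed.

Definition cycle_graph : sgraph := SGraph cycle_sym cycle_irrefl.

Definition biclique_rel : rel ('I_m + 'I_n) :=
  [rel u v : 'I_m + 'I_n | is_inl u != is_inl v].

Fact biclique_sym : symmetric biclique_rel.
Proof. by move=> u v; rewrite /biclique_rel /= eq_sym. Qed.

Fact biclique_irrefl : irreflexive biclique_rel.
Proof. by move=> u; rewrite /biclique_rel /= eqxx. Qed.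

Definition biclique_graph : sgraph := SGraph biclique_sym biclique_irrefl.
End StandardGraphs.

Section Notions.
Variable G : sgraph.

Definition complete : Prop := forall x y : G, x != y -> x -- y.

Definition claw_free : Prop :=
  ~ exists S : {set G}, isomorphic (induced S) (biclique_graph 1 3).

Definition edges : {set {set G}} :=
  [set e | [exists x, exists y, (x -- y) && (e == [set x; y])]].

Definition matching (M : {set {set G}}) : bool := (M \subset edges) && trivIset M.

Definition maximal_matching (M : {set {set G}}) : bool := maxset matching M.

Definition equimatchable : Prop :=
  forall M N, maximal_matching M -> maximal_matching N -> #|M| = #|N|.

Definition independent (S : {set G}) : bool :=
  [forall x in S, forall y in S, ~~ (x -- y)].

Definition alpha : nat := \max_(S : {set G} | independent S) #|S|.

(* The null graph is not connected. *)
Definition connected : Prop :=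
  0 < #|G| /\ forall x y : G, connect (@sedge G) x y.

Definition neighborhood (v : G) : {set G} := [set w | v -- w].

Definition neighborhood_in (X : {set G}) (v : G) : {set G} := neighborhood v :&: X.

Definition complete_to (v : G) (X : {set G}) : Prop := {in X, forall x, v -- x}.

(* Vertex sets of the connected components of the subgraph induced by U. *)
Definition components (U : {set G}) : {set {set G}} :=
  equivalence_partition (connect [rel x y in U | x -- y]) U.

Definition two_components_without (S A B : {set G}) : Prop :=
  A != B /\ components (~: S) = [set A; B].
End Notions.

Section Families.
Variable G : sgraph.

Definition G1_component (v : G) (H : {set G}) : Prop :=
  ((complete (induced H) /\ ~~ odd #|H|) \/
     isomorphic (induced H) (cycle_graph 4)) /\
  (isomorphic (induced H) (cycle_graph 4) ->
     exists x y : G, x -- y /\ neighborhood_in H v = [set x; y]).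

Definition inG1 : Prop :=
  exists (v : G) (H1 H2 : {set G}),
    [/\ two_components_without [set v] H1 H2,
        G1_component v H1,
        G1_component v H2
      & complete (induced H1) /\ complete (induced H2) ->
          (exists2 x, x \in H1 & ~~ (v -- x)) /\
          (exists2 y, y \in H2 & ~~ (v -- y))].

Definition inG21 : Prop :=
  exists V1 V2 : {set G},
    [/\ V1 :|: V2 = [set: G], [disjoint V1 & V2],
        exists2 q, 1 <= q & isomorphic (induced V1) (complete_graph (2 * q + 1))
      & exists v1 v2 v3 v4 : G,
          [/\ uniq [:: v1; v2; v3; v4] /\ V2 = [set v1; v2; v3; v4],
              [/\ v1 -- v2, v2 -- v3, v3 -- v4 & v4 -- v1] /\
                ~~ (v1 -- v3) /\ ~~ (v2 -- v4),
              neighborhood_in V1 v1 = neighborhood_in V1 v2,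
              2 <= #|neighborhood_in V1 v1| < #|V1|
            & neighborhood_in V1 v3 = set0 /\ neighborhood_in V1 v4 = set0]].

Definition inG22 : Prop :=
  exists (s1 s2 : G) (A B : {set G}),
    [/\ s1 != s2 /\ ~~ (s1 -- s2),
        [/\ two_components_without [set s1; s2] A B, ~~ odd #|A| & odd #|B|],
        exists2 p, 1 <= p & isomorphic (induced A) (complete_graph (2 * p)),
        exists q, isomorphic (induced B) (complete_graph (2 * q + 1))
      & [/\ complete_to s1 B, complete_to s2 B,
            neighborhood_in A s1 :|: neighborhood_in A s2 \proper A
          & neighborhood_in A s1 :&: neighborhood_in A s2 = set0]].

Definition inG23 : Prop :=
  exists (s1 s2 : G) (A B : {set G}),
    [/\ s1 != s2 /\ ~~ (s1 -- s2),
        [/\ two_components_without [set s1; s2] A B, ~~ odd #|A| & odd #|B|],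
        isomorphic (induced A) (complete_graph 2) /\
          isomorphic (induced ([set s1; s2] :|: A)) (path_graph 4),
        exists2 q, 1 <= q & isomorphic (induced B) (complete_graph (2 * q + 1))
      & neighborhood_in B s1 :|: neighborhood_in B s2 = B].

Definition inG3 : Prop :=
  exists (s1 s2 s3 : G) (A A' : {set G}),
    [/\ uniq [:: s1; s2; s3] /\ independent [set s1; s2; s3],
        two_components_without [set s1; s2; s3] A A',
        [/\ complete (induced A), odd #|A| & 3 <= #|A|],
        [/\ complete (induced A'), odd #|A'| & 3 <= #|A'|]
      & exists a a' : G,
          [/\ a \in A, a' \in A',
              neighborhood s1 = A :|: [set a'],
              neighborhood s2 = A' :|: [set a]
            & neighborhood s3 = (A :|: A') :\: [set a; a']]].
End Families.

(* Main.v *)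
Require Import Defs.
From mathcomp Require Import all_boot.

Set Implicit Arguments.
Unset Strict Implicit.
Unset Printing Implicit Defensive.

(* For a connected claw-free graph Sumner's theorem gives a matching that misses
   at most one vertex, so G is equimatchable iff no independent set T with
   |T| >= 2 leaves a perfect matching of G - T.  For the members of the families
   this is a parity check.

   For the direct part, suppose that G - (Z u U) has a perfect matching M, where
   Z is odd and has no edge to U.  As M leaves a vertex of Z uncovered, every
   matching of U extends to a perfect one; by Sumner's argument each component
   of U is then an even clique or a 4-cycle.  If G has even order, U = V(G)
   settles the matter.  If G has odd order and an independent triple, this is
   applied to the two sides of a cut vertex, of a cut made of two non-adjacent
   vertices, or (when no such cuts exist) of an independent triple whose removal
   leaves two odd components.  When any one attachment vertex of an odd side is
   deleted, even cliques and 4-cycles remain, which forces the side to be a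
   clique, or a clique minus one edge; the adjacencies to the cut are then read
   off from independent triples whose complement must not have a perfect
   matching. *)

(** Equimatchability enters only through independent sets whose complement is perfectly matchable;
    matchings appear as sets of edges only in the translation from [equimatchable]. In odd order
    such an independent set has odd size, so triples are the smallest obstruction. To isolate one
    side of a cut, the cut vertices must be matched to distinct neighbours while an odd number of
    vertices Z stays on the other side; an odd side must moreover give up one vertex, and only an
    attachment vertex can be matched into the cut. Apart from sides with a single vertex, which need
    their own treatment, distinct neighbours fail to exist only if there is a smaller cut, and a
    component left by the deletion lacks further attachment vertices only if the deleted vertex is a
    cut vertex. Hence the order in which cut vertices, non-adjacent pairs and independent triples
    are treated. Even cliques and 4-cycles are what claw-freeness leaves of the connected randomly
    matchable graphs $K_{2n}$ and $K_{n,n}$. *)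

Section PointFacts.
Variables (T : finType) (z : T).

(** Hypotheses are recast as propositional formulas in the atoms [z == x] and [z \in A] for one
    generic point z, which turns an inclusion or equality of sets into a finite truth table. *)
Lemma at_mem (x : T) (S : {set T}) : x \in S -> (z == x) ==> (z \in S).
Proof. by move=> xS; apply/implyP => /eqP->. Qed.

Lemma at_notin (x : T) (S : {set T}) : x \notin S -> (z == x) ==> (z \notin S).
Proof. by move=> xS; apply/implyP => /eqP->. Qed.

Lemma at_neq (x y : T) : x != y -> ~~ ((z == x) && (z == y)).
Proof. by move=> xy; apply: contra xy => /andP[/eqP<- /eqP<-]. Qed.

Lemma at_sub (A B : {set T}) : A \subset B -> (z \in A) ==> (z \in B).
Proof. by move=> /subsetP AB; apply/implyP => /AB. Qed.

Lemma at_disj (A B : {set T}) : [disjoint A & B] -> ~~ ((z \in A) && (z \in B)).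
Proof.
by move=> AB; apply/negP => /andP[zA zB]; rewrite (disjointFr AB zA) in zB.
Qed.

Lemma at_eq (A B : {set T}) : A = B ->
  ((z \in A) ==> (z \in B)) && ((z \in B) ==> (z \in A)).
Proof. by move=> ->; rewrite implybb. Qed.

End PointFacts.

Ltac set_facts z :=
  repeat match goal with
  | H : is_true (?A \subset ?B) |- _ => generalize (at_sub z H); clear H
  | H : is_true (disjoint (@mem _ _ ?A) (@mem _ _ ?B)) |- _ =>
      generalize (at_disj z H); clear H
  | H : @eq {set _} ?A ?B |- _ => generalize (at_eq z H); clear H
  | H : forall u, is_true _ |- _ => generalize (H z); clear H
  end.

(** The enumeration is exponential in the number of atoms, so facts about points absent from the
    goal are dropped. *)
Ltac if_in_goal x tac := try (lazymatch goal with |- context [x] => tac end).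

Ltac point_facts z :=
  repeat match goal with
  | H : is_true (?x \in ?S) |- _ =>
      if_in_goal x ltac:(generalize (at_mem z H)); clear H
  | H : is_true (?x \notin ?S) |- _ =>
      if_in_goal x ltac:(generalize (at_notin z H)); clear H
  | H : is_true (?x != ?y) |- _ =>
      if_in_goal x ltac:(if_in_goal y ltac:(generalize (at_neq z H))); clear H
  end.

Ltac bool_cases z :=
  repeat match goal with
  | |- context [in_mem z ?A] => move: (in_mem z A)
  | |- context [z == ?x] => move: (z == x)
  end;
  clear;
  repeat match goal with |- forall b : bool, _ => case; rewrite //= end.

Ltac revert_at z :=
  repeat match goal with
  | H : is_true ?b |- _ =>
      lazymatch b with
      | context [in_mem z _] => revert H
      | context [z == _] => revert H
      end
  end.

(* Proves a Boolean statement about the sets containing z: the hypotheses on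
   sets are instantiated at z, then those on the points that occur in the
   resulting goal, and all the memberships of z are enumerated. *)
Ltac at_dec z :=
  set_facts z; revert_at z; point_facts z;
  rewrite ?(inE, eqxx); bool_cases z.

Ltac set_dec :=
  let z := fresh "z" in
  match goal with
  | |- is_true (?A \subset ?B) => apply/subsetP => z; apply/implyP
  | |- is_true [disjoint ?A & ?B] => rewrite -setI_eq0; apply/eqP/setP => z
  | |- _ = _ => apply/setP => z
  end; at_dec z.

Ltac mem_dec :=
  match goal with
  | |- is_true (?x \in ?A) => at_dec x
  | |- is_true (~~ (?x \in ?A)) => at_dec x
  | |- is_true (~~ (?x == ?y)) => at_dec x
  | |- is_true (_ || (_ || (_ || (?x \in _)))) => at_dec x
  | |- is_true (_ || (?x \in _)) => at_dec x
  end.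

(** * Perfectly matchable sets and components *)

Section Graph.
Variable G : sgraph.
Implicit Types (x y z : G) (S T U V C D : {set G}).

Lemma adjC x y : (x -- y) = (y -- x).
Proof. exact: sedge_sym. Qed.

Lemma adj_neq x y : x -- y -> x != y.
Proof. by apply: contraTneq => ->; rewrite sedge_irrefl. Qed.

(** For [C \subset U] this says that C is a union of components of G[U]. *)
Definition adj_closed U C := [forall x in C, forall y in U, (x -- y) ==> (y \in C)].

Lemma adj_closedP U C :
  reflect (forall x y, x \in C -> y \in U -> x -- y -> y \in C) (adj_closed U C).
Proof.
apply: (iffP forall_inP) => [H x y xC yU xy|H x xC].
  by have /forall_inP/(_ y yU)/implyP := H x xC; apply.
by apply/forall_inP => y yU; apply/implyP; apply: H.
Qed.

(** Connectedness in the form in which it is applied: a nonempty subset that no edge leaves is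
    everything. The empty set is connected in this sense. *)
Definition conn U :=
  forall x C, x \in C -> C \subset U -> adj_closed U C -> C = U.

Definition clique U := {in U &, forall x y, x != y -> x -- y}.

Definition anticomplete U V := {in U & V, forall x y, ~~ (x -- y)}.

(** Perfect matchability of G[U], by peeling off one edge at a time: parity and gluing arguments
    become inductions and no set of edges is carried along. *)
Inductive pm : {set G} -> Prop :=
| pm_nil : pm set0
| pm_cons x y U : x \in U -> y \in U -> x -- y -> pm (U :\ x :\ y) -> pm U.

Lemma pm0 U : U = set0 -> pm U.
Proof. by move=> ->; apply: pm_nil. Qed.

Lemma cardD2 x y U : x \in U -> y \in U -> x != y -> #|U| = #|U :\ x :\ y|.+2.
Proof.
move=> xU yU xy; rewrite (cardsD1 x) xU (cardsD1 y (U :\ x)).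
by rewrite !inE eq_sym xy yU.
Qed.

Lemma odd_D1 x U : x \in U -> odd #|U :\ x| = ~~ odd #|U|.
Proof. by move=> xU; rewrite (cardsD1 x U) xU /= negbK. Qed.

Lemma odd_D2 x y U :
  x \in U -> y \in U -> x != y -> odd #|U :\ x :\ y| = odd #|U|.
Proof. by move=> xU yU xy; rewrite (cardD2 xU yU xy) /= negbK. Qed.

Lemma odd_disjU U V : [disjoint U & V] -> odd #|U :|: V| = odd #|U| (+) odd #|V|.
Proof. by move=> dUV; rewrite cardsU disjoint_setI0 // cards0 subn0 oddD. Qed.

Lemma odd_set_sub U V : V \subset U -> odd #|U :\: V| = odd #|U| (+) odd #|V|.
Proof.
move=> VU; rewrite -[U in RHS](setID U V) (setIidPr VU) odd_disjU; last by set_dec.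
by rewrite addbC addbA addbb.
Qed.

Lemma pm_even U : pm U -> ~~ odd #|U|.
Proof.
elim=> [|x y {}U xU yU xy _ IH]; first by rewrite cards0.
by rewrite (cardD2 xU yU (adj_neq xy)) /= negbK.
Qed.

Lemma pmU U V : pm U -> pm V -> [disjoint U & V] -> pm (U :|: V).
Proof.
move=> pU pV; elim: pU => [|x y {}U xU yU xy _ IH] dUV; first by rewrite set0U.
have xV : x \notin V by mem_dec.
have yV : y \notin V by mem_dec.
apply: (pm_cons _ _ xy); rewrite ?inE ?xU ?yU //.
have -> : (U :|: V) :\ x :\ y = (U :\ x :\ y) :|: V by set_dec.
by apply: IH; set_dec.
Qed.

(** No matching edge joins C to [U :\: C], so the edges that meet C match it perfectly. *)
Lemma pm_closed U C : pm U -> C \subset U -> adj_closed U C -> pm C.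
Proof.
move=> pU; elim: pU C => [|x y {}U xU yU xy _ IH] C CU /adj_closedP clC.
  by apply: pm0; apply/eqP; rewrite -subset0.
have [xC|xC] := boolP (x \in C); have [yC|yC] := boolP (y \in C).
- apply: (pm_cons xC yC xy); apply: IH; first by set_dec.
  apply/adj_closedP => u v; rewrite !inE => /and3P[_ _ uC] /and3P[-> -> vU] uv.
  exact: clC uv.
- by rewrite (clC x y) in yC.
- by rewrite (clC y x) // adjC in xC.
- apply: IH; first by set_dec.
  by apply/adj_closedP => u v uC; rewrite !inE => /and3P[_ _ vU]; apply: clC.
Qed.

Lemma pm_isolated U x :
  pm U -> x \in U -> exists2 y, y \in U & x -- y.
Proof.
elim=> [|u v {}U uU vU uv _ IH]; first by rewrite inE.
have [->|xu] := eqVneq x u; first by exists v.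
have [->|xv] := eqVneq x v; first by exists u => //; rewrite adjC.
move=> xU; case: IH => [|y]; first by rewrite !inE xu xv.
by rewrite !inE => /and3P[_ _ yU] xy; exists y.
Qed.

(** The order in which edges are peeled off is immaterial, so the edge at x may come first. *)
Lemma pm_partner U x :
  pm U -> x \in U -> exists2 y, y \in U & x -- y /\ pm (U :\ x :\ y).
Proof.
elim=> [|u v {}U uU vU uv pU IH]; first by rewrite inE.
have [->|xu] := eqVneq x u; first by exists v.
have [->|xv xU] := eqVneq x v.
  by exists u; rewrite // adjC; split=> //; rewrite !setDDl setUC -setDDl.
case: IH => [|y]; first by rewrite !inE xu xv.
rewrite !inE => /and3P[yv yu yU] [xy pU']; exists y => //; split=> //.
apply: (pm_cons _ _ uv); [by mem_dec|by mem_dec|].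
by have <- : U :\ u :\ v :\ x :\ y = U :\ x :\ y :\ u :\ v by set_dec.
Qed.

Lemma card_gt0E U x : x \in U -> 0 < #|U|.
Proof. by move=> xU; apply/card_gt0P; exists x. Qed.

Lemma odd_nonempty U : odd #|U| -> exists x, x \in U.
Proof. by move=> oU; apply/card_gt0P; case: #|U| oU. Qed.

Lemma even_other U x : ~~ odd #|U| -> x \in U -> exists2 y, y \in U & y != x.
Proof.
move=> eU xU; have [y] : exists y, y \in U :\ x.
  by apply: odd_nonempty; rewrite odd_D1.
by rewrite !inE => /andP[yx yU]; exists y.
Qed.

Lemma cliqueS U V : V \subset U -> clique U -> clique V.
Proof. by move=> /subsetP VU cU x y /VU xU /VU yU; apply: cU. Qed.

Lemma clique_pm U : clique U -> ~~ odd #|U| -> pm U.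
Proof.
have [n] := ubnP #|U|; elim: n U => // n IH U; rewrite ltnS => leUn cU eU.
have [->|[x xU]] := set_0Vmem U; first exact: pm_nil.
have [y yU yx] := even_other eU xU; rewrite eq_sym in yx.
have xy := cU x y xU yU yx.
apply: (pm_cons xU yU xy); apply: IH.
- by move: leUn; rewrite (cardD2 xU yU yx) => /ltnW.
- by apply: cliqueS cU; set_dec.
- by rewrite odd_D2.
Qed.

Lemma clique_pm1 U x y :
  clique U -> odd #|U| -> y \in U -> x \notin U -> x -- y -> pm (x |: U).
Proof.
move=> cU oU yU xU xy.
have yx : y != x by mem_dec.
apply: (pm_cons (x := x) (y := y)) => //; rewrite ?inE ?eqxx ?yU ?orbT //.
have -> : (x |: U) :\ x :\ y = U :\ y by set_dec.
apply: clique_pm; last by rewrite odd_D1 // negbK.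
by apply: cliqueS cU; set_dec.
Qed.

Lemma independentP U :
  reflect {in U &, forall x y, ~~ (x -- y)} (independent U).
Proof.
apply: (iffP forall_inP) => [H x y xU yU|H x xU].
  by have /forall_inP/(_ y yU) := H x xU.
by apply/forall_inP => y yU; apply: H.
Qed.

Lemma independent1 x : independent [set x].
Proof. by apply/independentP => y z /set1P-> /set1P->; rewrite sedge_irrefl. Qed.

Lemma independentU U V :
  independent U -> independent V -> anticomplete U V -> independent (U :|: V).
Proof.
move=> /independentP iU /independentP iV aUV.
apply/independentP => x y /setUP[xU|xV] /setUP[yU|yV]; [exact: iU|exact: aUV| |exact: iV].
by rewrite adjC aUV.
Qed.

Lemma independent2 x y : ~~ (x -- y) -> independent [set x; y].
Proof.
move=> xy; apply: independentU (independent1 _) (independent1 _) _.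
by move=> u v /set1P-> /set1P->.
Qed.

Lemma independent3 x y z :
  ~~ (x -- y) -> ~~ (x -- z) -> ~~ (y -- z) -> independent [set x; y; z].
Proof.
move=> xy xz yz; apply: independentU (independent2 xy) (independent1 _) _.
by move=> u v /set2P[->|->] /set1P->.
Qed.

(** T consists of the vertices missed by a maximal matching of G[U]. *)
Lemma maximal_pm U : exists T, [/\ T \subset U, independent T & pm (U :\: T)].
Proof.
have [n] := ubnP #|U|; elim: n U => // n IH U; rewrite ltnS => leUn.
have [iU|] := boolP (independent U).
  by exists U; split=> //; rewrite setDv; apply: pm_nil.
rewrite negb_forall_in => /exists_inP[x xU].
rewrite negb_forall_in => /exists_inP[y yU]; rewrite negbK => xy.
have [|T [TU iT pT]] := IH (U :\ x :\ y).
  by move: leUn; rewrite (cardD2 xU yU (adj_neq xy)) => /ltnW.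
exists T; split=> //; first by set_dec.
apply: (pm_cons _ _ xy); [by mem_dec|by mem_dec|].
by have -> : (U :\: T) :\ x :\ y = U :\ x :\ y :\: T by set_dec.
Qed.

Definition iscomp U D :=
  [/\ D \subset U, exists x, x \in D, adj_closed U D & conn D].

Definition rst U : rel G := [rel x y in U | x -- y].
Definition comp U x := [set y in U | connect (rst U) x y].

Lemma rst_sym U : symmetric (rst U).
Proof. by move=> x y; rewrite /rst /= adjC [(x \in U) && _]andbC. Qed.

Lemma comp_closed U x : adj_closed U (comp U x).
Proof.
apply/adj_closedP => y z; rewrite !inE => /andP[yU xy] zU yz; rewrite zU.
by apply: connect_trans xy (connect1 _); rewrite /rst /= yU zU.
Qed.

Lemma closed_connect U C x y :
  x \in C -> adj_closed U C -> connect (rst U) x y -> y \in C.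
Proof.
move=> xC /adj_closedP clC /connectP[p]; elim: p x xC => [x xC _ -> //|z p IH x xC].
move=> /= /andP[/andP[/andP[xU zU] xz] pp]; apply: IH pp.
exact: clC xz.
Qed.

Lemma iscomp_comp U x : x \in U -> iscomp U (comp U x).
Proof.
move=> xU; have sub : comp U x \subset U by apply/subsetP => y; rewrite inE => /andP[].
split=> //; [by exists x; rewrite inE xU connect0|exact: comp_closed|].
move=> y C yC CS /adj_closedP clC; apply/eqP; rewrite eqEsubset CS /=.
have clU : adj_closed U C.
  apply/adj_closedP => u v uC vU uv; apply: (clC u v uC _ uv).
  exact: (adj_closedP _ _ (comp_closed U x)) (subsetP CS _ uC) vU uv.
have xC : x \in C.
  apply: (closed_connect yC clU); rewrite (sym_connect_sym (@rst_sym U)).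
  by have := subsetP CS _ yC; rewrite inE => /andP[].
by apply/subsetP => z; rewrite inE => /andP[zU]; apply: closed_connect.
Qed.

Lemma comp_of U x : x \in U -> exists2 D, iscomp U D & x \in D.
Proof.
by move=> xU; exists (comp U x); [apply: iscomp_comp|rewrite inE xU connect0].
Qed.

End Graph.

Ltac pm_subclique cK := apply: clique_pm; [by apply: cliqueS cK; set_dec|].

Ltac pm_edge u v := apply: (@pm_cons _ u v) => //; [by mem_dec|by mem_dec|].

(** * Sumner's theorem *)

Section Sumner.
Variable G : sgraph.
Implicit Types (x y z : G) (S T U V W C D : {set G}).

Definition no_claw := forall c x y z : G, c -- x -> c -- y -> c -- z ->
  x != y -> x != z -> y != z -> [|| x -- y, x -- z | y -- z].

Lemma conn_connect U x y : conn U -> x \in U -> y \in U -> connect (rst U) x y.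
Proof.
move=> cU xU yU; have: y \in comp U x; last by rewrite inE => /andP[].
rewrite (cU x (comp U x)) ?inE ?xU ?connect0 //; last exact: comp_closed.
by apply/subsetP => z; rewrite inE => /andP[].
Qed.

Hypothesis cf : no_claw.

(* Shortens a walk between two uncovered vertices, rotating the matching along
   the first edges; claw-freeness supplies the edge needed for the rotation. *)
Lemma augment n U W u v p :
  size p <= n -> pm W -> W \subset U -> u \in U -> u \notin W -> v \notin W ->
  u != v -> path (rst U) u p -> last u p = v ->
  exists W', [/\ pm W', W' \subset U & #|W| < #|W'|].
Proof.
elim: n W u p => [|n IH] W u [|p1 q] //=.
- by move=> _ _ _ _ _ _ uv _ E; rewrite E eqxx in uv.
- by move=> _ _ _ _ _ _ uv _ E; rewrite E eqxx in uv.
rewrite ltnS => sq pW WU uU uW vW uv /andP[/andP[/andP[_ p1U] up1] pq] lq.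
have [p1W|p1W] := boolP (p1 \in W); last first.
  exists (u |: (p1 |: W)); split.
  - apply: (pm_cons (x := u) (y := p1)) => //; rewrite ?inE ?eqxx ?orbT //.
    have up := adj_neq up1.
    by have -> : (u |: (p1 |: W)) :\ u :\ p1 = W by set_dec.
  - by set_dec.
  - have up := adj_neq up1.
    by rewrite !cardsU1 p1W !inE (negbTE up) (negbTE uW).
have [r rW [p1r pWr]] := pm_partner pW p1W.
have rp1 := adj_neq p1r; have up1n := adj_neq up1.
have rU := subsetP WU _ rW.
(* The free vertex u takes over y, the former partner of x; x becomes free and the number of covered
   vertices is unchanged. *)
have swap x y : x \in W -> y \in W -> x != y -> u -- y -> pm (W :\ x :\ y) ->
    [/\ pm (u |: (W :\ x)), u |: (W :\ x) \subset U, x \notin u |: (W :\ x)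
     & #|u |: (W :\ x)| = #|W|].
  move=> xW yW xy uy pxy; split; [|by set_dec|by mem_dec|].
  - pm_edge u y.
    by have -> : (u |: (W :\ x)) :\ u :\ y = W :\ x :\ y by set_dec.
  - by rewrite cardsU1 !inE (negbTE uW) andbF (cardsD1 x W) xW.
have go x p' : x \in W -> size p' <= n -> path (rst U) x p' -> last x p' = v ->
    [/\ pm (u |: (W :\ x)), u |: (W :\ x) \subset U, x \notin u |: (W :\ x)
     & #|u |: (W :\ x)| = #|W|] ->
    exists W', [/\ pm W', W' \subset U & #|W| < #|W'|].
  move=> xW sp' pp' lp' [pm' sub' nx' card']; rewrite -card'.
  have vx : v \notin u |: (W :\ x) by mem_dec.
  have xv : x != v by mem_dec.
  have xU := subsetP WU _ xW.
  exact: IH sp' pm' sub' xU nx' vx xv pp' lp'.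
case: q sq pq lq => [|p2 q] /= sq pq lq; first by rewrite -lq p1W in vW.
have /andP[/andP[/andP[_ p2U] p12] pq2] := pq.
have pm_rp1 : pm (W :\ r :\ p1) by have <- : W :\ p1 :\ r = W :\ r :\ p1 by set_dec.
have [p2u|p2u] := eqVneq p2 u.
  by subst p2; apply: (IH W u q) => //; apply: ltnW.
have [up2|up2] := boolP (u -- p2).
  by apply: (IH W u (p2 :: q)) => //=; rewrite /rst /= uU p2U up2.
have [p2r|p2r] := eqVneq p2 r.
  subst p2; apply: (go r q) => //; first exact: ltnW.
  by apply: (swap r p1) => //; rewrite eq_sym.
have ur : u != r by mem_dec.
(* [p1] is adjacent to u, [p2] and its partner r, while u and [p2] are not adjacent. If u -- r,
   match u to r and free [p1]; if [p2] -- r, match u to [p1] and free r. Either way the walk from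
   the free vertex to v gets shorter. *)
move: (@cf p1 u p2 r); rewrite adjC up1 p12 p1r eq_sym p2u ur p2r (negbTE up2) /=.
case/(_ isT isT isT isT isT isT)/orP => [urA|p2rA].
  by apply: (go p1 (p2 :: q)) => //=; apply: (swap p1 r).
apply: (go r (p2 :: q)) => //=; first by rewrite /rst /= rU p2U adjC p2rA.
by apply: (swap r p1) => //; rewrite eq_sym.
Qed.

(** As long as two vertices of U are uncovered, a walk between them feeds [augment], and each round
    covers more vertices. *)
Lemma near_perfect U :
  conn U -> exists T, [/\ T \subset U, #|T| <= 1 & pm (U :\: T)].
Proof.
move=> cU; suff H n W : pm W -> W \subset U -> #|U :\: W| <= n ->
    exists T, [/\ T \subset U, #|T| <= 1 & pm (U :\: T)].
  by apply: (H #|U| set0); [apply: pm_nil|apply: sub0set|rewrite setD0].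
elim: n W => [|n IH] W pW WU.
  by move=> l0; exists (U :\: W); rewrite subsetDl (leq_trans l0) // setDDr setDv set0U (setIidPr WU).
move=> leW; have [le1|] := leqP #|U :\: W| 1.
  by exists (U :\: W); rewrite subsetDl le1 setDDr setDv set0U (setIidPr WU).
case/card_gt1P => u [v [/setDP[uU uW] /setDP[vU vW] uv]].
have /connectP[p pp lp] := conn_connect cU uU vU.
have [W' [pW' W'U ltW]] := augment (leqnn _) pW WU uU uW vW uv pp (esym lp).
apply: (IH W') => //; rewrite -ltnS; apply: leq_trans leW; rewrite !cardsD.
rewrite (setIidPr WU) (setIidPr W'U) ltn_sub2l //.
by apply: leq_trans ltW (subset_leq_card W'U).
Qed.

Lemma conn_pm U : conn U -> ~~ odd #|U| -> pm U.
Proof.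
move=> cU eU; have [T [TU]] := near_perfect cU.
rewrite leq_eqVlt ltnS leqn0 cards_eq0 => /orP[|/eqP->]; last by rewrite setD0.
move=> /cards1P[x Tx]; move: TU; rewrite Tx sub1set => xU /pm_even.
by rewrite odd_D1 // negbK (negbTE eU).
Qed.

Lemma comp_rest U D : iscomp U D -> adj_closed U (U :\: D).
Proof.
case=> _ _ /adj_closedP clD _; apply/adj_closedP => x y /setDP[xU xD] yU xy.
by apply/setDP; split=> //; apply: contra xD => yD; apply: clD yD xU _; rewrite adjC.
Qed.

Lemma iscompD U D C : iscomp U D -> iscomp (U :\: D) C -> iscomp U C.
Proof.
move=> cD [CU neC /adj_closedP clC cC]; split=> //; first by apply: subset_trans CU (subsetDl _ _).
apply/adj_closedP => x y xC yU xy; apply: (clC x) => //.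
exact: (adj_closedP _ _ (comp_rest cD)) (subsetP CU _ xC) yU xy.
Qed.

Lemma iscomp_pm U D : pm U -> iscomp U D -> pm D.
Proof. by move=> pU [DU _ clD _]; apply: pm_closed clD. Qed.

(** Even components have perfect matchings by Sumner's theorem; if all components were even, these
    would combine to a perfect matching of U. *)
Lemma odd_comp U : ~ pm U -> exists2 D, iscomp U D & odd #|D|.
Proof.
have [n] := ubnP #|U|; elim: n U => // n IH U; rewrite ltnS => leUn npU.
have [U0|[x xU]] := set_0Vmem U; first by case: npU; apply: pm0.
have [D cD _] := comp_of xU; have [DU [y yD] clD coD] := cD.
have [oD|eD] := boolP (odd #|D|); first by exists D.
have pD := conn_pm coD eD.
case: (IH (U :\: D)) => [||C cC oC].
- apply: leq_trans leUn; rewrite [in ltnRHS](cardsD1 y) (subsetP DU _ yD) ltnS.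
  by apply: subset_leq_card; set_dec.
- move=> pUD; apply: npU; rewrite -[U](setID _ D) (setIidPr DU).
  by apply: pmU => //; set_dec.
- by exists C => //; apply: iscompD cC.
Qed.
End Sumner.

(** * Randomly matchable graphs *)

Section RandomlyMatchable.
Variable G : sgraph.
Implicit Types (x y z : G) (S T U V W C D Z : {set G}).

Record C4_at D c1 c2 c3 c4 : Prop := C4At {
  C4_set : D = [set c1; c2; c3; c4];
  C4_neq : [/\ c1 != c2, c1 != c3, c1 != c4 & [/\ c2 != c3, c2 != c4 & c3 != c4]];
  C4_adj : [/\ c1 -- c2, c2 -- c3, c3 -- c4 & c4 -- c1];
  C4_nadj : ~~ (c1 -- c3) /\ ~~ (c2 -- c4)
}.

Definition isC4 D := exists c1 c2 c3 c4, C4_at D c1 c2 c3 c4.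

(** The connected randomly matchable graphs are $K_{2n}$ and $K_{n,n}$; without claws only even
    cliques and $K_{2,2} = C_4$ remain. The empty set counts as an even clique. *)
Definition good D := ~~ odd #|D| /\ (clique D \/ isC4 D).

Lemma C4_rot D c1 c2 c3 c4 : C4_at D c1 c2 c3 c4 -> C4_at D c2 c3 c4 c1.
Proof.
case=> -> [n12 n13 n14 [n23 n24 n34]] [a12 a23 a34 a41] [b13 b24]; split=> //.
- by set_dec.
- by rewrite ![_ == c1]eq_sym.
- by rewrite [c3 -- _]adjC.
Qed.

Lemma C4_from D x : isC4 D -> x \in D -> exists c2 c3 c4, C4_at D x c2 c3 c4.
Proof.
case=> c1 [c2 [c3 [c4 h]]]; have h2 := C4_rot h; have h3 := C4_rot h2.
have h4 := C4_rot h3; rewrite [in X in X -> _](C4_set h) !inE -!orbA => /or4P[] /eqP->.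
- by exists c2, c3, c4.
- by exists c3, c4, c1.
- by exists c4, c1, c2.
- by exists c1, c2, c3.
Qed.

Lemma C4_two_neighbours D x : isC4 D -> x \in D ->
  exists y z, [/\ y \in D, z \in D, y != z, x -- y & x -- z].
Proof.
move=> cD xD; have [c2 [c3 [c4 [-> [_ _ _ [_ n24 _]] [a12 _ _ a41] _]]]] := C4_from cD xD.
by exists c2, c4; rewrite !inE !eqxx !orbT a12 adjC a41.
Qed.

(** Excluding defect 2 suffices when U has a perfect matching: augmenting paths lower any larger
    defect of a maximal matching to 2, and the uncovered vertices stay independent. *)
Definition randomly_matchable U :=
  forall x y, x \in U -> y \in U -> x != y -> ~~ (x -- y) -> ~ pm (U :\ x :\ y).

(** * Attaching an edge xy to a component of the rest *)

Section Shape.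
Variables (x y : G) (D : {set G}).

(** The two ways to attach an edge xy to D: both ends are complete to a clique, which gives a larger
    clique, or [x w w' y] is a 4-cycle. *)
Definition shape :=
  [/\ clique D, {in D, forall w, x -- w} & {in D, forall w, y -- w}] \/
  exists w w', [/\ D = [set w; w'], w != w', w -- w', x -- w /\ ~~ (x -- w')
                 & y -- w' /\ ~~ (y -- w)].

Lemma shape_sym : shape -> [/\ clique D, {in D, forall w, y -- w} & {in D, forall w, x -- w}] \/
  exists w w', [/\ D = [set w; w'], w != w', w -- w', y -- w /\ ~~ (y -- w')
                 & x -- w' /\ ~~ (x -- w)].
Proof.
case=> [[]|[w [w' [-> n a ? ?]]]]; [by left|right; exists w', w].
by split=> //; [rewrite setUC|rewrite eq_sym|rewrite adjC].
Qed.

(** Matching x into D releases a vertex w of D. Two components could each release one, which gives a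
    forbidden non-adjacent pair. *)
Lemma shape_pm : ~~ odd #|D| -> (exists w, w \in D) -> x \notin D -> shape ->
  exists2 w, w \in D & pm (x |: (D :\ w)).
Proof.
move=> eD [w wD] xD [[cD xc _]|[v [v' [Dv vv' _ [xv _] _]]]].
  have [v vD vw] := even_other eD wD; exists w => //.
  apply: (clique_pm1 (y := v)); [|by rewrite odd_D1|by mem_dec|by mem_dec|exact: xc].
  by apply: cliqueS cD; set_dec.
exists v'; first by rewrite Dv !inE eqxx orbT.
apply: (pm_cons (x := x) (y := v)) => //; [by mem_dec| |].
  by rewrite Dv; mem_dec.
by apply: pm0; rewrite Dv in xD *; set_dec.
Qed.

Hypothesis cf : no_claw G.
Hypotheses (gD : good D) (D0 : exists w, w \in D) (xD : x \notin D) (yD : y \notin D).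
Hypothesis xy : x != y.
Hypothesis touch : exists2 w, w \in D & (x -- w) || (y -- w).
(** Random matchability seen from D: such a matching, completed outside D, would leave exactly the
    non-adjacent pair x, w. *)
Hypothesis Px : {in D, forall w, ~~ (x -- w) -> ~ pm (y |: (D :\ w))}.
Hypothesis Py : {in D, forall w, ~~ (y -- w) -> ~ pm (x |: (D :\ w))}.
Hypothesis Pxy : {in D &, forall u v, u != v -> ~~ (u -- v) ->
  ~ pm (x |: (y |: (D :\ u :\ v)))}.

(** [D :\ w] is an odd clique, so a neighbour of u in it would yield a perfect matching of u
    together with [D :\ w]; only w can be adjacent to u. *)
Lemma shape_clique_aux (u v : G) : clique D -> u \notin D ->
  {in D, forall w, ~~ (v -- w) -> ~ pm (u |: (D :\ w))} ->
  {in D &, forall w t, ~~ (v -- w) -> u -- t -> t = w}.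
Proof.
move=> cD uD P w t wD tD vw ut; apply/eqP/negPn/negP => tw; apply: (P w wD vw).
apply: (clique_pm1 (y := t)) => //; [|by rewrite odd_D1 //; case: gD|by mem_dec|by mem_dec].
by apply: cliqueS cD; set_dec.
Qed.

(** On the cycle [w c2 c3 c4], an edge from u to [c2] or [c4] would leave an edge of the cycle to
    match the rest. Hence u misses both, and an edge from u to w or [c3] would complete a claw with
    legs [c2], [c4] there. *)
Lemma shape_C4_aux (u v : G) : isC4 D -> u \notin D ->
  {in D, forall w, ~~ (v -- w) -> ~ pm (u |: (D :\ w))} ->
  {in D &, forall w t, ~~ (v -- w) -> ~~ (u -- t)}.
Proof.
move=> cD uD P w t wD tD vw; have np := P w wD vw.
have [c2 [c3 [c4 [Dc [n12 n13 n14 [n23 n24 n34]] [a12 a23 a34 a41] [b13 b24]]]]] := C4_from cD wD.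
have u2 : ~~ (u -- c2).
  apply/negP => u2; apply: np; pm_edge u c2.
  pm_edge c3 c4.
  by apply: pm0; set_dec.
have u4 : ~~ (u -- c4).
  apply/negP => u4; apply: np; pm_edge u c4.
  pm_edge c2 c3.
  by apply: pm0; set_dec.
have [c2D c4D] : c2 \in D /\ c4 \in D by rewrite Dc !inE !eqxx !orbT.
have nu (c : G) : c -- c2 -> c -- c4 -> ~~ (u -- c).
  move=> k2 k4; apply/negP => uc.
  have := @cf c u c2 c4; rewrite adjC uc k2 k4 n24 (negbTE u2) (negbTE u4) (negbTE b24) /=.
  have [-> ->] : u != c2 /\ u != c4 by split; mem_dec.
  by move=> /(_ isT isT isT isT isT isT).
move: tD; rewrite [in X in X -> _]Dc !inE -!orbA => /or4P[] /eqP-> //.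
- by apply: nu => //; rewrite adjC.
- by apply: nu => //; rewrite adjC.
Qed.

Lemma shapeP : shape.
Proof.
have [w0 w0D] := D0; have [eD [cD|cD]] := gD.
- have Cx := shape_clique_aux cD yD Px; have Cy := shape_clique_aux cD xD Py.
  have two w : w \in D -> exists2 w', w' \in D & w' != w by apply: even_other.
  have [v vD xv] : exists2 v, v \in D & x -- v.
    case: touch => t tD /orP[xt|yt]; first by exists t.
    have [t' t'D t't] := two t tD.
    exists t' => //; apply/negPn/negP => xt'.
    by move: t't; rewrite -(Cx t' t t'D tD xt' yt) eqxx.
  have [v' v'D yv'] : exists2 v, v \in D & y -- v.
    have [t tD tv] := two v vD.
    exists t => //; apply/negPn/negP => yt.
    by move: tv; rewrite -(Cy t v tD vD yt xv) eqxx.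
  have [xc|] := boolP [forall w in D, x -- w].
    have [yc|] := boolP [forall w in D, y -- w].
      by left; split=> // w wD; [apply: (forall_inP xc)|apply: (forall_inP yc)].
    rewrite negb_forall_in => /exists_inP[w wD yw].
    have [u uD uw] := two w wD.
    by move: uw; rewrite (Cy w u wD uD yw (forall_inP xc u uD)) eqxx.
  rewrite negb_forall_in => /exists_inP[w wD xw].
  have v'w := Cx w v' wD v'D xw yv'.
  have vw : v != w by apply: contraNneq xw => <-.
  have yu u : u \in D -> u != w -> ~~ (y -- u).
    by move=> uD; apply: contra => yu; rewrite (Cx w u wD uD xw yu).
  right; exists v, w; split=> //; [|exact: cD|by rewrite -{1}v'w yu].
  apply/setP => u; rewrite !inE; apply/idP/idP => [uD|/orP[]/eqP->//].
  have [->|uw] := eqVneq u w; first by rewrite orbT.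
  by rewrite (Cy u v uD vD (yu u uD uw) xv) eqxx.
- have Cx := shape_C4_aux cD yD Px; have Cy := shape_C4_aux cD xD Py.
  have tx t : t \in D -> x -- t -> {in D, forall w, y -- w}.
    by move=> tD xt w wD; apply/negPn/negP => yw; move: xt; rewrite (negbTE (Cy w t wD tD yw)).
  have ty t : t \in D -> y -- t -> {in D, forall w, x -- w}.
    by move=> tD yt w wD; apply/negPn/negP => xw; move: yt; rewrite (negbTE (Cx w t wD tD xw)).
  have [xc yc] : {in D, forall w, x -- w} /\ {in D, forall w, y -- w}.
    case: touch => t tD /orP[xt|yt].
      by split; [apply: (ty t tD); apply: (tx t)|apply: tx xt].
    by split; [apply: ty yt|apply: (tx t tD); apply: (ty t)].
  have [c2 [c3 [c4 [Dc [n12 n13 n14 [n23 n24 n34]] _ [b13 b24]]]]] := C4_from cD w0D.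
  have [c2D c3D c4D] : [/\ c2 \in D, c3 \in D & c4 \in D] by rewrite Dc !inE !eqxx !orbT.
  (* Both x and y are complete to the 4-cycle; matched to [c2] and [c4] they leave the opposite
     vertices [w0] and [c3]. So D is never a 4-cycle. *)
  case: (Pxy w0D c3D n13 b13).
  apply: (pm_cons (x := x) (y := c2)) => //; [by mem_dec|by mem_dec|by apply: xc|].
  apply: (pm_cons (x := y) (y := c4)) => //; [by mem_dec|by mem_dec|by apply: yc|].
  by apply: pm0; set_dec.
Qed.
End Shape.
End RandomlyMatchable.

Section Randomly.
Variable G : sgraph.
Implicit Types (x y z : G) (S T U V W C D Z H P : {set G}).
Hypothesis cf : no_claw G.

Lemma comp_setD_pm U D : pm U -> iscomp U D -> pm (U :\: D).
Proof. by move=> pU cD; apply: pm_closed pU (subsetDl _ _) (comp_rest cD). Qed.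

Lemma comp_rm U D : pm U -> randomly_matchable U -> iscomp U D -> randomly_matchable D.
Proof.
move=> pU rU cD x y xD yD xy nxy pD; have [DU _ _ _] := cD.
apply: (rU x y) => //; [by mem_dec|by mem_dec|].
have -> : U :\ x :\ y = (D :\ x :\ y) :|: (U :\: D) by set_dec.
by apply: pmU => //; [apply: comp_setD_pm|set_dec].
Qed.

Lemma comp_anti U D : iscomp U D -> anticomplete D (U :\: D).
Proof.
case=> _ _ /adj_closedP clD _ x y xD /setDP[yU yD]; apply: contra yD.
exact: clD.
Qed.

(** Remove an edge xy of a perfect matching. The rest stays randomly matchable, so by induction its
    components are good and attached to xy as in [shape]. At most one component is possible, and
    either shape makes U good. *)
Lemma randomly_matchable_good U : conn U -> pm U -> randomly_matchable U -> good U.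
Proof.
have [n] := ubnP #|U|; elim: n U => // n IH U; rewrite ltnS => leUn cU pU rU.
split; first exact: pm_even.
have [->|[x xU]] := set_0Vmem U; first by left=> u v; rewrite inE.
have [y yU [xy pU']] := pm_partner pU xU; have nxy := adj_neq xy.
have nyx : y != x by rewrite eq_sym.
set U' := U :\ x :\ y; have xU' : x \notin U' by rewrite !inE eqxx andbF.
have yU' : y \notin U' by rewrite !inE eqxx.
rewrite -/U' in pU'.
have EU : U = x |: (y |: U') by rewrite /U'; set_dec.
have ltU : #|U'| < n by apply: leq_trans leUn; rewrite (cardD2 xU yU nxy).
clearbody U'.
have U'U : U' \subset U by set_dec.
have rU' : randomly_matchable U'.
  move=> u v uU vU uv nuv p; apply: (rU u v) => //; [by mem_dec|by mem_dec|].
  pm_edge x y.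
  by have -> : U :\ u :\ v :\ x :\ y = U' :\ u :\ v by set_dec.
have shD D : iscomp U' D -> [/\ ~~ odd #|D|, exists w, w \in D, x \notin D, y \notin D & shape x y D].
  move=> cD; have [DU [w wD] clD coD] := cD.
  have pD := iscomp_pm pU' cD; have pR := comp_setD_pm pU' cD.
  have [xD yD] : x \notin D /\ y \notin D by split; mem_dec.
  split=> //; [exact: pm_even|by exists w|].
  have gD : good D.
    by apply: IH => //; [apply: leq_ltn_trans (subset_leq_card DU) _|apply: comp_rm cD].
  apply: shapeP => //; first by exists w.
  - apply/exists_inP; have [//|nt] := boolP [exists w in D, (x -- w) || (y -- w)].
    suff DE : D = U by rewrite DE xU in xD.
    apply: (cU w) => //; first exact: subset_trans U'U.
    apply/adj_closedP => u v uD; rewrite EU !inE => /or3P[/eqP->|/eqP->|vU] uv.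
    + by case/negP: nt; apply/exists_inP; exists u; rewrite // [x -- _]adjC uv.
    + by case/negP: nt; apply/exists_inP; exists u; rewrite // [y -- _]adjC uv orbT.
    + exact: (adj_closedP _ _ clD) vU uv.
  - move=> u uD xu pu; apply: (rU x u) => //; [by mem_dec|by mem_dec|].
    have -> : U :\ x :\ u = (y |: (D :\ u)) :|: (U' :\: D) by set_dec.
    by apply: pmU => //; set_dec.
  - move=> u uD yu pu; apply: (rU y u) => //; [by mem_dec|by mem_dec|].
    have -> : U :\ y :\ u = (x |: (D :\ u)) :|: (U' :\: D) by set_dec.
    by apply: pmU => //; set_dec.
  - move=> u v uD vD uv nuv pu; apply: (rU u v) => //; [by mem_dec|by mem_dec|].
    have -> : U :\ u :\ v = (x |: (y |: (D :\ u :\ v))) :|: (U' :\: D) by set_dec.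
    by apply: pmU => //; set_dec.
have [U'0|[w0 w0U]] := set_0Vmem U'.
  left=> u v; rewrite EU U'0 !inE !orbF => /orP[]/eqP-> /orP[]/eqP->; rewrite ?eqxx //.
  by rewrite adjC.
have [D cD w0D] := comp_of w0U; have [eD D0 xD yD sD] := shD D cD.
have [DU _ _ _] := cD.
(* With two components, x matched into one and y into the other would release a vertex on each side,
   and these two are not adjacent. *)
have [DE|[w2 w2R]] := set_0Vmem (U' :\: D); last first.
  have [D2 cD2' w2D] := comp_of w2R; have cD2 := iscompD cD cD2'.
  have [eD2 D20 xD2 yD2 /shape_sym sD2] := shD D2 cD2.
  have [w wD pw] := shape_pm eD D0 xD sD.
  have [v vD2 pv] := shape_pm eD2 D20 yD2 sD2.
  have [D2R _ _ _] := cD2'.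
  have pR := comp_setD_pm (comp_setD_pm pU' cD) cD2'.
  case: (rU w v); [by mem_dec|by mem_dec|by mem_dec| |].
    by apply: (comp_anti cD) => //; apply: (subsetP D2R).
  have -> : U :\ w :\ v = (x |: (D :\ w)) :|: (y |: (D2 :\ v)) :|: (U' :\: D :\: D2).
    by set_dec.
  by apply: pmU pR _; [apply: pmU => //; set_dec|set_dec].
have UD : U = x |: (y |: D) by set_dec.
case: sD => [[cD' xc yc]|[w [w' [Dw nww ww [xw xw'] [yw' yw]]]]].
  left=> u v; rewrite UD !inE => /or3P[/eqP->|/eqP->|uD] /or3P[/eqP->|/eqP->|vD] nuv.
  - by rewrite eqxx in nuv.
  - exact: xy.
  - exact: xc.
  - by rewrite adjC.
  - by rewrite eqxx in nuv.
  - exact: yc.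
  - by rewrite adjC xc.
  - by rewrite adjC yc.
  - exact: cD'.
right; exists x, w, w', y; rewrite Dw in xD yD UD.
move: xD yD; rewrite !inE !negb_or => /andP[xnw xnw'] /andP[ynw ynw'].
split; rewrite ?xnw ?xnw' ?nxy ?nww 1?[_ == y]eq_sym ?ynw ?ynw' //; first by set_dec.
- by split=> //; rewrite eq_sym.
- by rewrite [y -- x]adjC [_ -- y]adjC.
- by rewrite [w -- y]adjC.
Qed.

(** * Matchings that isolate a part of the graph *)

Section Defect.
Hypothesis defect : forall T, independent T -> pm (~: T) -> #|T| <= 1.

(* The only use of the matching of the complement: it leaves a vertex of Z
   uncovered, so any matching of U must extend to a perfect one. *)
Lemma isolating_matching Z U :
  pm (~: (Z :|: U)) -> [disjoint Z & U] -> odd #|Z| -> anticomplete Z U ->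
  pm U /\ forall D, iscomp U D -> good D.
Proof.
move=> pR dZU oZ aZU; have [T0 [T0Z iT0 pT0]] := maximal_pm Z.
have [t tT0] : exists t, t \in T0.
  by apply: odd_nonempty; move: (pm_even pT0); rewrite odd_set_sub // oZ negbK.
(* [T0 :|: T] is independent and its complement is matched in three pieces; it has at most one
   element, and [T0] already supplies it. *)
have key T : T \subset U -> independent T -> pm (U :\: T) -> T = set0.
  move=> TU iT pT; apply/eqP; rewrite -cards_eq0.
  have: #|T0 :|: T| <= 1.
    apply: defect; first by apply: independentU => // u v /(subsetP T0Z) uZ /(subsetP TU); apply: aZU.
    have -> : ~: (T0 :|: T) = ~: (Z :|: U) :|: (Z :\: T0) :|: (U :\: T) by set_dec.
    by apply: pmU => //; [apply: pmU => //; set_dec|set_dec].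
  have dT : [disjoint T0 & T] by set_dec.
  rewrite cardsU disjoint_setI0 // cards0 subn0.
  by have := card_gt0E tT0; case: #|T0| => [|[|?]]; case: #|T|.
have pU : pm U.
  have [T [TU iT pT]] := maximal_pm U.
  by move: (pT); rewrite (key T TU iT pT) setD0.
split=> // D cD; have [_ _ _ coD] := cD.
apply: randomly_matchable_good => //; first exact: iscomp_pm cD.
apply: comp_rm cD => // x y xU yU xy nxy pxy.
have: [set x; y] = set0.
  apply: key; [by set_dec|exact: independent2|].
  by have -> : U :\: [set x; y] = U :\ x :\ y by set_dec.
by move/setP/(_ x); rewrite !inE eqxx.
Qed.
End Defect.

(** The component C of [W :\ p'] that contains p swallows D. By parity it has a vertex e outside D
    and different from p, without neighbours in D, so C is no clique. As a 4-cycle it would contain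
    two vertices of D, e, and the two neighbours of e: five vertices. *)
Lemma good_comp_absurd W D p p' :
  (forall C, iscomp (W :\ p') C -> good C) ->
  p \in W -> p' \in W -> p != p' -> iscomp (W :\ p) D -> ~~ odd #|D| -> p' \notin D ->
  (exists2 d, d \in D & p -- d) -> False.
Proof.
move=> gW pW p'W pp' cD eD p'D [d dD pd].
have [DW _ /adj_closedP clD coD] := cD.
have pD : p \notin D by mem_dec.
have [C cC pC] : exists2 C, iscomp (W :\ p') C & p \in C by apply: comp_of; rewrite !inE pp'.
have [CW _ /adj_closedP clC coC] := cC; have [eC gC] := gW C cC.
have DC : D \subset C.
  have dC : d \in C by apply: clC pd => //; mem_dec.
  apply/setIidPl; apply: (coD d); [by rewrite inE dD dC|exact: subsetIl|].
  apply/adj_closedP => u v /setIP[uD uC] vD uv; rewrite inE vD.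
  by apply: clC uv => //; mem_dec.
have [e /setDP[/setD1P[ep eC'] eD']] : exists e, e \in (C :\ p) :\: D.
  apply: odd_nonempty; rewrite odd_set_sub; last by set_dec.
  by rewrite odd_D1 // eC (negbTE eD).
have eW : e \in W :\ p by mem_dec.
have anti u : u \in D -> ~~ (u -- e) by move=> uD; apply: contra eD'; apply: clD.
case: gC => [cC'|c4].
  by have := anti d dD; rewrite cC' //; [apply: (subsetP DC)|mem_dec].
have [y [z [yC zC yz ey ez]]] := C4_two_neighbours c4 eC'.
have [d' d'D d'd] := even_other eD dD.
have nD u : e -- u -> u \notin D by move=> eu; apply/negP => /anti; rewrite adjC eu.
have [yD zD] := (nD y ey, nD z ez).
have [y_e z_e] := (adj_neq ey, adj_neq ez).
have : #|[set d; d'; e; y; z]| <= #|C|.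
  by apply: subset_leq_card; set_dec.
have -> : #|C| = 4.
  case: c4 => c1 [c2 [c3 [c4 [-> [n12 n13 n14 [n23 n24 n34]] _ _]]]].
  rewrite -!setUA !cardsU1 cards1 !inE !negb_or n12 n13 n14 n23 n24 n34 //.
rewrite -!setUA !cardsU1 cards1.
have [-> -> -> ->] : [/\ d \notin d' |: (e |: (y |: [set z])), d' \notin e |: (y |: [set z]),
   e \notin y |: [set z] & y \notin [set z]] by split; mem_dec.
by [].
Qed.

(** P is the set of attachment vertices of an odd side H. Each [H :\ p] turns out to be connected,
    hence an even clique or a 4-cycle, and the 4-cycle is excluded by deleting other attachment
    vertices. A non-adjacent pair of H then has to contain every attachment vertex. *)
Lemma near_clique H P :
  conn H -> P \subset H ->
  (forall p D, p \in P -> iscomp (H :\ p) D -> good D /\ exists2 q, q \in D & q \in P) ->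
  (forall p x y, p \in P -> x \in H -> y \in H -> p -- x -> p -- y -> x != y ->
     x \notin P -> y \notin P -> x -- y) ->
  (exists p, p \in P) ->
  clique H \/ exists p p', [/\ P = [set p; p'], p != p', ~~ (p -- p') &
    {in H &, forall x y, x != y -> [set x; y] != [set p; p'] -> x -- y}].
Proof.
move=> cH PH gH nP [p0 p0P].
have goodp p : p \in P -> good (H :\ p).
  move=> pP; have pH := subsetP PH _ pP.
  have [->|[x xHp]] := set_0Vmem (H :\ p).
    by split; [rewrite cards0|left=> u v; rewrite inE].
  have [D cD xD] := comp_of xHp; have [gD [q qD qP]] := gH p D pP cD.
  have [DH D0 clD coD] := cD.
  suff -> : H :\ p = D by [].
  apply/eqP; rewrite eqEsubset DH andbT -setD_eq0; apply/negPn/negP => /set0Pn[y yR].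
  have [D2 cD2' yD2] := comp_of yR; have cD2 := iscompD cD cD2'.
  have [_ [q2 q2D2 q2P]] := gH p D2 pP cD2; have [D2R _ _ _] := cD2'.
  have q2H := subsetP PH _ q2P.
  have pq2 : p != q2 by mem_dec.
  (* A second component contains an attachment vertex [q2], so D is an even component of [H :\ p]
     that avoids [q2] but is touched by p. *)
  apply: (@good_comp_absurd H D p q2) => //.
  - by move=> C /(gH _ _ q2P)[].
  - by case: gD.
  - by mem_dec.
  - apply/exists_inP; have [//|nt] := boolP [exists d in D, p -- d].
    have pD : p \notin D by mem_dec.
    suff DE : D = H by rewrite DE pH in pD.
    apply: (cH x) => //; first by set_dec.
    apply/adj_closedP => u v uD vH uv.
    have [vp|vp] := eqVneq v p.
      by case/negP: nt; apply/exists_inP; exists u; rewrite // adjC -vp.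
    by apply: (adj_closedP _ _ clD) uv; rewrite // !inE vp.
have other p : p \in P -> H :\ p = set0 \/ exists2 q, q \in P & q != p.
  move=> pP; have [->|[x xHp]] := set_0Vmem (H :\ p); first by left.
  have [D cD xD] := comp_of xHp; have [_ [q qD qP]] := gH p D pP cD.
  by have [DH _ _ _] := cD; right; exists q => //; mem_dec.
have cHp p : p \in P -> clique (H :\ p).
  move=> pP; have [eHp [//|c4]] := goodp p pP.
  case: (other p pP) => [->|[p' p'P p'p]]; first by move=> u v; rewrite inE.
  have pH := subsetP PH _ pP; have p'H := subsetP PH _ p'P.
  have p'Hp : p' \in H :\ p by mem_dec.
  have [a [m [b h]]] := C4_from c4 p'Hp; have [e _ [p'a am mb bp'] [p'm ab]] := h.
  have [n1 n2 n3 [n4 n5 n6]] := C4_neq h.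
  have [aH bH mH] : [/\ a \in H, b \in H & m \in H] by split; mem_dec.
  have [ap bp mp] : [/\ a != p, b != p & m != p] by split; mem_dec.
  have [eHp' gHp'] := goodp p' p'P.
  have mHp' : m \in H :\ p' by mem_dec.
  have aHp' : a \in H :\ p' by mem_dec.
  have bHp' : b \in H :\ p' by mem_dec.
  case: gHp' => [/(_ a b aHp' bHp' n5)|c4']; first by rewrite (negbTE ab).
  have [u [v [w h']]] := C4_from c4' mHp'.
  have [e' [k1 k2 k3 [k4 k5 k6]] [mu uv vw wm] [mv uw]] := h'.
  (* On the first cycle m misses only p', which is deleted here; so the vertex opposite m on the
     second cycle is p. *)
  have vp : v = p.
    have : v \in H :\ p' by rewrite e' !inE eqxx !orbT.
    rewrite !inE => /andP[vp' vH]; apply/eqP/negPn/negP => vp.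
    have : v \in H :\ p by rewrite !inE vp.
    rewrite e !inE (negbTE vp') /= -!orbA [v == m]eq_sym (negbTE k2) /=.
    by case/orP => /eqP vE; move: mv; rewrite vE ?mb // adjC am.
  subst v; have pm' : ~~ (m -- p) by [].
  have inuw c : c \in H :\ p' -> c -- m -> c != p -> p -- c.
    move=> cH' cm cp; move: (cH'); rewrite e' !inE (negbTE cp) orbF -orbA.
    by case/or3P => /eqP cE; rewrite cE ?sedge_irrefl // in cm *; rewrite adjC.
  have pa : p -- a by apply: inuw.
  have pb : p -- b by apply: inuw => //; rewrite adjC.
  (* If c were an attachment vertex, [H :\ c] would contain the non-adjacent m and p and thus be a
     4-cycle, in which m keeps only one neighbour. *)
  have bad c d : c \in P -> c \in [set a; b] -> H :\ p = [set p'; c; m; d] -> False.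
    move=> cP cab eE; have [_ gHc] := goodp c cP.
    have cm : c != m by mem_dec.
    have mHc : m \in H :\ c by mem_dec.
    have pHc : p \in H :\ c by mem_dec.
    case: gHc => [/(_ m p mHc pHc mp)|]; first by rewrite (negbTE pm').
    move=> c4c; have [y [z [yH zH yz my mz]]] := C4_two_neighbours c4c mHc.
    have only t : t \in H :\ c -> m -- t -> t = d.
      move=> /setD1P[tc tH] mt; have tp : t != p by apply: contraNneq pm' => <-.
      have : t \in H :\ p by rewrite !inE tp.
      rewrite eE !inE (negbTE tc) orbF -orbA => /or3P[]/eqP// tE.
      - by move: mt; rewrite tE adjC (negbTE p'm).
      - by move: mt; rewrite tE sedge_irrefl.
    by rewrite (only y) // (only z) ?eqxx in yz.
  have [aP|aP] := boolP (a \in P).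
    by case: (bad a b) => //; rewrite !inE eqxx.
  have [bP|bP] := boolP (b \in P).
    by case: (bad b a) => //; [rewrite !inE eqxx orbT|set_dec].
  (* Neither a nor b is an attachment vertex, so as common neighbours of one they would be
     adjacent. *)
  by rewrite (nP p a b) in ab.
have [cl|] := boolP [forall x in H, forall y in H, (x != y) ==> (x -- y)].
  left=> x y xH yH; apply/implyP; exact: (forall_inP (forall_inP cl x xH)).
rewrite negb_forall_in => /exists_inP[x xH].
rewrite negb_forall_in => /exists_inP[y yH]; rewrite negb_imply => /andP[xy nxy].
(* Deleting an attachment vertex other than x and y would keep this non-adjacent pair inside a
   clique. *)
have inxy p : p \in P -> p \in [set x; y].
  move=> pP; apply/negPn/negP; rewrite !inE negb_or => /andP[px py].
  by move: nxy; rewrite (cHp p pP) // !inE eq_sym ?px ?py.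
have [q qP qp0] : exists2 q, q \in P & q != p0.
  case: (other p0 p0P) => // H0; have [xp yp] : x == p0 /\ y == p0.
    by split; apply/negPn/negP => np; [move/setP/(_ x): H0|move/setP/(_ y): H0]; rewrite !inE np ?xH ?yH.
  by rewrite (eqP xp) (eqP yp) eqxx in xy.
have PE : P = [set x; y].
  apply/eqP; rewrite eqEsubset; apply/andP; split; first exact/subsetP.
  have := inxy q qP; have := inxy p0 p0P; rewrite !inE.
  by case/orP => /eqP E0 /orP[]/eqP E1; move: qp0 p0P qP; rewrite E0 E1 ?eqxx // => _ ? ?; apply/subsetP => u; rewrite !inE => /orP[]/eqP->.
right; exists x, y; split=> // u v uH vH uv uvxy.
have [xP yP] : x \in P /\ y \in P by rewrite PE !inE !eqxx orbT.
have [xin|xin] := boolP (x \in [set u; v]); last first.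
  by move: xin; rewrite !inE negb_or => /andP[xu xv]; apply: (cHp x xP); rewrite // !inE eq_sym ?xu ?xv.
have [yin|yin] := boolP (y \in [set u; v]); last first.
  by move: yin; rewrite !inE negb_or => /andP[yu yv]; apply: (cHp y yP); rewrite // !inE eq_sym ?yu ?yv.
case/negP: uvxy; rewrite eq_sym eqEcard !cards2 uv xy andbT.
by apply/subsetP => t; rewrite [in X in X -> _]inE => /orP[]/set1P->.
Qed.
End Randomly.

(** * Isomorphisms and separations *)

Section Isomorphisms.
Variable G : sgraph.
Implicit Types (x y z : G) (S T U V W C D A B : {set G}).

Lemma induced_isoP U (H : sgraph) :
  isomorphic (induced U) H <->
  exists g : H -> G, [/\ injective g, forall x, (x \in U) = (x \in codom g)
                       & forall i j, (g i -- g j) = (i -- j)].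
Proof.
split=> [[f [h fK hK] fE]|[g [gI gU gE]]].
  exists (fun i => val (h i)); split.
  - by move=> i j /val_inj /(can_inj hK).
  - move=> x; apply/idP/codomP => [xU|[i ->]]; last exact: valP (h i).
    by exists (f (Sub x xU)); rewrite fK.
  - by move=> i j; rewrite -[in RHS](hK i) -[in RHS](hK j) fE.
have inU i : g i \in U by rewrite gU codom_f.
have inC (x : induced U) : val x \in codom g by rewrite -gU (valP x).
exists (fun x : induced U => iinv (inC x)); last by move=> x y; rewrite -gE !f_iinv.
exists (fun i => Sub (g i) (inU i)) => [x|i].
- by apply: val_inj; rewrite /= f_iinv.
- by apply: gI; rewrite f_iinv.
Qed.

Lemma isomorphicT (H : sgraph) :
  isomorphic (induced [set: G]) H <-> isomorphic G H.
Proof.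
split=> [/induced_isoP[g [gI gU gE]]|[f [h fK hK] fE]].
  have inC (x : G) : x \in codom g by rewrite -gU inE.
  exists (fun x => iinv (inC x)); last by move=> x y; rewrite -gE !f_iinv.
  by exists g => [x|i]; [rewrite f_iinv|apply: gI; rewrite f_iinv].
apply/induced_isoP; exists h; split.
- exact: can_inj hK.
- by move=> x; rewrite inE; apply/esym/codomP; exists (f x); rewrite fK.
- by move=> i j; rewrite -[in RHS](hK i) -[in RHS](hK j) fE.
Qed.

Lemma complete_inducedP U : complete (induced U) <-> clique U.
Proof.
split=> [c x y xU yU xy|c x y xy].
  by apply: (c (Sub x xU) (Sub y yU)); apply: contra xy => /eqP [->].
by apply: c; rewrite ?(valP x) ?(valP y).
Qed.

Lemma iso_completeP U n :
  isomorphic (induced U) (complete_graph n) <-> clique U /\ #|U| = n.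
Proof.
split=> [/induced_isoP[g [gI gU gE]]|[cU <-]].
  split=> [x y|]; last first.
    by rewrite (eq_card gU) card_codom // card_ord.
  rewrite !gU => /codomP[i ->] /codomP[j ->] gij; rewrite gE /= /complete_rel /=.
  by apply: contra gij => /eqP->.
apply/induced_isoP; exists enum_val; split.
- exact: enum_val_inj.
- move=> x; apply/idP/codomP => [xU|[i ->]]; last exact: enum_valP.
  by exists (enum_rank_in xU x); rewrite enum_rankK_in.
- move=> i j; rewrite /= /complete_rel /=; have [->|ij] := eqVneq i j.
    by rewrite sedge_irrefl.
  by apply: cU; rewrite ?enum_valP // (inj_eq enum_val_inj).
Qed.

Lemma seq_isoP U n (e : rel 'I_n) (eS : symmetric e) (eI : irreflexive e) :
  isomorphic (induced U) (SGraph eS eI) <->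
  exists2 t : n.-tuple G, uniq t /\ U =i t &
    forall i j : 'I_n, (tnth t i -- tnth t j) = e i j.
Proof.
split=> [/induced_isoP[g [gI gU gE]]|[t [ut Ut] tE]].
  exists (map_tuple g (ord_tuple n)); last by move=> i j; rewrite !tnth_map !tnth_ord_tuple gE.
  split; first by rewrite map_inj_uniq //= enum_uniq.
  by move=> x; rewrite gU codomE.
apply/induced_isoP; exists (tnth t); split=> //.
- by apply/tuple_uniqP.
- move=> x; rewrite Ut; apply/tnthP/codomP => -[i ->]; by exists i.
Qed.

Lemma iso_C4P U : isomorphic (induced U) (cycle_graph 4) <-> isC4 U.
Proof.
split=> [/seq_isoP[[[|a [|b [|c [|d [|]]]]] //= ts] [ut Ut] tE]|].
  exists a, b, c, d.
  have E (i j : 'I_4) := tE i j.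
  have := (E (inord 0) (inord 1), E (inord 1) (inord 2), E (inord 2) (inord 3),
     E (inord 3) (inord 0), E (inord 0) (inord 2), E (inord 1) (inord 3)).
  rewrite !(tnth_nth a) /cycle_rel /= -!val_eqE /= !inordK //=.
  move=> [[[[[ab bc] cd] da] ac] bd].
  move: ut; rewrite /= !inE !negb_or -!andbA => /and5P[n1 n2 n3 n4 /and3P[n5 n6 _]].
  split=> //; rewrite ?ac ?bd //.
  by apply/setP => x; rewrite Ut !inE -!orbA.
case=> a [b [c [d [Ue [n1 n2 n3 [n4 n5 n6]] [ab bc cd da] [ac bd]]]]].
apply/seq_isoP; exists [tuple a; b; c; d]; first split.
- by rewrite /= !inE !negb_or n1 n2 n3 n4 n5 n6.
- by move=> x; rewrite Ue !inE -!orbA.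
- case=> [[|[|[|[|//]]]] i] [[|[|[|[|//]]]] j]; rewrite !(tnth_nth a) /cycle_rel /= -?val_eqE /=;
  by rewrite ?sedge_irrefl ?ab ?bc ?cd ?da ?(negbTE ac) ?(negbTE bd) // adjC ?ab ?bc ?cd ?da ?(negbTE ac) ?(negbTE bd).
Qed.

Record P4_at D c1 c2 c3 c4 : Prop := P4At {
  P4_set : D = [set c1; c2; c3; c4];
  P4_neq : [/\ c1 != c2, c1 != c3, c1 != c4 & [/\ c2 != c3, c2 != c4 & c3 != c4]];
  P4_adj : [/\ c1 -- c2, c2 -- c3 & c3 -- c4];
  P4_nadj : [/\ ~~ (c1 -- c3), ~~ (c2 -- c4) & ~~ (c1 -- c4)]
}.

Lemma iso_P4P U :
  isomorphic (induced U) (path_graph 4) <-> exists c1 c2 c3 c4, P4_at U c1 c2 c3 c4.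
Proof.
split=> [/seq_isoP[[[|a [|b [|c [|d [|]]]]] //= ts] [ut Ut] tE]|].
  exists a, b, c, d.
  have E (i j : 'I_4) := tE i j.
  have := (E (inord 0) (inord 1), E (inord 1) (inord 2), E (inord 2) (inord 3),
     E (inord 0) (inord 3), E (inord 0) (inord 2), E (inord 1) (inord 3)).
  rewrite !(tnth_nth a) /path_rel /= !inordK //=.
  move=> [[[[[ab bc] cd] ad] ac] bd].
  move: ut; rewrite /= !inE !negb_or -!andbA => /and5P[n1 n2 n3 n4 /and3P[n5 n6 _]].
  split=> //; rewrite ?ac ?bd ?ad //.
  by apply/setP => x; rewrite Ut !inE -!orbA.
case=> a [b [c [d [Ue [n1 n2 n3 [n4 n5 n6]] [ab bc cd] [ac bd ad]]]]].
apply/seq_isoP; exists [tuple a; b; c; d]; first split.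
- by rewrite /= !inE !negb_or n1 n2 n3 n4 n5 n6.
- by move=> x; rewrite Ue !inE -!orbA.
- case=> [[|[|[|[|//]]]] i] [[|[|[|[|//]]]] j]; rewrite !(tnth_nth a) /path_rel /=;
  by rewrite ?sedge_irrefl ?ab ?bc ?cd ?(negbTE ad) ?(negbTE ac) ?(negbTE bd) // adjC
     ?ab ?bc ?cd ?(negbTE ad) ?(negbTE ac) ?(negbTE bd).
Qed.

Lemma iso_C7 (a b c d e f g : G) :
  uniq [:: a; b; c; d; e; f; g] ->
  (forall x, x \in [:: a; b; c; d; e; f; g]) ->
  [/\ a -- b, b -- c, c -- d & [/\ d -- e, e -- f, f -- g & g -- a]] ->
  [/\ ~~ (a -- c), ~~ (b -- d), ~~ (c -- e) & [/\ ~~ (d -- f), ~~ (e -- g), ~~ (f -- a) & ~~ (g -- b)]] ->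
  [/\ ~~ (a -- d), ~~ (b -- e), ~~ (c -- f) & [/\ ~~ (d -- g), ~~ (e -- a), ~~ (f -- b) & ~~ (g -- c)]] ->
  isomorphic G (cycle_graph 7).
Proof.
move=> us all [ab bc cd [de ef fg ga]] [ac bd ce [df eg fa gb]] [ad be cf [dg ea fb gc]].
apply/isomorphicT/seq_isoP; exists [tuple a; b; c; d; e; f; g].
  by split=> // x; rewrite inE; apply/esym/all.
case=> [[|[|[|[|[|[|[|//]]]]]]] i] [[|[|[|[|[|[|[|//]]]]]]] j];
  rewrite !(tnth_nth a) /cycle_rel /= -?val_eqE /=;
  do 2 rewrite ?sedge_irrefl ?ab ?bc ?cd ?de ?ef ?fg ?ga
    ?(negbTE ac) ?(negbTE bd) ?(negbTE ce) ?(negbTE df) ?(negbTE eg) ?(negbTE fa) ?(negbTE gb)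
    ?(negbTE ad) ?(negbTE be) ?(negbTE cf) ?(negbTE dg) ?(negbTE ea) ?(negbTE fb) ?(negbTE gc) //
    1?adjC.
Qed.

Lemma comp_unique U D x : iscomp U D -> x \in D -> comp U x = D.
Proof.
case=> DU _ clD coD xD; have [KU _ /adj_closedP clK coK] := iscomp_comp (subsetP DU x xD).
have xK : x \in comp U x by rewrite inE (subsetP DU) ?connect0.
have sub A B : x \in A -> x \in B -> A \subset U -> adj_closed U B -> conn A -> A \subset B.
  move=> xA xB AU /adj_closedP clB cA; apply/setIidPl; apply: (cA x).
  - by rewrite inE xA xB.
  - exact: subsetIl.
  - apply/adj_closedP => u v /setIP[uA uB] vA uv; rewrite inE vA.
    by apply: clB uv => //; apply: (subsetP AU).
apply/eqP; rewrite eqEsubset; apply/andP; split; apply: sub => //.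
exact/adj_closedP.
Qed.

Record separation S A B : Prop := Separation {
  sep_l : iscomp (~: S) A;
  sep_r : iscomp (~: S) B;
  sep_disj : [disjoint A & B];
  sep_cover : ~: S = A :|: B
}.

Lemma componentsE U : components U = [set comp U x | x in U].
Proof. by []. Qed.

Lemma separationP S A B : two_components_without S A B <-> separation S A B.
Proof.
split=> [[AB cE]|[cA cB dAB cov]].
  have cmp C : C \in [set A; B] -> iscomp (~: S) C.
    by rewrite -cE componentsE => /imsetP[x xS ->]; apply: iscomp_comp.
  have [cA cB] : iscomp (~: S) A /\ iscomp (~: S) B by split; apply: cmp; rewrite !inE eqxx ?orbT.
  split=> //.
    rewrite -setI_eq0; apply/negPn/negP => /set0Pn[x /setIP[xA xB]].
    by move: AB; rewrite -(comp_unique cA xA) -(comp_unique cB xB) eqxx.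
  apply/eqP; rewrite eqEsubset subUset.
  have [-> _ _ _] := cA; have [-> _ _ _] := cB; rewrite !andbT.
  apply/subsetP => x xS; have : comp (~: S) x \in [set A; B].
    by rewrite -cE componentsE imset_f.
  have xx : x \in comp (~: S) x by rewrite inE xS connect0.
  by rewrite !inE => /orP[]/eqP <-; rewrite xx ?orbT.
have [AS [a aA] _ _] := cA; have [BS [b bB] _ _] := cB.
split; first by apply: contraTneq dAB => <-; rewrite -setI_eq0 setIid; apply/set0Pn; exists a.
rewrite componentsE; apply/setP => C; apply/imsetP/set2P => [[x xS ->]|[]->].
- move: xS; rewrite [in X in X -> _]cov => /setUP[xA|xB]; [left; exact: (comp_unique cA)|right; exact: (comp_unique cB)].
- by exists a; [apply: (subsetP AS)|rewrite (comp_unique cA)].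
- by exists b; [apply: (subsetP BS)|rewrite (comp_unique cB)].
Qed.
End Isomorphisms.

(** * Cut vertices *)

(** What is left of the direct part once even order and independence number at most 2 are
    settled. *)
Record critical (G : sgraph) : Prop := Critical {
  crit_claw : no_claw G;
  crit_conn : conn [set: G];
  crit_odd : odd #|G|;
  crit_defect : forall T : {set G}, independent T -> pm (~: T) -> #|T| <= 1;
  crit_triple : exists x y z : G, [/\ x != y, x != z, y != z &
    [/\ ~~ (x -- y), ~~ (x -- z) & ~~ (y -- z)]]
}.

Section Critical.
Variable G : sgraph.
Implicit Types (x y z : G) (S T U V W C D A B Z H P K L : {set G}).
Hypothesis HG : critical G.

Let cf := crit_claw HG.

Lemma claw3 c x y z : c -- x -> c -- y -> c -- z -> x != y -> x != z -> y != z ->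
  ~~ (x -- y) -> ~~ (x -- z) -> y -- z.
Proof.
move=> cx cy cz xy xz yz nxy nxz; have := cf cx cy cz xy xz yz.
by rewrite (negbTE nxy) (negbTE nxz).
Qed.

Definition connb U := [forall x in U, comp U x == U].

Lemma connP U : reflect (conn U) (connb U).
Proof.
apply: (iffP forall_inP) => [H x C xC CU clC|cU x xU].
  have xU := subsetP CU x xC; apply/eqP; rewrite eqEsubset CU -(eqP (H x xU)).
  by apply/subsetP => y; rewrite inE => /andP[yU]; apply: closed_connect.
have [KU _ clK _] := iscomp_comp xU.
by apply/eqP; apply: (cU x) => //; rewrite inE xU connect0.
Qed.

Lemma not_conn U : ~ conn U -> exists2 D, iscomp U D & exists x, x \in U :\: D.
Proof.
move/connP; rewrite negb_forall_in => /exists_inP[x xU ne].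
exists (comp U x); first exact: iscomp_comp.
apply/set0Pn; rewrite setD_eq0; apply: contra ne => sub; rewrite eqEsubset sub andbT.
by have [] := iscomp_comp xU.
Qed.

Lemma conn_iscomp U : conn U -> (exists x, x \in U) -> iscomp U U.
Proof.
move=> cU U0; split=> //.
by apply/adj_closedP.
Qed.

(** If s had no neighbour in D, then D would be closed in the connected set W without containing
    s. *)
Lemma touch W D s : conn W -> s \in W -> s \notin D -> D \subset W ->
  adj_closed (W :\ s) D -> (exists x, x \in D) -> exists2 d, d \in D & s -- d.
Proof.
move=> cW sW sD DW /adj_closedP clD [x xD].
apply/exists_inP; have [//|nt] := boolP [exists d in D, s -- d].
suff DE : D = W by rewrite DE sW in sD.
apply: (cW x) => //; apply/adj_closedP => u v uD vW uv.
have [vs|vs] := eqVneq v s; last by apply: clD uv; rewrite // !inE vs.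
by case/negP: nt; apply/exists_inP; exists u; rewrite // adjC -vs.
Qed.

Lemma odd_setC S : odd #|~: S| = ~~ odd #|S|.
Proof. by rewrite -setTD odd_set_sub ?subsetT // cardsT (crit_odd HG). Qed.

Lemma no_triple x y z : x != y -> ~~ (x -- y) -> ~~ (x -- z) -> ~~ (y -- z) ->
  ~ pm (~: [set x; y; z]).
Proof.
move=> xy nxy nxz nyz /(crit_defect HG (independent3 nxy nxz nyz)).
rewrite leqNgt => /negP; apply; apply/card_gt1P; exists x, y.
by rewrite !inE !eqxx !orbT.
Qed.

Lemma no_two_cliques A B : clique A -> clique B -> (forall x, (x \in A) || (x \in B)) -> False.
Proof.
move=> cA cB cov; have [x [y [z [xy xz yz [nxy nxz nyz]]]]] := crit_triple HG.
have bad u v C : clique C -> u != v -> ~~ (u -- v) -> u \in C -> v \in C -> False.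
  by move=> cC uv nuv uC vC; rewrite cC in nuv.
by case/orP: (cov x) => hx; case/orP: (cov y) => hy; case/orP: (cov z) => hz;
  solve [exact: (bad x y A)|exact: (bad x y B)|exact: (bad x z A)|exact: (bad x z B)
        |exact: (bad y z A)|exact: (bad y z B)].
Qed.

Lemma anti_sep S A B : separation S A B -> anticomplete A B.
Proof.
case=> cA cB dAB _ x y xA yB; have [BS _ _ _] := cB.
by apply: (comp_anti cA) => //; have yS := subsetP BS y yB; mem_dec.
Qed.

Lemma sep_sym S A B : separation S A B -> separation S B A.
Proof. by case=> cA cB dAB cov; split; rewrite // 1?disjoint_sym // setUC. Qed.

Lemma sep_notin S A B s : separation S A B -> s \in S -> s \notin A /\ s \notin B.
Proof.
case=> [[AS _ _ _] [BS _ _ _] _ _] sS.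
by split; apply/negP; [move/(subsetP AS)|move/(subsetP BS)]; rewrite inE sS.
Qed.

(* A vertex with neighbours in three components would be the centre of a claw. *)
Lemma two_comps S s A : iscomp (~: S) A -> (exists x, x \in ~: S :\: A) ->
  (forall C, iscomp (~: S) C -> exists2 c, c \in C & s -- c) ->
  separation S A (~: S :\: A).
Proof.
move=> cA [x xR] tch; have [D cD' xD] := comp_of xR; have cD := iscompD cA cD'.
have [AS A0 clA _] := cA; have [DS D0 clD _] := cD; have [DR _ _ _] := cD'.
suff RD : ~: S :\: A = D by rewrite RD; split=> //; [set_dec|set_dec].
apply/eqP; rewrite eqEsubset DR andbT -setD_eq0; apply/negPn/negP => /set0Pn[y yR].
have [C cC' yC] := comp_of yR; have cC := iscompD cA (iscompD cD' cC').
have [CR _ _ _] := cC'.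
have [[a aA sa] [d dD sd] [c cC0 sc]] := And3 (tch A cA) (tch D cD) (tch C cC).
have := cf sa sd sc; have nad : a != d by mem_dec.
have -> /= : a != c by mem_dec.
have -> /= : d != c by mem_dec.
rewrite nad (negbTE (comp_anti cA aA (_ : d \in _))); last by mem_dec.
rewrite (negbTE (comp_anti cA aA (_ : c \in _))); last by mem_dec.
rewrite (negbTE (comp_anti cD dD (_ : c \in _))); last by mem_dec.
by move/(_ isT isT isT).
Qed.

Lemma cut_vertex_sep v A : iscomp (~: [set v]) A ->
  (exists x, x \in ~: [set v] :\: A) -> separation [set v] A (~: [set v] :\: A).
Proof.
move=> cA R0; apply: (two_comps (s := v)) => // C [CS C0 clC _].
apply: (touch (crit_conn HG)) => //; last by rewrite -setTD in clC.
by apply/negP => /(subsetP CS); rewrite !inE eqxx.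
Qed.

(** Otherwise x, y and a neighbour of v in B form a claw at v. *)
Lemma cut_clique v A B x y : separation [set v] A B -> x \in A -> y \in A ->
  x != y -> v -- x -> v -- y -> x -- y.
Proof.
move=> sAB xA yA xy vx vy; have sBA := sep_sym sAB.
have [BS B0 clB _] := sep_r sAB; have dAB := sep_disj sAB.
have [b bB vb] : exists2 b, b \in B & v -- b.
  apply: (touch (crit_conn HG)) => //.
    by apply/negP => /(subsetP BS); rewrite !inE eqxx.
  by move: clB; rewrite -setTD.
have aBA := anti_sep sBA.
by apply: (claw3 vb) => //; rewrite ?(aBA b) //; mem_dec.
Qed.

Lemma sep_touch v A B : separation [set v] A B -> exists2 a, a \in A & v -- a.
Proof.
move=> sAB; have [AS A0 clA _] := sep_l sAB.
apply: (touch (crit_conn HG)) => //.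
  by apply/negP => /(subsetP AS); rewrite !inE eqxx.
by move: clA; rewrite -setTD.
Qed.

(** Matching v to some b in B leaves the odd set [B :\ b] as the isolating part. *)
Lemma cut_good v A B : separation [set v] A B -> ~~ odd #|A| -> good A.
Proof.
move=> sAB eA; have [b bB vb] := sep_touch (sep_sym sAB).
have cov := sep_cover sAB; have dAB := sep_disj sAB; have aAB := anti_sep sAB.
have [vA vB] := sep_notin sAB (set11 v).
have oB : ~~ odd #|B|.
  by have := odd_setC [set v]; rewrite cov odd_disjU // (negbTE eA) cards1 /= => ->.
have [||||_ gA] := isolating_matching cf (crit_defect HG) (Z := B :\ b) (U := A).
- pm_edge v b.
  by apply: pm0; set_dec.
- by set_dec.
- by rewrite odd_D1.
- by move=> x y /setD1P[_ xB] yA; rewrite adjC aAB.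
- have [_ A0 _ coA] := sep_l sAB; exact: gA (conn_iscomp coA A0).
Qed.

(** The neighbours of v in A form a clique, so a 4-cycle contains at most two of them, adjacent
    ones. A single neighbour would be the centre of a claw formed by v and its two cycle
    neighbours. *)
Lemma cut_G1_component v A B : separation [set v] A B -> ~~ odd #|A| -> G1_component v A.
Proof.
move=> sAB eA; have [_ gA] := cut_good sAB eA.
split; first by case: gA => [/complete_inducedP|/iso_C4P]; [left|right].
move=> /iso_C4P cA; have [a aA va] := sep_touch sAB.
have [vA vB] := sep_notin sAB (set11 v).
have [c2 [c3 [c4 [Ae [n12 n13 n14 [n23 n24 n34]] [a12 a23 a34 a41] [b13 b24]]]]] := C4_from cA aA.
have [i2 i3 i4] : [/\ c2 \in A, c3 \in A & c4 \in A] by rewrite Ae !inE !eqxx !orbT.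
have cl := cut_clique sAB.
have v3 : ~~ (v -- c3) by apply: contra b13 => v3; apply: cl.
have [v2|v2] := boolP (v -- c2).
  have v4 : ~~ (v -- c4) by apply: contra b24 => v4; apply: cl.
  exists a, c2; split=> //; apply/setP => u; rewrite !inE; apply/andP/idP.
    case=> vu; rewrite Ae !inE -!orbA => /or4P[] /eqP E; rewrite E ?eqxx ?orbT // in vu *;
    by [rewrite vu in v3|rewrite vu in v4].
  by case/orP => /eqP->.
have v4 : v -- c4.
  apply: (@claw3 a c2 v c4) => //; rewrite 1?adjC // ?[c2 -- v]adjC //; first by mem_dec.
  by mem_dec.
exists a, c4; split; first by rewrite adjC.
apply/setP => u; rewrite !inE; apply/andP/idP.
  case=> vu; rewrite Ae !inE -!orbA => /or4P[] /eqP E; rewrite E ?eqxx ?orbT // in vu *;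
  by [rewrite vu in v3|rewrite vu in v2].
by case/orP => /eqP->.
Qed.

(** Otherwise the cliques [v |: K] and L cover G, and no independent triple fits. *)
Lemma sep_non_neighbour v K L : separation [set v] K L -> clique K -> clique L ->
  exists2 x, x \in K & ~~ (v -- x).
Proof.
move=> sKL cK cL; apply/exists_inP; rewrite -negb_forall_in; apply/negP => /forall_inP vK.
apply: (@no_two_cliques (v |: K) L) => //.
  move=> x y; rewrite !inE => /orP[/eqP->|xK] /orP[/eqP->|yK] xy.
  - by rewrite eqxx in xy.
  - exact: vK.
  - by rewrite adjC vK.
  - exact: cK.
move=> x; rewrite !inE -orbA; have [//|/= xv] := eqVneq x v.
by move/setP/(_ x): (sep_cover sKL); rewrite !inE xv => <-.
Qed.

Lemma cut_even v A : iscomp (~: [set v]) A -> (exists x, x \in ~: [set v] :\: A) ->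
  ~~ odd #|A| -> inG1 G.
Proof.
move=> cA R0 eA; have sAB := cut_vertex_sep cA R0; move: (_ :\: A) sAB => B sAB {R0}.
have cov := sep_cover sAB; have sBA := sep_sym sAB.
have oB : ~~ odd #|B|.
  by have := odd_setC [set v]; rewrite cov odd_disjU ?(sep_disj sAB) // (negbTE eA) cards1 /= => ->.
exists v, A, B; split; [exact/separationP|exact: cut_G1_component sAB eA|exact: cut_G1_component sBA oB|].
move=> [/complete_inducedP clA /complete_inducedP clB].
by split; [apply: sep_non_neighbour sAB _ _|apply: sep_non_neighbour sBA _ _].
Qed.

(** Matching v to a neighbour p in A leaves the odd set B to isolate [A :\ p]. If every component
    left meets the neighbourhood of v, [near_clique] applies, and its exceptional case contradicts
    [cut_clique]. If some component does not, p is a cut vertex with an even component. *)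
Lemma cut_odd_clique v A B : separation [set v] A B -> odd #|A| -> odd #|B| ->
  inG1 G \/ clique A.
Proof.
move=> sAB oA oB; have [AS A0 clA coA] := sep_l sAB.
have [a aA va] := sep_touch sAB.
have cov := sep_cover sAB; have dAB := sep_disj sAB; have aAB := anti_sep sAB.
have [vA vB] := sep_notin sAB (set11 v).
pose P := [set x in A | v -- x].
have gAp p D : p \in P -> iscomp (A :\ p) D -> good D.
  rewrite inE => /andP[pA vp] cD.
  have [||||_ gA] := isolating_matching cf (crit_defect HG) (Z := B) (U := A :\ p).
  - pm_edge v p.
    by apply: pm0; set_dec.
  - by set_dec.
  - by [].
  - by move=> x y xB /setD1P[_ yA]; rewrite adjC aAB.
  - exact: gA.
have [meet|] := boolP [forall p in P, forall x in A :\ p, [exists q in P, q \in comp (A :\ p) x]].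
  right; case: (@near_clique G A P) => //.
  - by apply/subsetP => x; rewrite inE => /andP[].
  - move=> p D pP cD; split; first exact: gAp cD.
    have [DA [x xD] _ _] := cD; have xA := subsetP DA x xD.
    have /exists_inP[q qP] := forall_inP (forall_inP meet p pP) x xA.
    by rewrite (comp_unique cD xD) => qD; exists q.
  - move=> p x y; rewrite !inE => /andP[pA vp] xA yA px py xy; rewrite xA yA => vx vy.
    by apply: (@claw3 p v x y) => //; rewrite 1?adjC //; mem_dec.
  - by exists a; rewrite inE aA va.
  - move=> [p [p' [PE pp' npp' _]]]; have [] : p \in P /\ p' \in P by rewrite PE !inE !eqxx orbT.
    rewrite !inE => /andP[pA vp] /andP[p'A vp'].
    by rewrite (cut_clique sAB pA p'A) in npp'.
rewrite negb_forall_in => /exists_inP[p pP].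
rewrite negb_forall_in => /exists_inP[x xAp]; rewrite negb_exists_in => /forall_inP nm.
have cD := iscomp_comp xAp; move: (comp _ _) nm cD => D nm cD; left.
have [eD _] := gAp p D pP cD; have [DA D0 /adj_closedP clD coD] := cD.
move: pP; rewrite inE => /andP[pA vp].
(* No vertex of D is adjacent to v, so p alone separates the even set D. *)
apply: (@cut_even p D) => //; last by exists v; mem_dec.
split=> //; first by set_dec.
apply/adj_closedP => u w uD wp uw; have uA : u \in A by mem_dec.
have [wv|wv] := eqVneq w v.
  have uP : u \in P by rewrite inE uA adjC -wv.
  by have := nm u uP; rewrite uD.
have : (w \in A) || (w \in B) by mem_dec.
case/orP => [wA|wB]; last by move: uw; rewrite (negbTE (aAB u w uA wB)).
by apply: clD uw => //; mem_dec.
Qed.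

Lemma cut_vertex (v : G) : ~ conn (~: [set v]) -> inG1 G.
Proof.
move=> /not_conn[A cA R0]; have [oA|eA] := boolP (odd #|A|); last exact: cut_even cA R0 eA.
have sAB := cut_vertex_sep cA R0; move: (_ :\: A) sAB => B sAB {R0}.
have cov := sep_cover sAB; have sBA := sep_sym sAB; have dAB := sep_disj sAB.
have oB : odd #|B|.
  by have := odd_setC [set v]; rewrite cov odd_disjU // oA cards1 /= => /negbFE.
case: (cut_odd_clique sAB oA oB) => // clA; case: (cut_odd_clique sBA oB oA) => // clB.
have [vA vB] := sep_notin sAB (set11 v).
have [x xA vx] := sep_non_neighbour sAB clA clB; have [y yB vy] := sep_non_neighbour sBA clB clA.
(* The sides are odd cliques and v misses x and y, so two even cliques remain outside the triple. *)
case: (@no_triple v x y) => //; [by mem_dec|exact: (anti_sep sAB)|].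
have -> : ~: [set v; x; y] = (A :\ x) :|: (B :\ y) by set_dec.
apply: pmU; last by set_dec.
  by pm_subclique clA; rewrite odd_D1 // oA.
by pm_subclique clB; rewrite odd_D1 // oB.
Qed.
End Critical.

(** * Cuts of two non-adjacent vertices *)

Section TwoCuts.
Variable G : sgraph.
Implicit Types (x y z s t p q r : G) (S T U V W C D A B Z H P K L Q : {set G}).
Hypothesis HG : critical G.
Hypothesis H2 : forall v : G, conn (~: [set v]).

Let cf := crit_claw HG.

Lemma clique_conn A : clique A -> conn A.
Proof.
move=> cA x C xC CA /adj_closedP clC; apply/eqP; rewrite eqEsubset CA.
apply/subsetP => y yA; have [->//|yx] := eqVneq y x.
by apply: (clC x) => //; apply: cA => //; [apply: (subsetP CA)|rewrite eq_sym].
Qed.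

Lemma conn_addv s B : conn B -> (exists2 b, b \in B & s -- b) -> conn (s |: B).
Proof.
move=> cB [b bB sb] x C xC CsB /adj_closedP clC.
have [c cC cB'] : exists2 c, c \in C & c \in B.
  have [xs|xs] := eqVneq x s; last by exists x => //; mem_dec.
  by exists b => //; apply: (clC s) => //; [rewrite -xs|mem_dec].
have BC : B \subset C.
  apply/setIidPl; apply: (cB c); [by mem_dec|exact: subsetIl|].
  apply/adj_closedP => u v /setIP[uB uC] vB uv; rewrite inE vB.
  by apply: (clC u) => //; mem_dec.
have sC : s \in C.
  by apply: (clC b); [apply: (subsetP BC)|mem_dec|rewrite adjC].
by set_dec.
Qed.

Lemma mk_separation S A B : [disjoint A & B] -> ~: S = A :|: B ->
  anticomplete A B -> conn A -> conn B ->
  (exists x, x \in A) -> (exists x, x \in B) -> separation S A B.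
Proof.
move=> dAB cov aAB coA coB A0 B0.
split=> //; split; rewrite ?cov ?subsetUl ?subsetUr //; apply/adj_closedP.
  by move=> x y xA /setUP[//|yB] xy; rewrite (negbTE (aAB x y xA yB)) in xy.
by move=> x y xB /setUP[yA|//] xy; rewrite adjC (negbTE (aAB y x yA xB)) in xy.
Qed.

Record cut2 s t A B : Prop := Cut2 {
  cut2_sep : separation [set s; t] A B;
  cut2_neq : s != t;
  cut2_nadj : ~~ (s -- t)
}.

Lemma cut2_flip s t A B : cut2 s t A B -> cut2 s t B A.
Proof. by case=> sAB n na; split=> //; apply: sep_sym. Qed.

Lemma cut2_swap s t A B : cut2 s t A B -> cut2 t s A B.
Proof. by case=> sAB n na; split; rewrite 1?setUC // 1?eq_sym // 1?adjC. Qed.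

Lemma comp2_touch s t A : s != t -> iscomp (~: [set s; t]) A ->
  exists2 a, a \in A & s -- a.
Proof.
move=> st [AS A0 clA coA]; have [sA tA] : s \notin A /\ t \notin A.
  by split; apply/negP => /(subsetP AS); rewrite !inE eqxx ?orbT.
refine (touch (@H2 t) _ sA _ _ A0); [by mem_dec|by set_dec|].
by have <- : ~: [set s; t] = ~: [set t] :\ s by set_dec.
Qed.

Lemma cut2_touch s t A B : cut2 s t A B -> exists2 a, a \in A & s -- a.
Proof. by case=> [[cA _ _ _] st _]; apply: comp2_touch cA. Qed.

Lemma cut2_facts s t A B : cut2 s t A B ->
  [/\ [disjoint A & B], ~: [set s; t] = A :|: B, s \notin A /\ t \notin A, s \notin B /\ t \notin B
   & s != t].
Proof.
case=> sAB st _; have [sA sB] := sep_notin sAB (set21 s t).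
by have [tA tB] := sep_notin sAB (set22 s t); split=> //; case: sAB.
Qed.

Lemma cut2P s t A : s != t -> ~~ (s -- t) -> iscomp (~: [set s; t]) A ->
  (exists x, x \in ~: [set s; t] :\: A) -> cut2 s t A (~: [set s; t] :\: A).
Proof.
move=> st nst cA R0; split=> //; apply: (two_comps HG (s := s)) => // C.
exact: comp2_touch.
Qed.

Lemma cut2_clique s t A B x y : cut2 s t A B -> x \in A -> y \in A ->
  x != y -> s -- x -> s -- y -> x -- y.
Proof.
move=> c2 xA yA xy vx vy; have [b bB vb] := cut2_touch (cut2_flip c2).
have [dAB _ _ _ _] := cut2_facts c2; have aBA := anti_sep (sep_sym (cut2_sep c2)).
by apply: (claw3 HG vb) => //; rewrite ?(aBA b) //; mem_dec.
Qed.

(** If s and t had a single common neighbour b as their only neighbour in B, then b would be a cut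
    vertex separating the rest of B. *)
Lemma cut2_distinct s t A B : cut2 s t A B -> 1 < #|B| ->
  exists b c, [/\ b \in B, c \in B, b != c, s -- b & t -- c].
Proof.
move=> c2 B2; have [b bB sb] := cut2_touch (cut2_flip c2).
have [c cB tc] := cut2_touch (cut2_swap (cut2_flip c2)).
have [bc|bc] := eqVneq b c; last by exists b, c.
subst c.
have [dAB cov [sA tA] [sB tB] st] := cut2_facts c2.
have [/exists_inP[x xB /andP[xb /orP[sx|tx]]]|nx] :=
   boolP [exists x in B, (x != b) && ((s -- x) || (t -- x))].
- by exists x, b.
- by exists b, x; rewrite eq_sym.
have [x xBb] : exists x, x \in B :\ b.
  by apply/card_gt0P; move: B2; rewrite (cardsD1 b) bB.
suff E : B :\ b = ~: [set b].
  have : s \in B :\ b by rewrite E; mem_dec.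
  by rewrite !inE (negbTE sB) andbF.
apply: (@H2 b _ _ xBb); first by set_dec.
have aBA := anti_sep (sep_sym (cut2_sep c2)).
apply/adj_closedP => u v /setD1P[ub uB] vb uv; apply/setD1P; split; first by mem_dec.
have : [|| v == s, v == t, v \in A | v \in B] by mem_dec.
case/or4P => [/eqP vs|/eqP vt|vA|//].
- by case/negP: nx; apply/exists_inP; exists u; rewrite // ub adjC -vs uv.
- by case/negP: nx; apply/exists_inP; exists u; rewrite // ub (adjC t) -vt uv orbT.
- by rewrite (negbTE (aBA u v uB vA)) in uv.
Qed.

(** s and t are matched to distinct vertices of B, and the odd remainder of B isolates A. *)
Lemma cut2_good s t A B : cut2 s t A B -> 1 < #|B| -> odd #|B| -> good A.
Proof.
move=> c2 B2 oB; have [b [c [bB cB bc sb tc]]] := cut2_distinct c2 B2.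
have [dAB cov [sA tA] [sB tB] st] := cut2_facts c2.
have aAB := anti_sep (cut2_sep c2).
have [||||_ gA] := isolating_matching cf (crit_defect HG) (Z := B :\ b :\ c) (U := A).
- pm_edge s b.
  pm_edge t c.
  by apply: pm0; set_dec.
- by set_dec.
- by rewrite odd_D2.
- by move=> x y xB yA; rewrite adjC aAB //; mem_dec.
- by have [[_ A0 _ coA] _ _ _] := cut2_sep c2; exact: gA (conn_iscomp coA A0).
Qed.

(** Otherwise s and the two cycle neighbours of a form a claw at a. *)
Lemma cut2_C4_neighbours s t A B a : cut2 s t A B -> isC4 A -> a \in A -> s -- a ->
  exists2 b, b \in A & a -- b /\ s -- b.
Proof.
move=> c2 cA aA sa; have [c3 [c4 [c5 h]]] := C4_from cA aA.
have [Ae [n12 n13 n14 [n23 n24 n34]] [a12 a23 a34 a41] [b13 b24]] := h.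
have [dAB cov [sA tA] [sB tB] st] := cut2_facts c2.
have [i2 i4] : c3 \in A /\ c5 \in A by rewrite Ae !inE !eqxx !orbT.
have [s3|s3] := boolP (s -- c3); first by exists c3.
exists c5 => //; split; first by rewrite adjC.
apply: (@claw3 _ HG a c3 s c5) => //; rewrite 1?adjC //; try by mem_dec.
Qed.

Lemma cut2_not_C4 s t A B : cut2 s t A B -> odd #|B| -> ~ isC4 A.
Proof.
move=> c2 oB cA.
have [dAB cov [sA tA] [sB tB] st] := cut2_facts c2.
have aAB := anti_sep (cut2_sep c2).
have [a aA sa] := cut2_touch c2.
have [b bA [ab sb]] := cut2_C4_neighbours c2 cA aA sa.
have [c2' [c3 [c4 h]]] := C4_from cA aA.
(* Matching s and t to the opposite vertices v and z leaves u and w, which are non-adjacent;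
   together with the vertices missed in B they form a forbidden independent set. *)
have key u v w z : C4_at A u v w z -> s -- v -> t -- z -> False.
  case=> Ae [n12 n13 n14 [n23 n24 n34]] [a12 a23 a34 a41] [b13 b24] sv tz.
  have [uA vA wA zA] : [/\ u \in A, v \in A, w \in A & z \in A] by rewrite Ae !inE !eqxx !orbT.
  have [T [TB iT pT]] := maximal_pm B.
  have iT' : independent ([set u; w] :|: T).
    apply: independentU => //; first exact: independent2.
    by move=> x y xuw /(subsetP TB) yB; apply: aAB => //; mem_dec.
  have /negP[] : ~~ (#|[set u; w] :|: T| <= 1).
    by rewrite -ltnNge; apply/card_gt1P; exists u, w; rewrite !inE !eqxx !orbT.
  apply: (crit_defect HG iT').
  pm_edge s v.
  pm_edge t z.
  by have -> : (~: ([set u; w] :|: T)) :\ s :\ v :\ t :\ z = B :\: T by set_dec.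
have [c cA' tc] := cut2_touch (cut2_swap c2).
have [d dA [cd td]] := cut2_C4_neighbours (cut2_swap c2) cA cA' tc.
(* s and t are both joined to an edge of the 4-cycle; if these edges differ,
   key applies, and otherwise they form a claw. *)
have edge u v w z : C4_at A u v w z -> s -- u -> s -- v -> False.
  move=> hh su sv; have h2 := C4_rot hh; have h3 := C4_rot h2; have h4 := C4_rot h3.
  have tz : ~~ (t -- z) by apply/negP; apply: key hh sv.
  have tw : ~~ (t -- w) by apply/negP; apply: key h4 su.
  have [Ae [n12 n13 n14 [n23 n24 n34]] [a12 a23 a34 a41] [b13 b24]] := hh.
  have [uA vA wA zA] : [/\ u \in A, v \in A, w \in A & z \in A] by rewrite Ae !inE !eqxx !orbT.
  have [tu tv] : t -- u /\ t -- v.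
    have inuv x : x \in A -> t -- x -> x = u \/ x = v.
      move=> xA tx; move: xA; rewrite Ae !inE -!orbA => /or4P[]/eqP xE; [by left|by right| |];
      by rewrite xE ?(negbTE tw) ?(negbTE tz) in tx.
    have cd' := adj_neq cd.
    by case: (inuv c cA' tc) (inuv d dA td) => E [] E'; move: tc td cd'; rewrite E E' ?eqxx.
  have sz : ~~ (s -- z) by apply: contra b24 => sz; apply: (cut2_clique c2).
  have [us ut uz] : [/\ u -- s, u -- t & u -- z] by rewrite ![u -- _]adjC.
  have [s_z t_z] : s != z /\ t != z by split; mem_dec.
  by move: tz; rewrite (claw3 HG us ut uz st s_z t_z (cut2_nadj c2) sz).
have [Ae _ [a12 a23 a34 a41] [b13 b24]] := h.
move: (bA); rewrite Ae !inE -!orbA => /or4P[]/eqP E; rewrite E in ab sb.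
- by rewrite sedge_irrefl in ab.
- exact: edge h sa sb.
- by rewrite ab in b13.
- exact: edge (C4_rot (C4_rot (C4_rot h))) sb sa.
Qed.

Lemma cut2_even_clique s t A B : cut2 s t A B -> 1 < #|B| -> odd #|B| -> clique A.
Proof.
move=> c2 B2 oB; have [_ [//|c4]] := cut2_good c2 B2 oB.
by case: (cut2_not_C4 c2 oB).
Qed.

Lemma cut2_odd s t A B : cut2 s t A B -> ~~ odd #|A| -> odd #|B|.
Proof.
move=> c2 eA; have [dAB cov _ _ st] := cut2_facts c2.
by have := odd_setC HG [set s; t]; rewrite cov odd_disjU // cards2 st (negbTE eA).
Qed.

(** The exceptional case of [near_clique] for a 2-cut: the two attachment vertices are shared out
    between s and t. *)
Definition clique_minus_edge s t B p q : Prop :=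
  [/\ [/\ p \in B, q \in B, p != q & ~~ (p -- q)],
    s -- p /\ t -- q, {in B, forall x, s -- x -> x = p}, {in B, forall x, t -- x -> x = q} &
    {in B &, forall x y, x != y -> [set x; y] != [set p; q] -> x -- y}].

(** [near_clique] applied to the neighbours of s or t in B. In the exceptional case s cannot see
    both p and q, as its neighbours in B form a clique, and likewise for t. *)
Lemma cut2_near_clique s t A B : cut2 s t A B -> ~~ odd #|A| -> odd #|B| ->
  clique B \/ exists p q, clique_minus_edge s t B p q.
Proof.
move=> c2 eA oB; have [dAB cov [sA tA] [sB tB] st] := cut2_facts c2.
have aAB := anti_sep (cut2_sep c2).
have [[AS A0 clA coA] [BS B0 clB coB] _ _] := cut2_sep c2.
pose P := [set x in B | (s -- x) || (t -- x)].
have gP p D : p \in P -> iscomp (B :\ p) D -> good D.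
  rewrite inE => /andP[pB pst] cD.
  (* u is the cut vertex that is matched to p; the other one, v, is matched to a in A, which leaves
     [A :\ a] odd. *)
  have [u [v [uv u_v up [a aA va]]]] : exists u v, [/\ [set u; v] = [set s; t], u != v, u -- p & exists2 a, a \in A & v -- a].
    case/orP: pst => [sp|tp].
      by exists s, t; split=> //; apply: cut2_touch (cut2_swap c2).
    by exists t, s; split=> //; [rewrite setUC|rewrite eq_sym|apply: cut2_touch c2].
  have [uuv vuv] : u \in [set s; t] /\ v \in [set s; t] by rewrite -uv !inE !eqxx orbT.
  have [||||_ gB] := isolating_matching cf (crit_defect HG) (Z := A :\ a) (U := B :\ p).
  - pm_edge u p.
    pm_edge v a.
    by apply: pm0; set_dec.
  - by set_dec.
  - by rewrite odd_D1.
  - by move=> x y xB yA; rewrite aAB //; mem_dec.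
  - exact: gB.
have PB : P \subset B by apply/subsetP => x; rewrite inE => /andP[].
(* A component of [B :\ p] without attachment vertices would be separated by p alone. *)
have meet p D : p \in P -> iscomp (B :\ p) D -> exists2 q, q \in D & q \in P.
  move=> pP [DB [d dD] /adj_closedP clD coD]; have pB := subsetP PB p pP.
  apply/exists_inP; have [//|nt] := boolP [exists q in D, q \in P].
  have sD : s \notin D by mem_dec.
  suff E : D = ~: [set p] by move: sD; rewrite E; have -> : s \in ~: [set p] by mem_dec.
  apply: (@H2 p _ _ dD); first by set_dec.
  apply/adj_closedP => u v uD vp uv; have uB : u \in B by mem_dec.
  have uP : u \notin P by apply: contra nt => uP; apply/exists_inP; exists u.
  have : [|| v == s, v == t, v \in A | v \in B] by mem_dec.
  case/or4P => [/eqP vs|/eqP vt|vA|vB].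
  - by move: uP; rewrite inE uB adjC -vs uv.
  - by move: uP; rewrite inE uB (adjC t) -vt uv orbT.
  - by move: uv; rewrite adjC (negbTE (aAB v u vA uB)).
  - by apply: clD uv => //; mem_dec.
have [b bB sb] := cut2_touch (cut2_flip c2).
have bP : b \in P by rewrite inE bB sb.
have hg p D : p \in P -> iscomp (B :\ p) D -> good D /\ exists2 q, q \in D & q \in P.
  by move=> pP cD; split; [exact: gP cD|exact: meet cD].
have hn p x y : p \in P -> x \in B -> y \in B -> p -- x -> p -- y -> x != y ->
    x \notin P -> y \notin P -> x -- y.
  rewrite !inE => /andP[pB psp] xB yB px py xy.
  rewrite xB yB /= !negb_or => /andP[sx tx] /andP[sy ty].
  case/orP: psp => [sp|tp].
    by apply: (@claw3 _ HG p s x y) => //; rewrite 1?adjC //; mem_dec.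
  by apply: (@claw3 _ HG p t x y) => //; rewrite 1?adjC //; mem_dec.
case: (near_clique coB PB hg hn (ex_intro _ b bP)) => [|[p [q [PE pq npq adj]]]]; first by left.
right.
have inpq x : x \in B -> (s -- x) || (t -- x) -> x = p \/ x = q.
  move=> xB h; have: x \in P by rewrite inE xB.
  by rewrite PE => /set2P.
have [pP qP] : p \in P /\ q \in P by rewrite PE !inE !eqxx orbT.
have [pB qB] := (subsetP PB p pP, subsetP PB q qP).
have ns u : s -- p -> s -- q -> u.
  by move=> sp sq; move: npq; rewrite (cut2_clique (cut2_flip c2) pB qB pq sp sq).
have nt u : t -- p -> t -- q -> u.
  by move=> sp sq; move: npq; rewrite (cut2_clique (cut2_swap (cut2_flip c2)) pB qB pq sp sq).
move: pP qP; rewrite !inE pB qB /=.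
have fin p' q' : p' \in B -> q' \in B -> p' != q' -> ~~ (p' -- q') -> [set p'; q'] = [set p; q] -> s -- p' -> t -- q' -> ~~ (s -- q') -> ~~ (t -- p') ->
  exists p0 q0, clique_minus_edge s t B p0 q0.
  move=> p'B q'B pq' npq' E sp tq sq tp; exists p', q'; split=> //; last by rewrite E.
    move=> x xB sx; have: x \in [set p'; q'] by rewrite E -PE inE xB sx.
    by case/set2P => // xE; rewrite xE (negbTE sq) in sx.
  move=> x xB tx; have: x \in [set p'; q'] by rewrite E -PE inE xB tx orbT.
  by case/set2P => // xE; rewrite xE (negbTE tp) in tx.
case/orP => [sp|tp] /orP[sq|tq].
- exact: ns sp sq.
- apply: (fin p q) => //; apply/negP => h; [exact: ns sp h|exact: nt h tq].
- apply: (fin q p) => //; [by rewrite eq_sym|by rewrite adjC|by rewrite setUC|apply/negP => h; exact: ns h sq|apply/negP => h; exact: nt tp h].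
- exact: nt tp tq.
Qed.

(** * From 2-cuts to the families *)

Definition two_connected_family :=
  inG21 G \/ inG22 G \/ inG23 G \/ isomorphic G (cycle_graph 7).

Lemma iso_even A : clique A -> ~~ odd #|A| -> (exists x, x \in A) ->
  exists2 p, 1 <= p & isomorphic (induced A) (complete_graph (2 * p)).
Proof.
move=> cA eA [x xA]; exists #|A|./2.
  by have := card_gt0E xA; move: eA; case: #|A| => [|[|]].
by apply/iso_completeP; rewrite mul2n even_halfK.
Qed.

Lemma iso_odd A : clique A -> odd #|A| ->
  isomorphic (induced A) (complete_graph (2 * #|A|./2 + 1)).
Proof.
move=> cA oA; apply/iso_completeP; split=> //.
by rewrite -[LHS]odd_double_half oA mul2n addnC.
Qed.

Lemma odd_gt1_half A : odd #|A| -> 1 < #|A| -> 1 <= #|A|./2.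
Proof. by case: #|A| => [|[|[|]]]. Qed.

Lemma mk_G22 s t A B : cut2 s t A B -> clique A -> clique B -> ~~ odd #|A| ->
  {in B, forall x, s -- x} -> {in B, forall x, t -- x} ->
  {in A, forall x, ~~ ((s -- x) && (t -- x))} ->
  (exists2 x, x \in A & ~~ (s -- x) && ~~ (t -- x)) -> inG22 G.
Proof.
move=> c2 cA cB eA sB tB stA [x xA /andP[sx tx]].
have oB := cut2_odd c2 eA.
exists s, t, A, B; split.
- by case: c2.
- by split=> //; apply/separationP; case: c2.
- by apply: iso_even => //; exists x.
- by exists #|B|./2; apply: iso_odd.
- split=> //; last first.
    apply/setP => u; rewrite !inE; apply/negP => /andP[/andP[su uA] /andP[tu _]].
    by move: (stA u uA); rewrite su tu.
  apply/properP; split; first by apply/subsetP => u; rewrite !inE => /orP[]/andP[].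
  by exists x; rewrite // !inE xA !andbT (negbTE sx) (negbTE tx).
Qed.

Lemma mk_G23 s t A B a b : cut2 s t A B -> clique A -> clique B ->
  1 < #|B| -> A = [set a; b] -> a != b -> s -- a -> t -- b -> ~~ (s -- b) -> ~~ (t -- a) ->
  {in B, forall x, (s -- x) || (t -- x)} -> inG23 G.
Proof.
move=> c2 cA cB B1 Ae ab sa tb sb ta stB.
have [dAB cov [sA tA] [sB tB] st] := cut2_facts c2.
have eA : ~~ odd #|A| by rewrite Ae cards2 ab.
have oB := cut2_odd c2 eA; have [aA bA] : a \in A /\ b \in A by rewrite Ae !inE !eqxx orbT.
exists s, t, A, B; split.
- by case: c2.
- by split=> //; apply/separationP; case: c2.
- split; first by apply/iso_completeP; rewrite Ae cards2 ab -Ae.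
  apply/iso_P4P; exists s, a, b, t; split.
  + by set_dec.
  + by split; [mem_dec|mem_dec|mem_dec|split; [|mem_dec|mem_dec]].
  + by split=> //; [apply: cA|rewrite adjC].
  + by split=> //; [rewrite adjC|apply: cut2_nadj c2].
- by exists #|B|./2; [apply: odd_gt1_half|apply: iso_odd].
- apply/setP => x; rewrite !inE -andb_orl; case xB: (x \in B); rewrite ?andbF //.
  by rewrite stB.
Qed.

(** A vertex x of B missed by both would form a triple with s and t whose complement consists of the
    even cliques A and [B :\ x]. *)
Lemma cut2_covered s t A B : cut2 s t A B -> clique A -> clique B -> ~~ odd #|A| ->
  {in B, forall x, (s -- x) || (t -- x)}.
Proof.
move=> c2 cA cB eA x xB; have oB := cut2_odd c2 eA.
have [dAB cov [sA tA] [sB tB] st] := cut2_facts c2.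
apply/negPn/negP; rewrite negb_or => /andP[sx tx].
apply: (no_triple HG st (cut2_nadj c2) sx tx).
have -> : ~: [set s; t; x] = A :|: (B :\ x) by set_dec.
apply: pmU; [exact: clique_pm| |by set_dec].
by pm_subclique cB; rewrite odd_D1 // oB.
Qed.

(** For x different from a, the edge t x and the even remainders of both cliques would match the
    complement of the triple s, a, b. *)
Lemma cut2_unique s t A B a b x : cut2 s t A B -> clique A -> clique B -> ~~ odd #|A| ->
  a \in A -> ~~ (s -- a) -> b \in B -> ~~ (s -- b) -> x \in A -> t -- x -> x = a.
Proof.
move=> c2 cA cB eA aA sa bB sb xA tx; have oB := cut2_odd c2 eA.
have [dAB cov [sA tA] [sB tB] st] := cut2_facts c2.
have ab := anti_sep (cut2_sep c2) aA bB.
apply/eqP/negPn/negP => xa; have s_a : s != a by mem_dec.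
apply: (no_triple HG s_a sa sb ab).
pm_edge t x.
have -> : (~: [set s; a; b]) :\ t :\ x = (A :\ a :\ x) :|: (B :\ b) by set_dec.
apply: pmU; last by set_dec.
  by pm_subclique cA; rewrite odd_D2 // eq_sym.
by pm_subclique cB; rewrite odd_D1 // oB.
Qed.

(** An independent triple has at most one vertex in each clique, so it contains s or t; if it
    contains both, its third vertex is missed by both. *)
Lemma cut2_triple s t A B : cut2 s t A B -> clique A -> clique B ->
  [\/ exists x, [/\ (x \in A) || (x \in B), ~~ (s -- x) & ~~ (t -- x)],
      exists a b, [/\ a \in A, b \in B, ~~ (s -- a) & ~~ (s -- b)] |
      exists a b, [/\ a \in A, b \in B, ~~ (t -- a) & ~~ (t -- b)]].
Proof.
move=> c2 cA cB; have [dAB cov [sA tA] [sB tB] st] := cut2_facts c2.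
have [x [y [z [xy xz yz [nxy nxz nyz]]]]] := crit_triple HG.
have whr u : [|| u == s, u == t, u \in A | u \in B] by mem_dec.
have bad u v C : clique C -> u != v -> ~~ (u -- v) -> u \in C -> v \in C -> False.
  by move=> cC uv nuv uC vC; rewrite cC in nuv.
have [nyx nzx nzy] : [/\ ~~ (y -- x), ~~ (z -- x) & ~~ (z -- y)] by split; rewrite adjC.
have one u : (u \in A) || (u \in B) -> ~~ (s -- u) -> ~~ (t -- u) ->
    exists x, [/\ (x \in A) || (x \in B), ~~ (s -- x) & ~~ (t -- x)] by exists u.
have two u a b : a \in A -> b \in B -> ~~ (u -- a) -> ~~ (u -- b) ->
    exists a b, [/\ a \in A, b \in B, ~~ (u -- a) & ~~ (u -- b)] by exists a, b.
case/or4P: (whr x) => [/eqP xE|/eqP xE|xE|xE];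
case/or4P: (whr y) => [/eqP yE|/eqP yE|yE|yE];
case/or4P: (whr z) => [/eqP zE|/eqP zE|zE|zE];
  try (rewrite xE in xy xz nxy nxz nyx nzx); try (rewrite yE in xy yz nxy nyz nyx nzy);
  try (rewrite zE in xz yz nxz nyz nzx nzy); rewrite ?eqxx // in xy xz yz;
  first [ by case: (bad x y A) | by case: (bad x y B) | by case: (bad x z A) | by case: (bad x z B)
        | by case: (bad y z A) | by case: (bad y z B)
        | by apply: Or31; apply: (one x); rewrite ?xE ?orbT
        | by apply: Or31; apply: (one y); rewrite ?yE ?orbT
        | by apply: Or31; apply: (one z); rewrite ?zE ?orbT
        | by apply: Or32; solve [exact: (two s x y)|exact: (two s y x)|exact: (two s x z)
            |exact: (two s z x)|exact: (two s y z)|exact: (two s z y)]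
        | by apply: Or33; solve [exact: (two t x y)|exact: (two t y x)|exact: (two t x z)
            |exact: (two t z x)|exact: (two t y z)|exact: (two t z y)]].
Qed.

(** [cut2_unique] makes a the only neighbour of t in A and s complete to the rest of A. What remains
    open is whether t is complete to B. *)
Lemma cut2_swap_family s t A B a b : cut2 s t A B -> clique A -> clique B -> ~~ odd #|A| ->
  a \in A -> b \in B -> ~~ (s -- a) -> ~~ (s -- b) -> inG22 G \/ inG23 G.
Proof.
move=> c2 cA cB eA aA bB sa sb; have oB := cut2_odd c2 eA.
have [dAB cov [sA tA] [sB tB] st] := cut2_facts c2.
have aAB := anti_sep (cut2_sep c2).
have stB := cut2_covered c2 cA cB eA.
have tuni x : x \in A -> t -- x -> x = a by apply: cut2_unique c2 cA cB eA aA sa bB sb.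
have ta : t -- a.
  by have [x xA tx] := cut2_touch (cut2_swap c2); rewrite -(tuni x xA tx).
have sall x : x \in A -> x != a -> s -- x.
  move=> xA xa; apply/negPn/negP => sx.
  by have := cut2_unique c2 cA cB eA xA sx bB sb aA ta => ax; rewrite ax eqxx in xa.
have [tBall|] := boolP [forall x in B, t -- x].
  left; have {}tBall := forall_inP tBall.
  have s_a : s != a by mem_dec.
  have eA' : odd #|A :\ a| by rewrite odd_D1 // eA.
  have cA' : clique (A :\ a) by apply: cliqueS cA; set_dec.
  have cB' : clique (t |: B).
    move=> x y; rewrite !inE => /orP[/eqP->|xB] /orP[/eqP->|yB] xy.
    - by rewrite eqxx in xy.
    - exact: tBall.
    - by rewrite adjC tBall.
    - exact: cB.
  (* Exchanging t for a in the cut also exchanges parities: [t |: B] is the even side and [A :\ a]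
     the odd one. *)
  have c2' : cut2 a s (t |: B) (A :\ a).
    split; rewrite 1?eq_sym // 1?adjC //.
    apply: mk_separation; [by set_dec|by set_dec| |exact: clique_conn|exact: clique_conn| |].
    - move=> x y; rewrite !inE => /orP[/eqP->|xB] /andP[ya yA].
        by apply: contra ya => ty; rewrite (tuni y yA ty).
      by rewrite adjC aAB.
    - by exists t; rewrite !inE eqxx.
    - exact: odd_nonempty.
  apply: (mk_G22 c2') => //.
  - by rewrite cardsU1 tB /= oB.
  - by move=> x /setD1P[xa xA]; apply: cA; rewrite // eq_sym.
  - by move=> x /setD1P[xa xA]; apply: sall.
  - move=> x; rewrite !inE => /orP[/eqP->|xB].
      by rewrite (negbTE (cut2_nadj c2)) andbF.
    by rewrite (negbTE (aAB a x aA xB)).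
  - by exists b; [rewrite !inE bB orbT|rewrite (aAB a b) // sb].
(* As t misses [b2] as well, [cut2_unique] also leaves s a single neighbour in A, so A has two
   vertices. *)
rewrite negb_forall_in => /exists_inP[b2 b2B tb2]; right.
have suni x y : x \in A -> ~~ (t -- x) -> y \in A -> s -- y -> y = x.
  by move=> xA tx yA sy; apply: (cut2_unique (cut2_swap c2) cA cB eA xA tx b2B tb2 yA sy).
have [c cA_ ca] := even_other eA aA.
have tc : ~~ (t -- c) by apply: contra ca => tc; rewrite (tuni c cA_ tc).
apply: (mk_G23 (a := c) (b := a) c2) => //.
- apply/card_gt1P; exists b, b2; split=> //.
  by apply: contraNneq tb2 => <-; have := stB b bB; rewrite (negbTE sb).
- apply/setP => x; rewrite !inE; apply/idP/idP => [xA|/orP[]/eqP->//].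
  have [->|xa] := eqVneq x a; first by rewrite orbT.
  by rewrite (suni c x cA_ tc xA (sall x xA xa)) eqxx.
- exact: sall.
Qed.

Lemma cut2_cliques s t A B : cut2 s t A B -> clique A -> clique B -> ~~ odd #|A| ->
  inG22 G \/ inG23 G.
Proof.
move=> c2 cA cB eA; have aAB := anti_sep (cut2_sep c2).
have [dAB cov [sA tA] [sB tB] st] := cut2_facts c2.
case: (cut2_triple c2 cA cB) => [[x [xAB sx tx]]|[a [b [aA bB sa sb]]]|[a [b [aA bB ta tb]]]].
- have xA : x \in A.
    case/orP: xAB => // xB; have := cut2_covered c2 cA cB eA xB.
    by rewrite (negbTE sx) (negbTE tx).
  (* A vertex y of B missed by u would make x the only neighbour of v in A, but v misses x. *)
  have full u v : cut2 u v A B -> ~~ (u -- x) -> ~~ (v -- x) -> {in B, forall y, u -- y}.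
    move=> cuv ux vx y yB; apply/negPn/negP => uy.
    have [z zA vz] := cut2_touch (cut2_swap cuv).
    by move: vx; rewrite -(cut2_unique cuv cA cB eA xA ux yB uy zA vz) vz.
  left; apply: (mk_G22 c2) => //; [exact: full c2 sx tx|exact: full (cut2_swap c2) tx sx| |].
    move=> y yA; apply/negP => /andP[sy ty].
    have xy : x != y by apply: contraNneq sx => ->.
    have [ys yt yx] : [/\ y -- s, y -- t & y -- x].
      by rewrite ![y -- _]adjC; split=> //; apply: cA.
    have [s_x t_x] : s != x /\ t != x by split; mem_dec.
    by rewrite (claw3 HG ys yt yx st s_x t_x (cut2_nadj c2) sx) in tx.
  by exists x => //; rewrite sx tx.
- exact: cut2_swap_family c2 cA cB eA aA bB sa sb.
- exact: cut2_swap_family (cut2_swap c2) cA cB eA aA bB ta tb.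
Qed.

Lemma clique2 p q : p -- q -> clique [set p; q].
Proof.
move=> pq x y /set2P[->|->] /set2P[->|->]; rewrite ?eqxx // => _.
by rewrite adjC.
Qed.

Lemma set2_neq x y u v w : w \in [set u; v] -> w \notin [set x; y] ->
  [set x; y] != [set u; v].
Proof. by move=> wuv wxy; apply: contraNneq wxy => ->. Qed.

Lemma fam_22_23 : inG22 G \/ inG23 G -> two_connected_family.
Proof. by case=> h; right; [left|right; left]. Qed.

(* The path s p q p' t leads around the clique A. *)
Lemma short_path_side s t A p q p' : cut2 s t A [set p; q; p'] -> clique A -> ~~ odd #|A| ->
  s -- p -> p -- q -> q -- p' -> t -- p' -> ~~ (p -- p') -> p != p' ->
  (forall x, x \in [set p; q; p'] -> s -- x -> x = p) ->
  (forall x, x \in [set p; q; p'] -> t -- x -> x = p') ->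
  two_connected_family \/
  exists r, [/\ r \in A, s -- r, {in A, forall x, s -- x -> x = r}, ~~ (t -- r) &
    {in A, forall x, x != r -> t -- x}].
Proof.
move=> c2 cA eA sp pq qp' tp' npp' pp' sB tB.
have [dAB cov [sA tA] [sN tN] st] := cut2_facts c2.
have aAB := anti_sep (cut2_sep c2).
have [pB qB p'B] : [/\ p \in [set p; q; p'], q \in [set p; q; p'] & p' \in [set p; q; p']].
  by rewrite !inE !eqxx !orbT.
have q_p := adj_neq pq; have q_p' := adj_neq qp'.
have sp' : ~~ (s -- p') by apply: contraTN isT => /sB E; move: pp'; rewrite E // eqxx.
have tp : ~~ (t -- p) by apply: contraTN isT => /tB E; move: pp'; rewrite E // eqxx.
have sq : ~~ (s -- q) by apply: contraTN isT => /sB E; move: q_p; rewrite E // eqxx.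
have tq : ~~ (t -- q) by apply: contraTN isT => /tB E; move: q_p'; rewrite E // eqxx.
have pA : p \notin A by mem_dec.
have p'A : p' \notin A by mem_dec.
have qA : q \notin A by mem_dec.
have [s_p s_q s_p'] : [/\ s != p, s != q & s != p'] by split; mem_dec.
have [t_p t_q t_p'] : [/\ t != p, t != q & t != p'] by split; mem_dec.
have o2 : odd #|t |: A| by rewrite cardsU1 tA /= eA.
have e2 : ~~ odd #|[set p; q]| by rewrite cards2 q_p.
have [a aA ta] := cut2_touch (cut2_swap c2).
(* The cut is moved along the path: p and q form the even side, and t joins A on the odd side. If
   that side is not a clique, its missing edge ends in t, the neighbour of p' there. *)
have c2' : cut2 s p' [set p; q] (t |: A).
  split=> //; apply: mk_separation.
  - by set_dec.
  - by set_dec.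
  - move=> x y /set2P[->|->] /setU1P[->|yA]; rewrite 1?adjC //; exact: aAB.
  - by apply: clique_conn; apply: clique2.
  - by apply: conn_addv; [apply: clique_conn|exists a].
  - by exists p; rewrite !inE eqxx.
  - by exists t; rewrite !inE eqxx.
case: (cut2_near_clique c2' e2 o2) => [cl|[r [r' [[rA r'A rr' nrr'] [sr p'r'] sur p'u adj]]]].
  by left; apply: fam_22_23; apply: (cut2_cliques c2') => //; apply: clique2.
right; have tin : t \in t |: A by rewrite !inE eqxx.
have r't : t = r' by apply: p'u => //; rewrite adjC.
have rA' : r \in A by move: rA; rewrite !inE => /orP[/eqP rt|//]; move: rr'; rewrite rt -r't eqxx.
exists r; split=> //.
- by move=> x xA; apply: sur; rewrite !inE xA orbT.
- by rewrite adjC r't.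
- move=> x xA xr; have xin : x \in t |: A by rewrite !inE xA orbT.
  have tx : t != x by mem_dec.
  apply: adj => //; apply: (set2_neq (w := r)); rewrite !inE ?eqxx // negb_or r't rr'.
  by rewrite eq_sym.
Qed.

(** If B is a clique minus the edge pp', its other vertices form an odd clique Q complete to p and
    p'. Q must be a single vertex, and then the sides of the resulting path leave only $C_7$ or a
    cut between two cliques. *)
Lemma cut2_big s t A B : cut2 s t A B -> ~~ odd #|A| -> 1 < #|B| -> two_connected_family.
Proof.
move=> c2 eA B1; have oB := cut2_odd c2 eA.
have cA := cut2_even_clique c2 B1 oB.
case: (cut2_near_clique c2 eA oB) => [cB|[p [p' [[pB p'B pp' npp'] [sp tp'] su tu adj]]]].
  by apply: fam_22_23; apply: (cut2_cliques c2).
have [dAB cov [sA tA] [sB tB] st] := cut2_facts c2.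
have aAB := anti_sep (cut2_sep c2).
set Q := B :\ p :\ p'; have oQ : odd #|Q| by rewrite odd_D2.
have QE u : (u \in Q) = [&& u != p', u != p & u \in B] by rewrite !inE.
clearbody Q.
have [q qQ] := odd_nonempty oQ.
have apQ u : u \in Q -> p -- u /\ p' -- u.
  rewrite QE => /and3P[up' up uB]; split; apply: adj => //.
  - by rewrite eq_sym.
  - by apply: (set2_neq (w := p')); rewrite !inE ?eqxx ?orbT // negb_or ![p' == _]eq_sym pp' up'.
  - by rewrite eq_sym.
  - by apply: (set2_neq (w := p)); rewrite !inE ?eqxx // negb_or ![p == _]eq_sym up eq_sym pp'.
have qcl : clique Q.
  move=> u v; rewrite !QE => /and3P[up' up uB] /and3P[vp' vp vB] uv; apply: adj => //.
  by apply: (set2_neq (w := p)); rewrite !inE ?eqxx // negb_or ![p == _]eq_sym up vp.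
(* If Q had more vertices, p and p' would cut it off, and the even side containing s, t and A would
   be a clique although s and t are non-adjacent. *)
have [Q1|Q1] := leqP #|Q| 1; last first.
  have cR : cut2 p p' (s |: (t |: A)) Q.
    split=> //; apply: mk_separation; [| | | |exact: clique_conn| |by exists q].
    - by rewrite -setI_eq0; apply/eqP/setP => z; rewrite !inE QE; at_dec z.
    - by apply/setP => z; rewrite !inE QE; at_dec z.
    - move=> x y; rewrite !inE QE => /or3P[/eqP->|/eqP->|xA] /and3P[yp' yp yB].
      + by apply: contra yp => sy; rewrite (su y yB sy).
      + by apply: contra yp' => ty; rewrite (tu y yB ty).
      + exact: aAB.
    - have [a aA sa] := cut2_touch c2; have [b bA tb] := cut2_touch (cut2_swap c2).
      apply: conn_addv; last by exists a => //; rewrite !inE aA orbT.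
      by apply: conn_addv; [apply: clique_conn|exists b].
    - by exists s; rewrite !inE eqxx.
  have := cut2_even_clique cR Q1 oQ.
  move/(_ s t); rewrite !inE !eqxx orbT st => /(_ isT isT isT).
  by rewrite (negbTE (cut2_nadj c2)).
have Qq u : u \in Q -> u = q.
  by move=> uQ; apply/eqP/negPn/negP => uq; move: Q1; rewrite leqNgt => /negP[]; apply/card_gt1P; exists u, q.
have [pq p'q] := apQ q qQ.
have BE : B = [set p; q; p'].
  apply/setP => u; rewrite !inE; apply/idP/idP => [uB|/orP[/orP[]|]/eqP->//].
    have [->|up] := eqVneq u p; first by []. have [->|up'] := eqVneq u p'; first by rewrite orbT.
    by rewrite (Qq u) ?eqxx // QE up up' uB.
  by move: qQ; rewrite QE => /and3P[].
have BE' : B = [set p'; q; p] by rewrite BE; set_dec.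
have c2a : cut2 s t A [set p; q; p'] by rewrite -BE.
have c2b : cut2 t s A [set p'; q; p] by rewrite -BE'; apply: cut2_swap.
(* Read from both ends, the path gives private neighbours [x1] of s and [x2] of t, and these exhaust
   A. *)
case: (short_path_side c2a) => //; rewrite -?BE //; first by rewrite adjC.
case=> x1 [x1A sx1 su1 tx1 tall].
case: (short_path_side c2b) => //; rewrite -?BE' // 1?adjC //; first by rewrite eq_sym.
case=> x2 [x2A tx2 tu2 sx2 sall].
have x12 : x1 != x2 by apply: contraNneq sx2 => <-.
have AE u : u \in A -> u = x1 \/ u = x2.
  move=> uA; have [->|ux] := eqVneq u x1; [by left|right].
  by apply: tu2 => //; apply: tall.
have qB : q \in B by rewrite BE !inE eqxx orbT.
have no u v w : (forall x, x \in B -> u -- x -> x = v) -> w \in B -> w != v -> ~~ (u -- w).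
  by move=> uni wB; apply: contra => uw; rewrite (uni w wB uw).
have [q_p q_p'] : q != p /\ q != p' by split; rewrite eq_sym adj_neq.
have p'_p : p' != p by rewrite eq_sym.
have s_q := no s p q su qB q_p; have t_q := no t p' q tu qB q_p'.
have s_p' := no s p p' su p'B p'_p; have t_p := no t p' p tu pB pp'.
right; right; right.
apply: (@iso_C7 _ s p q p' t x2 x1).
- by rewrite /= !inE !negb_or; do ?[apply/andP; split]; rewrite //; mem_dec.
- move=> u; have : [|| u == s, u == t, u \in A | u \in B] by mem_dec.
  rewrite !inE => /or4P[->//|->|/AE[]->|]; rewrite ?eqxx ?orbT //.
  by rewrite BE !inE => /orP[/orP[]|]->; rewrite ?orbT.
- split; rewrite // 1?adjC //; split; rewrite // 1?adjC //.
  by apply: cA => //; rewrite eq_sym.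
- split; [by []|by []|by rewrite adjC|].
  by split; [rewrite adjC aAB|by []|rewrite adjC|rewrite aAB].
- split; [by []|by rewrite adjC|by rewrite adjC aAB|].
  by split; [rewrite adjC aAB|rewrite adjC; case: c2|rewrite aAB|rewrite aAB].
Qed.

(** * 2-cuts whose odd side is a single vertex *)

Lemma set_D1C A x y : A :\ x :\ y = A :\ y :\ x.
Proof. by set_dec. Qed.

Lemma singleton_facts s t A b : cut2 s t A [set b] ->
  [/\ s -- b, t -- b, {in A, forall x, ~~ (b -- x)} & ~~ odd #|A|].
Proof.
move=> c2; split.
- by have [x /set1P->] := cut2_touch (cut2_flip c2).
- by have [x /set1P->] := cut2_touch (cut2_swap (cut2_flip c2)).
- by move=> x xA; rewrite adjC (anti_sep (cut2_sep c2)) // inE.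
- apply/negP => oA; have := odd_setC HG [set s; t]; have [dAB -> _ _ st] := cut2_facts c2.
  by rewrite odd_disjU // cards2 st cards1 oA.
Qed.

(** s and t are matched into A this time, so that the odd set isolating the rest of A is b
    itself. *)
Lemma singleton_pair s t A b x y : cut2 s t A [set b] -> x \in A -> y \in A -> x != y ->
  s -- x -> t -- y ->
  pm (A :\ x :\ y) /\ forall D, iscomp (A :\ x :\ y) D -> good D.
Proof.
move=> c2 xA yA xy sx ty; have [sb tb bA _] := singleton_facts c2.
have [dAB cov [sA tA] [sB tB] st] := cut2_facts c2.
apply: (isolating_matching cf (crit_defect HG) (Z := [set b])).
- pm_edge s x.
  pm_edge t y.
  by apply: pm0; set_dec.
- by set_dec.
- by rewrite cards1.
- by move=> u v /set1P-> vA; apply: bA; mem_dec.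
Qed.

(** The 4-cycle of the family is [a t b s], and [A :\ a] is its odd clique. *)
Lemma mk_G21 s t A b a p q h : cut2 s t A [set b] -> a \in A -> clique (A :\ a) ->
  s -- a -> t -- a -> {in A :\ a, forall x, ~~ (s -- x)} ->
  {in A :\ a, forall x, (t -- x) = (a -- x)} ->
  p \in A :\ a -> q \in A :\ a -> p != q -> t -- p -> t -- q ->
  h \in A :\ a -> ~~ (t -- h) -> inG21 G.
Proof.
move=> c2 aA cH sa ta sH tH pH qH pq tp tq hH th.
have [sb tb bA eA] := singleton_facts c2.
have [dAB cov [sA tA] [sB tB] st] := cut2_facts c2.
have oH : odd #|A :\ a| by rewrite odd_D1.
exists (A :\ a), [set a; t; b; s]; split.
- by set_dec.
- by set_dec.
- exists #|A :\ a|./2; last exact: iso_odd.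
  by apply: odd_gt1_half => //; apply/card_gt1P; exists p, q.
exists a, t, b, s; split.
- by split=> //=; rewrite !inE !negb_or; do ?[apply/andP; split]; rewrite //; mem_dec.
- split; first by split; rewrite // adjC.
  by split; [rewrite adjC; apply: bA|rewrite adjC; case: c2].
- apply/setP => x; rewrite in_setI [RHS]in_setI; case xH: (x \in A :\ a); rewrite ?andbF // !andbT.
  by rewrite !inE -tH.
- apply/andP; split.
    by apply/card_gt1P; exists p, q; rewrite !in_setI pH qH !inE -!tH // tp tq.
  apply: proper_card; apply/properP; split; first exact: subsetIr.
  by exists h; rewrite // in_setI negb_and !inE -tH // th.
- split; apply/setP => x; rewrite in_setI [RHS]inE; apply/negP => /andP[]; rewrite inE => ux xH.
    have xA : x \in A by mem_dec.
    by rewrite (negbTE (bA x xA)) in ux.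
  by rewrite (negbTE (sH x xH)) in ux.
Qed.

(** With a matched to s or t, deleting a further attachment vertex from [H = A :\ a] leaves even
    cliques and 4-cycles, so [near_clique] applies to H. If a is not complete to the clique H, a
    non-neighbour h gives the triple b, a, h, which forces s or t to have no neighbour in H. *)
Lemma singleton_common s t A b a : cut2 s t A [set b] -> a \in A -> s -- a -> t -- a ->
  inG21 G \/ clique A.
Proof.
move=> c2 aA sa ta; have [sb tb bA eA] := singleton_facts c2.
have [dAB cov [sA tA] [sB tB] st] := cut2_facts c2.
have aAB := anti_sep (cut2_sep c2).
have [[AS A0 clA coA] _ _ _] := cut2_sep c2.
have Na x : x \in A -> a -- x -> (s -- x) || (t -- x).
  move=> xA ax; have as' : a -- s by rewrite adjC. have at' : a -- t by rewrite adjC.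
  have := cf as' at' ax st; rewrite (negbTE (cut2_nadj c2)) /=; apply; mem_dec.
set H := A :\ a; have oH : odd #|H| by rewrite odd_D1.
have HA : H \subset A by apply: subsetDl.
have aH : a \notin H by rewrite !inE eqxx.
have AE : A = a |: H by rewrite /H; set_dec.
pose P := [set x in H | (s -- x) || (t -- x)].
have PH : P \subset H by apply/subsetP => x; rewrite inE => /andP[].
have gP p : p \in P -> pm (H :\ p) /\ forall D, iscomp (H :\ p) D -> good D.
  rewrite inE => /andP[pH /orP[sp|tp]].
    have -> : H :\ p = A :\ p :\ a by rewrite /H set_D1C.
    by apply: (singleton_pair c2) => //; mem_dec.
  by apply: (singleton_pair c2) => //; mem_dec.
clearbody H.
(* Without attachment vertices D would be separated by v alone; a does not touch D either, since the
   neighbours of a in A are adjacent to s or t. *)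
have meet v D : v \in A -> iscomp (A :\ a :\ v) D \/ iscomp (A :\ v) D ->
    v \notin D -> a \notin D -> D \subset H -> exists2 q, q \in D & q \in P.
  move=> vA cD vD aD DH; apply/exists_inP; have [//|nt] := boolP [exists q in D, q \in P].
  have [d dD] : exists d, d \in D by case: cD => -[].
  have E : D = ~: [set v].
    apply: (@H2 v _ _ dD); first by set_dec.
    apply/adj_closedP => u w uD wv uw; have uH := subsetP DH u uD.
    have uP : u \notin P by apply: contra nt => uP; apply/exists_inP; exists u.
    have [su tu] : ~~ (s -- u) /\ ~~ (t -- u) by apply/andP; move: uP; rewrite inE uH /= negb_or.
    have : [|| w == s, w == t, w \in A | w \in [set b]] by mem_dec.
    case/or4P => [/eqP E|/eqP E|wA|/set1P E].
    - by rewrite adjC E (negbTE su) in uw.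
    - by rewrite adjC E (negbTE tu) in uw.
    - have [wa|wa] := eqVneq w a.
        have au : a -- u by rewrite -wa adjC.
        by have := Na u (subsetP HA u uH) au; rewrite (negbTE su) (negbTE tu).
      case: cD => -[_ _ /adj_closedP clD _]; apply: clD uw => //; mem_dec.
    - by move: uw; rewrite adjC E (negbTE (bA u (subsetP HA u uH))).
  by have : s \in D; [rewrite E; mem_dec|move/(subsetP DH)/(subsetP HA); rewrite (negbTE sA)].
have HE : A :\ a = H by rewrite AE; set_dec.
have meetp p D : p \in P -> iscomp (H :\ p) D -> exists2 q, q \in D & q \in P.
  move=> pP cD; have [DH _ _ _] := cD; have pH := subsetP PH p pP.
  by apply: (meet p); [mem_dec|left; rewrite HE|mem_dec|mem_dec|set_dec].
(* Deleting an attachment vertex of another component leaves a perfectly matchable set in which the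
   odd component [D1] would still be closed. *)
have coH : conn H.
  have [|D1 cD1 oD1] := @odd_comp _ cf H; first by move/pm_even; rewrite oH.
  have [D1H _ clD1 coD1] := cD1.
  suff HD : H = D1 by rewrite HD.
  apply/eqP; rewrite eq_sym eqEsubset D1H -setD_eq0; apply/negPn/negP => /set0Pn[x xR].
  have [D2 cD2' _] := comp_of xR; have cD2 := iscompD cD1 cD2'; have [D2R _ _ _] := cD2'.
  have [p pD2 pP] : exists2 p, p \in D2 & p \in P.
    by apply: (meet a) => //; [right; rewrite HE|mem_dec|mem_dec|set_dec].
  have [pHp _] := gP p pP.
  suff /pm_even : pm D1 by rewrite oD1.
  apply: (pm_closed pHp); first by set_dec.
  apply/adj_closedP => u v uD vH uv; apply: (adj_closedP _ _ clD1 u) => //; mem_dec.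
have [p0 p0H ap0] : exists2 d, d \in H & a -- d.
  apply: (touch coA aA aH HA); last exact: odd_nonempty.
  by apply/adj_closedP => u v; rewrite HE.
have p0P : p0 \in P by rewrite inE p0H Na // (subsetP HA).
have nP p x y : p \in P -> x \in H -> y \in H -> p -- x -> p -- y -> x != y ->
     x \notin P -> y \notin P -> x -- y.
  rewrite !inE => /andP[pH psp] xH yH px py xy.
  rewrite xH yH /= !negb_or => /andP[sx tx] /andP[sy ty].
  case/orP: psp => [sp|tp].
    by apply: (@claw3 _ HG p s x y) => //; rewrite 1?adjC //; mem_dec.
  by apply: (@claw3 _ HG p t x y) => //; rewrite 1?adjC //; mem_dec.
have hg p D : p \in P -> iscomp (H :\ p) D -> good D /\ exists2 q, q \in D & q \in P.
  by move=> pP cD; split; [case: (gP p pP) => _; apply|apply: meetp cD].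
case: (near_clique coH PH hg nP (ex_intro _ p0 p0P)) => [cH|[p [p' [PE pp' npp' adj]]]]; last first.
  exfalso.
  (* A further vertex q of H is no attachment vertex, hence not adjacent to a. The triple b, q, a
     then has a complement matched by s u, t v and an even clique. *)
  have bad u v : u \in H -> v \in H -> u != v -> P = [set u; v] -> s -- u -> t -- v -> False.
    move=> uH vH uv PE' su tv.
    have [q qQ] : exists q, q \in H :\ u :\ v by apply: odd_nonempty; rewrite odd_D2.
    have qP : q \notin P by rewrite PE'; mem_dec.
    have qH : q \in H by mem_dec.
    have naq : ~~ (q -- a).
      rewrite adjC; apply: contra qP => aq; rewrite inE qH Na //; exact: (subsetP HA).
    have bq : b != q by mem_dec.
    apply: (no_triple HG bq (bA q (subsetP HA q qH)) (bA a aA) naq).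
    pm_edge s u.
    pm_edge t v.
    have -> : (~: [set b; q; a]) :\ s :\ u :\ t :\ v = H :\ u :\ v :\ q by set_dec.
    apply: clique_pm; last by rewrite odd_D1 // odd_D2 // oH.
    move=> x y xQ yQ xy; apply: adj => //; [by mem_dec|by mem_dec|].
    by rewrite -PE PE'; apply: (set2_neq (w := u)); [rewrite !inE eqxx|mem_dec].
  have [] : p \in P /\ p' \in P by rewrite PE !inE !eqxx orbT.
  rewrite !inE => /andP[pH psp] /andP[p'H psp'].
  have [pA p'A] := (subsetP HA p pH, subsetP HA p' p'H).
  case/orP: psp => [sp|tp]; case/orP: psp' => [sp'|tp'].
  - by rewrite (cut2_clique c2 pA p'A) in npp'.
  - exact: (bad p p').
  - by apply: (bad p' p) => //; [rewrite eq_sym|rewrite PE setUC].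
  - by rewrite (cut2_clique (cut2_swap c2) pA p'A) in npp'.
have [ca|] := boolP [forall x in H, a -- x].
  right; have {}ca := forall_inP ca; rewrite AE => x y /setU1P[->|xH] /setU1P[->|yH] xy.
  - by rewrite eqxx in xy.
  - exact: ca.
  - by rewrite adjC ca.
  - exact: cH.
rewrite negb_forall_in => /exists_inP[h hH ah]; left.
have hA := subsetP HA h hH.
have ca u v x : cut2 u v A [set b] -> u -- a -> x \in H -> u -- x -> a -- x.
  by move=> cuv ua xH ux; apply: (cut2_clique cuv) => //; [apply: (subsetP HA)|mem_dec].
(* Distinct x and y would match s and t and leave an even clique outside the triple b, a, h. *)
have nosdr x y : x \in H -> y \in H -> s -- x -> t -- y -> x = y.
  move=> xH yH sx ty; apply/eqP/negPn/negP => xy.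
  have hx : h != x by apply: contraNneq ah => ->; apply: ca c2 sa xH sx.
  have hy : h != y by apply: contraNneq ah => ->; apply: ca (cut2_swap c2) ta yH ty.
  have ba : b != a by mem_dec.
  apply: (no_triple HG ba (bA a aA) (bA h hA) ah).
  pm_edge s x.
  pm_edge t y.
  have -> : (~: [set b; a; h]) :\ s :\ x :\ t :\ y = H :\ x :\ y :\ h by set_dec.
  have hxy : h \in H :\ x :\ y by mem_dec.
  apply: clique_pm; last by rewrite odd_D1 // odd_D2 // oH.
  by apply: cliqueS cH; set_dec.
have hP : h \notin P.
  by apply: contra ah; rewrite inE => /andP[_ /orP[/(ca _ _ _ c2)|/(ca _ _ _ (cut2_swap c2))]]; apply.
have second p : p \in P -> exists2 q, q \in P & q != p.
  move=> pP; have hp : h \in H :\ p by rewrite !inE hH andbT; apply: contraNneq hP => ->.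
  have [D cD hD] := comp_of hp; have [q qD qP] := meetp p D pP cD.
  by have [DH _ _ _] := cD; exists q => //; mem_dec.
have fin u v : cut2 u v A [set b] -> u -- a -> v -- a ->
    (forall x, x \in P -> (u -- x) || (v -- x)) ->
    (forall x y, x \in H -> y \in H -> u -- x -> v -- y -> x = y) ->
    (forall x, x \in H -> v -- x -> x \in P) -> (forall x, x \in H -> u -- x -> x \in P) ->
    v -- p0 -> inG21 G.
  move=> cuv ua va Puv sdr Pv Pu vp0.
  (* With v -- [p0], every neighbour of u in H equals [p0]; a second attachment vertex q then rules
     out u -- [p0] too, so u has no neighbour in H. *)
  have Pp0 x : x \in H -> u -- x -> x = p0 by move=> xH ux; apply: sdr.
  have [q qP qp0] := second p0 p0P.
  have qH := subsetP PH q qP.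
  have up0 : ~~ (u -- p0).
    apply/negP => up0; case/orP: (Puv q qP) => [uq|vq].
      by rewrite (Pp0 q) ?eqxx in qp0.
    by rewrite (sdr p0 q) ?eqxx in qp0.
  have uH x : x \in H -> ~~ (u -- x).
    by move=> xH; apply: contra up0 => ux; rewrite -(Pp0 x).
  have vq : v -- q by have := Puv q qP; rewrite (negbTE (uH q qH)).
  apply: (@mk_G21 u v A b a p0 q h); rewrite ?HE //.
  - move=> x xH; apply/idP/idP => [vx|ax]; first exact: ca (cut2_swap cuv) va xH vx.
    have : x \in P by rewrite inE xH Na // (subsetP HA).
    by move/Puv; rewrite (negbTE (uH x xH)).
  - by rewrite eq_sym.
  - by apply: contra hP; apply: Pv.
have [Ps Pt] : (forall x, x \in H -> s -- x -> x \in P) /\ (forall x, x \in H -> t -- x -> x \in P).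
  by split=> x xH h'; rewrite inE xH h' ?orbT.
have Pst x : x \in P -> (s -- x) || (t -- x) by rewrite inE => /andP[].
case/orP: (Pst p0 p0P) => [sp0|tp0]; last exact: fin c2 sa ta Pst nosdr Pt Ps tp0.
apply: fin (cut2_swap c2) ta sa _ _ Ps Pt sp0 => [x /Pst|x y xH yH tx sy]; first by rewrite orbC.
by apply/esym; apply: nosdr.
Qed.

(** {w, t} is another cut, with even side {s, b} and odd side [A :\ w]. If the latter has several
    vertices, [cut2_big] applies; otherwise A is an edge. *)
Lemma singleton_single s t A b w : cut2 s t A [set b] -> w \in A -> s -- w ->
  {in A, forall x, s -- x -> x = w} -> ~~ (t -- w) ->
  two_connected_family \/ clique A.
Proof.
move=> c2 wA sw su tw; have [sb tb bA eA] := singleton_facts c2.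
have [dAB cov [sA tA] [sB tB] st] := cut2_facts c2.
have [h hA hw] := even_other eA wA.
have wt : w != t by mem_dec.
have cC : iscomp (~: [set w; t]) [set s; b].
  split; [by set_dec|by exists s; rewrite !inE eqxx| |by apply: clique_conn; apply: clique2].
  apply/adj_closedP => u v /set2P[->|->] vN uv.
    have : [|| v == s, v == t, v \in A | v \in [set b]] by mem_dec.
    case/or4P => [/eqP->|/eqP E|vA|/set1P->]; rewrite ?inE ?eqxx ?orbT //.
      by move: vN; rewrite E !inE eqxx orbT.
    by move: vN; rewrite (su v vA uv) !inE eqxx.
  have : [|| v == s, v == t, v \in A | v \in [set b]] by mem_dec.
  case/or4P => [/eqP->|/eqP E|vA|/set1P->]; rewrite ?inE ?eqxx ?orbT //.
    by move: vN; rewrite E !inE eqxx orbT.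
  by rewrite (negbTE (bA v vA)) in uv.
have c2' : cut2 w t [set s; b] (~: [set w; t] :\: [set s; b]).
  apply: (cut2P) => //; first by rewrite adjC.
  by exists h; mem_dec.
have RE : ~: [set w; t] :\: [set s; b] = A :\ w by set_dec.
rewrite RE in c2'.
have [R1|R1] := leqP #|A :\ w| 1; [right|left].
  have Ah u : u \in A -> u = w \/ u = h.
    move=> uA; have [->|uw] := eqVneq u w; [by left|right].
    apply/eqP/negPn/negP => uh; move: R1; rewrite leqNgt => /negP[].
    by apply/card_gt1P; exists u, h; split=> //; mem_dec.
  have AE : A = [set w; h].
    by apply/setP => u; rewrite !inE; apply/idP/idP => [/Ah[]->|/orP[]/eqP->//]; rewrite eqxx ?orbT.
  have [x xR wx] := cut2_touch (cut2_flip c2').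
  have xA : x \in A by mem_dec.
  case: (Ah x xA) wx => ->; first by rewrite sedge_irrefl.
  by move=> wh; rewrite AE; apply: clique2.
apply: (cut2_big c2') => //.
by rewrite cards2; have -> : s != b by mem_dec.
Qed.

(** s may be matched to x or to x', so both deletions leave good components. If x touched D, this
    would contradict [good_comp_absurd] in [A :\ y]. *)
Lemma double_untouched s t b A x x' y D : cut2 s t A [set b] ->
  x \in A -> x' \in A -> y \in A -> s -- x -> s -- x' -> t -- y ->
  x != x' -> x != y -> x' != y -> iscomp (A :\ x :\ y) D -> x' \notin D ->
  {in D, forall d, ~~ (x -- d)}.
Proof.
move=> c2 xA x'A yA sx sx' ty xx' xy x'y cD x'D d dD; apply/negP => xd.
have [_ gU] := singleton_pair c2 xA yA xy sx ty.
have [_ gU'] := singleton_pair c2 x'A yA x'y sx' ty.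
apply: (@good_comp_absurd G (A :\ y) D x x') => //.
- by move=> C; rewrite set_D1C; apply: gU'.
- by mem_dec.
- by mem_dec.
- by rewrite set_D1C.
- by have [] := gU D cD.
- by exists d.
Qed.

(** * Each cut vertex has two neighbours in A, and none is common *)

Section Double.
Variables (s t b : G) (A : {set G}).
Hypothesis c2 : cut2 s t A [set b].
Variables (x x' y y' : G).
Hypotheses (xA : x \in A) (x'A : x' \in A) (yA : y \in A) (y'A : y' \in A).
Hypotheses (sx : s -- x) (sx' : s -- x') (ty : t -- y) (ty' : t -- y').
Hypotheses (xx' : x != x') (yy' : y != y').
Hypothesis st_disj : {in A, forall z, ~~ ((s -- z) && (t -- z))}.

Let st_neq u v : u \in A -> s -- u -> t -- v -> u != v.
Proof.
by move=> uA su tv; apply: contraTneq tv => <-; have := st_disj uA; rewrite su.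
Qed.

Let xy_neq : [/\ x != y, x' != y, x != y' & x' != y'].
Proof. by split; apply: st_neq. Qed.

Let U := A :\ x :\ y.

Lemma double_untouched_y D : iscomp U D -> y' \notin D -> {in D, forall d, ~~ (y -- d)}.
Proof.
move=> cD y'D; rewrite /U set_D1C in cD.
have [yx y'x] : y != x /\ y' != x by split; rewrite eq_sym st_neq.
exact: (double_untouched (cut2_swap c2) yA y'A xA ty ty' sx yy' yx y'x cD y'D).
Qed.

Lemma double_untouched_x D : iscomp U D -> x' \notin D -> {in D, forall d, ~~ (x -- d)}.
Proof.
move=> cD x'D; have [xy x'y] : x != y /\ x' != y by split; apply: st_neq.
exact: (double_untouched c2 xA x'A yA sx sx' ty xx' xy x'y cD x'D).
Qed.

(** Claws on the cycle force s to see one of its edges and t the opposite one. Then a triple with b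
    has a matchable complement: two opposite cycle vertices if x -- y, and x, y otherwise. *)
Lemma double_not_C4 : ~ isC4 U.
Proof.
move=> c4; have [sb tb bA eA] := singleton_facts c2.
have [dAB cov [sA tA] [sB tB] st] := cut2_facts c2.
have [xy x'y xy' x'y'] := xy_neq.
have x'U : x' \in U by rewrite /U; mem_dec.
have y'U : y' \in U by rewrite /U; mem_dec.
have UA : U \subset A by rewrite /U; set_dec.
have AE : A = x |: (y |: U) by rewrite /U; set_dec.
have [xU yU] : x \notin U /\ y \notin U by rewrite !inE !eqxx andbF.
clearbody U.
have nt v : v \in U -> s -- v -> ~~ (t -- v).
  by move=> vU sv; have := st_disj (subsetP UA v vU); rewrite sv.
have key u v w z : C4_at U u v w z -> s -- u -> s -- v -> t -- w -> t -- z -> False.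
  case=> Ue [n12 n13 n14 [n23 n24 n34]] [a12 a23 a34 a41] [b13 b24] su sv tw tz.
  have [uU vU wU zU] : [/\ u \in U, v \in U, w \in U & z \in U] by rewrite Ue !inE !eqxx !orbT.
  have [uA vA wA zA] : [/\ u \in A, v \in A, w \in A & z \in A] by split; apply: (subsetP UA).
  have [xyA|nxy] := boolP (x -- y).
    have bu : b != u by mem_dec.
    apply: (no_triple HG bu (bA u uA) (bA w wA) b13).
    pm_edge s v.
    pm_edge t z.
    pm_edge x y.
    by apply: pm0; set_dec.
  have bx : b != x by mem_dec.
  apply: (no_triple HG bx (bA x xA) (bA y yA) nxy).
  pm_edge s u.
  pm_edge t z.
  pm_edge v w.
  by apply: pm0; set_dec.
have edge u v w z : C4_at U u v w z -> s -- u -> s -- v -> False.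
  move=> h su sv; have [Ue [n12 n13 n14 [n23 n24 n34]] [a12 a23 a34 a41] [b13 b24]] := h.
  have [uU vU wU zU] : [/\ u \in U, v \in U, w \in U & z \in U] by rewrite Ue !inE !eqxx !orbT.
  have [uA vA wA zA] : [/\ u \in A, v \in A, w \in A & z \in A] by split; apply: (subsetP UA).
  have [tu tv] := (nt u uU su, nt v vU sv).
  have [t_u t_v t_w t_z] : [/\ t != u, t != v, t != w & t != z] by split; mem_dec.
  suff [tw tz] : t -- w /\ t -- z by apply: key h su sv tw tz.
  move: (y'U); rewrite Ue !inE -!orbA => /or4P[]/eqP E; move: (ty'); rewrite E ?(negbTE tu) ?(negbTE tv) // => tt; split=> //.
  - have [wv wt wz] : [/\ w -- v, w -- t & w -- z] by rewrite adjC [w -- t]adjC.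
    by apply: (claw3 HG wv wt wz) => //; [rewrite eq_sym|rewrite adjC].
  - have [zu zt zw] : [/\ z -- u, z -- t & z -- w] by rewrite [z -- t]adjC [z -- w]adjC.
    by apply: (claw3 HG zu zt zw) => //; [rewrite eq_sym|rewrite adjC].
have [c3 [c4' [c5 h]]] := C4_from c4 x'U.
have [Ue [n12 n13 n14 [n23 n24 n34]] [a12 a23 a34 a41] [b13 b24]] := h.
have [i3 i5] : c3 \in U /\ c5 \in U by rewrite Ue !inE !eqxx !orbT.
have [j3 j5] := (subsetP UA c3 i3, subsetP UA c5 i5).
have [s3|s3] := boolP (s -- c3); first exact: edge h sx' s3.
apply: (edge _ _ _ _ (C4_rot (C4_rot (C4_rot h))) _ sx').
have [k1 k2 k3] : [/\ x' -- c3, x' -- s & x' -- c5] by rewrite [x' -- s]adjC [x' -- c5]adjC.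
by apply: (claw3 HG k1 k2 k3) => //; [mem_dec|mem_dec|rewrite adjC].
Qed.

(** Each missing adjacency at x or y gives an independent triple with b; the second neighbours x'
    and y' let s and t be matched outside it. *)
Lemma double_clique : clique U -> clique A.
Proof.
move=> cU; have [sb tb bA eA] := singleton_facts c2.
have [dAB cov [sA tA] [sB tB] st] := cut2_facts c2.
have [xy x'y xy' x'y'] := xy_neq.
have eU : ~~ odd #|U| by rewrite odd_D2.
have x'U : x' \in U by rewrite /U; mem_dec.
have y'U : y' \in U by rewrite /U; mem_dec.
have UA : U \subset A by rewrite /U; set_dec.
have AE : A = x |: (y |: U) by rewrite /U; set_dec.
have [xU yU] : x \notin U /\ y \notin U by rewrite !inE !eqxx andbF.
clearbody U.
have bx : b != x by mem_dec.
have by_ : b != y by mem_dec.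
have xx'A : x -- x' by apply: (cut2_clique c2).
have yy'A : y -- y' by apply: (cut2_clique (cut2_swap c2)).
have xU' c : c \in U -> x -- c.
  move=> cU'; have cA := subsetP UA c cU'; apply/negPn/negP => xc.
  have cx' : c != x' by apply: contraNneq xc => ->.
  apply: (no_triple HG bx (bA x xA) (bA c cA) xc).
  pm_edge s x'.
  pm_edge t y.
  have -> : (~: [set b; x; c]) :\ s :\ x' :\ t :\ y = U :\ c :\ x' by set_dec.
  by apply: clique_pm; [apply: cliqueS cU; set_dec|rewrite odd_D2].
have yU' c : c \in U -> y -- c.
  move=> cU'; have cA := subsetP UA c cU'; apply/negPn/negP => yc.
  have cy' : c != y' by apply: contraNneq yc => ->.
  apply: (no_triple HG by_ (bA y yA) (bA c cA) yc).
  pm_edge s x.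
  pm_edge t y'.
  have -> : (~: [set b; y; c]) :\ s :\ x :\ t :\ y' = U :\ c :\ y' by set_dec.
  by apply: clique_pm; [apply: cliqueS cU; set_dec|rewrite odd_D2].
have xyA : x -- y.
  apply/negPn/negP => nxy.
  apply: (no_triple HG bx (bA x xA) (bA y yA) nxy).
  pm_edge s x'.
  pm_edge t y'.
  have -> : (~: [set b; x; y]) :\ s :\ x' :\ t :\ y' = U :\ x' :\ y' by set_dec.
  by apply: clique_pm; [apply: cliqueS cU; set_dec|rewrite odd_D2].
rewrite AE => u v /setU1P[->|/setU1P[->|uU]] /setU1P[->|/setU1P[->|vU]] uv.
- by rewrite eqxx in uv.
- by [].
- exact: xU'.
- by rewrite adjC.
- by rewrite eqxx in uv.
- exact: yU'.
- by rewrite adjC xU'.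
- by rewrite adjC yU'.
- exact: cU.
Qed.

(** Another component of U would avoid x' and y', so neither x nor y would touch it and A would be
    disconnected. *)
Lemma double_connected D : iscomp U D -> x' \in D -> y' \in D -> clique A.
Proof.
move=> cD x'D y'D; have [[AS A0 clA coA] _ _ _] := cut2_sep c2.
have [xy x'y xy' x'y'] := xy_neq.
have [DU D0 clD coD] := cD.
have UD : U = D.
  apply/eqP; rewrite eq_sym eqEsubset DU -setD_eq0; apply/negPn/negP => /set0Pn[u uR].
  have [C cC' uC] := comp_of uR; have cC := iscompD cD cC'; have [CR _ _ _] := cC'.
  have [CU _ /adj_closedP clC _] := cC.
  have x'C : x' \notin C by mem_dec.
  have y'C : y' \notin C by mem_dec.
  have nx := double_untouched_x cC x'C; have ny := double_untouched_y cC y'C.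
  have E : C = A.
    apply: (coA u) => //; first by apply: subset_trans CU _; rewrite /U; set_dec.
    apply/adj_closedP => v w vC wA vw; apply: (clC v) => //.
    rewrite !inE wA andbT; apply/andP; split.
      by apply: contraTneq vw => ->; rewrite adjC ny.
    by apply: contraTneq vw => ->; rewrite adjC nx.
  by have /(subsetP CU) : x \in C; [rewrite E|rewrite !inE eqxx andbF].
have [_ gU] := singleton_pair c2 xA yA xy sx ty.
have [_ [gD|gD]] : good U by rewrite UD; apply: gU.
  exact: double_clique.
by case: double_not_C4.
Qed.

(** y does not touch D, and x touches no other component. Deleting x' and y' instead leaves the edge
    xy as a component, so the odd set [D :\ x'] would have to be perfectly matchable. *)
Lemma double_split D : iscomp U D -> x' \in D -> y' \notin D -> False.
Proof.
move=> cD x'D y'D; have [[AS A0 clA coA] _ _ _] := cut2_sep c2.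
have [xy x'y xy' x'y'] := xy_neq.
have [DU D0 /adj_closedP clD coD] := cD.
have nyD := double_untouched_y cD y'D.
have [_ gU] := singleton_pair c2 xA yA xy sx ty.
have [eD _] := gU D cD.
have UE u : (u \in U) = [&& u != y, u != x & u \in A] by rewrite !inE.
have inD u : u \in U -> x -- u -> u \in D.
  move=> uU xu; have [C cC uC] := comp_of uU.
  have [x'C|x'C] := boolP (x' \in C).
    by rewrite -(comp_unique cD x'D) (comp_unique cC x'C).
  by rewrite (negbTE (double_untouched_x cC x'C uC)) in xu.
have [xD yD] : x \notin D /\ y \notin D.
  by split; apply/negP => /(subsetP DU); rewrite UE eqxx ?andbF.
have DA : D \subset A by apply: subset_trans DU _; rewrite /U; set_dec.
(* Otherwise [x |: D] would be closed in the connected set A. *)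
have xyA : x -- y.
  apply/negPn/negP => nxy.
  have E : x |: D = A.
    apply: (coA x); [by rewrite !inE eqxx|by set_dec|].
    apply/adj_closedP => u v uC vA uv; rewrite inE; apply/orP.
    have [->|vx] := eqVneq v x; [by left; rewrite inE|right].
    have [vy|vy] := eqVneq v y.
      move: uC uv; rewrite vy => /setU1P[->|uD]; first by rewrite (negbTE nxy).
      by rewrite adjC (negbTE (nyD u uD)).
    have vU : v \in U by rewrite UE vx vy.
    by case/setU1P: uC => [ux|uD]; [apply: inD; rewrite // -ux|apply: clD uv].
  by move/setP/(_ y): E; rewrite yA !inE (negbTE yD) eq_sym (negbTE xy).
have [pW gW] := singleton_pair c2 x'A y'A x'y' sx' ty'.
set W := A :\ x' :\ y' in pW gW; have WE u : (u \in W) = [&& u != y', u != x' & u \in A] by rewrite !inE.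
have xW : x \in W by rewrite WE xx' xy' xA.
have yW : y \in W by rewrite WE yy' eq_sym x'y yA.
have WA : W \subset A by rewrite /W; set_dec.
clearbody W.
have [C cC xC] := comp_of xW; have [CW _ /adj_closedP clC coC] := cC.
have yC : y \in C by apply: clC xyA.
have CU u : u \in C -> u != x -> u != y -> u \in U.
  by move=> /(subsetP CW)/(subsetP WA) uA ux uy; rewrite UE ux uy.
have CE u : u \in C -> u = x \/ u = y.
  move=> uC; have [->|ux] := eqVneq u x; [by left|].
  have [->|uy] := eqVneq u y; [by right|exfalso].
  have uU := CU u uC ux uy.
  have [_ [cC'|c4]] := gW C cC.
    have xu : x -- u by apply: cC'; rewrite // eq_sym.
    by have := nyD u (inD u uU xu); rewrite cC' // eq_sym.
  have [c3 [c4' [c5 h]]] := C4_from c4 xC.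
  (* On a 4-cycle [x y w z], z lies in D as a neighbour of x, hence so does w; but y has no
     neighbour in D. *)
  have key w z : C4_at C x y w z -> False.
    case=> Ce [n12 n13 n14 [n23 n24 n34]] [a12 a23 a34 a41] [b13 b24].
    have [wC zC] : w \in C /\ z \in C by rewrite Ce !inE !eqxx !orbT.
    have zD : z \in D by apply: inD; [apply: CU => //; rewrite eq_sym|rewrite adjC].
    have wU : w \in U by apply: CU => //; rewrite eq_sym.
    have wD : w \in D by apply: (clD z) => //; rewrite adjC.
    by rewrite (negbTE (nyD w wD)) in a23.
  have [Ce [n12 n13 n14 [n23 n24 n34]] [a12 a23 a34 a41] [b13 b24]] := h.
  move: (yC); rewrite Ce !inE -!orbA eq_sym (negbTE xy) /= => /or3P[]/eqP E.
  - by apply: (key c4' c5); rewrite E.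
  - by rewrite -E xyA in b13.
  - apply: (key c4' c3); rewrite E; split=> //.
    + by rewrite Ce; set_dec.
    + by split; rewrite // ?[c4' == _]eq_sym ?[c5 == _]eq_sym.
    + by split; rewrite adjC.
    + by split; rewrite // adjC.
suff /pm_even : pm (D :\ x') by rewrite odd_D1 // eD.
apply: (pm_closed pW).
  by apply/subsetP => u /setD1P[ux' uD]; rewrite WE ux' (subsetP DA) // !andbT; apply: contraNneq y'D => <-.
apply/adj_closedP => u v /setD1P[ux' uD] vW uv.
have uW : u \in W by rewrite WE ux' (subsetP DA) // !andbT; apply: contraNneq y'D => <-.
have [vx|vx] := eqVneq v x.
  have /CE[E|E] : u \in C by apply: (clC x) => //; rewrite adjC -vx.
    by rewrite -E uD in xD.
  by rewrite -E uD in yD.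
have [vy|vy] := eqVneq v y.
  by rewrite vy adjC (negbTE (nyD u uD)) in uv.
apply/setD1P; move: vW; rewrite WE => /and3P[_ vx' vA]; split=> //.
by apply: (clD u) => //; rewrite UE vx vy.
Qed.

Lemma singleton_double : clique A.
Proof.
have [xy x'y xy' x'y'] := xy_neq.
have x'U : x' \in U by rewrite !inE x'y eq_sym xx' x'A.
have [D cD x'D] := comp_of x'U.
have [y'D|y'D] := boolP (y' \in D); first exact: double_connected cD x'D y'D.
by case: (double_split cD x'D y'D).
Qed.
End Double.

Lemma cut2_family s t A B : cut2 s t A B -> ~~ odd #|A| -> two_connected_family.
Proof.
move=> c2 eA; have oB := cut2_odd c2 eA.
have [B1|B1] := leqP #|B| 1; last exact: cut2_big c2 eA B1.
have [b Bb] : exists b, B = [set b].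
  by apply/cards1P; move: B1 oB; case: #|B| => [|[]].
rewrite Bb in c2; have [sb tb bA _] := singleton_facts c2.
(* A singleton is a clique, so [cut2_cliques] finishes as soon as A is a clique too. *)
suff [//|cA] : two_connected_family \/ clique A.
  apply: fam_22_23; apply: (cut2_cliques c2) => //.
  by move=> u v /set1P-> /set1P->; rewrite eqxx.
have [x xA sx] := cut2_touch c2; have [y yA ty] := cut2_touch (cut2_swap c2).
have [/exists_inP[a aA /andP[sa ta]]|nst] := boolP [exists a in A, (s -- a) && (t -- a)].
  by case: (singleton_common c2 aA sa ta) => h; [left; left|right].
have st_disj : {in A, forall z, ~~ ((s -- z) && (t -- z))}.
  by move=> z zA; apply: contra nst => h; apply/exists_inP; exists z.
have [/exists_inP[x' x'A /andP[x'x sx']]|nx] := boolP [exists x' in A, (x' != x) && (s -- x')]; last first.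
  apply: (singleton_single c2 xA sx); last by have := st_disj x xA; rewrite sx.
  move=> z zA sz; apply/eqP/negPn/negP => zx; case/negP: nx.
  by apply/exists_inP; exists z; rewrite // zx.
have [/exists_inP[y' y'A /andP[y'y ty']]|ny] := boolP [exists y' in A, (y' != y) && (t -- y')]; last first.
  apply: (singleton_single (cut2_swap c2) yA ty); last by have := st_disj y yA; rewrite ty andbT.
  move=> z zA tz; apply/eqP/negPn/negP => zy; case/negP: ny.
  by apply/exists_inP; exists z; rewrite // zy.
right; rewrite eq_sym in x'x; rewrite eq_sym in y'y.
exact: (singleton_double c2 xA x'A yA y'A sx sx' ty ty').
Qed.
End TwoCuts.

(** * Independent cuts of three vertices *)

Section ThreeCuts.
Variable G : sgraph.
Implicit Types (x y z s t p q r u v w a b : G) (S T U V W C D A B Z H P K L Q : {set G}).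
Hypothesis HG : critical G.
Hypothesis H2 : forall v : G, conn (~: [set v]).

Let cf := crit_claw HG.

(** Two vertices leave an odd number, hence some component is odd, and the vertices outside it form
    the even side. *)
Lemma two_cut_family s t : s != t -> ~~ (s -- t) -> ~ conn (~: [set s; t]) ->
  two_connected_family G.
Proof.
move=> st nst nc; have oS : odd #|~: [set s; t]| by rewrite (odd_setC HG) cards2 st.
have [|B cB oB] := @odd_comp _ cf (~: [set s; t]); first by move/pm_even; rewrite oS.
have [BS _ _ coB] := cB.
have [R0|[x xR]] := set_0Vmem (~: [set s; t] :\: B).
  case: nc; suff -> : ~: [set s; t] = B by [].
  by apply/eqP; rewrite eqEsubset BS -setD_eq0 R0 eqxx.
have c2 := cut2P HG H2 st nst cB (ex_intro _ x xR).
apply: (cut2_family HG H2 (cut2_flip c2)).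
by rewrite odd_set_sub // oS oB.
Qed.

Hypothesis H22 : forall s t : G, s != t -> ~~ (s -- t) -> conn (~: [set s; t]).

Record cut3 s1 s2 s3 A B : Prop := Cut3 {
  cut3_sep : separation [set s1; s2; s3] A B;
  cut3_neq : [/\ s1 != s2, s1 != s3 & s2 != s3];
  cut3_nadj : [/\ ~~ (s1 -- s2), ~~ (s1 -- s3) & ~~ (s2 -- s3)];
  cut3_odd : odd #|A| /\ odd #|B|;
  cut3_touch : forall s, s \in [set s1; s2; s3] ->
    (exists2 a, a \in A & s -- a) /\ (exists2 b, b \in B & s -- b)
}.

Lemma cut3_rot s1 s2 s3 A B : cut3 s1 s2 s3 A B -> cut3 s2 s3 s1 A B.
Proof.
have E : [set s1; s2; s3] = [set s2; s3; s1] by set_dec.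
case; rewrite E => sep [n12 n13 n23] [a12 a13 a23] o tch; split=> //.
  by rewrite ![_ == s1]eq_sym.
by rewrite ![_ -- s1]adjC.
Qed.

Lemma cut3_swap s1 s2 s3 A B : cut3 s1 s2 s3 A B -> cut3 s1 s3 s2 A B.
Proof.
have E : [set s1; s2; s3] = [set s1; s3; s2] by set_dec.
case; rewrite E => sep [n12 n13 n23] [a12 a13 a23] o tch; split=> //.
  by rewrite [s3 == _]eq_sym.
by rewrite [s3 -- _]adjC.
Qed.

Lemma cut3_flip s1 s2 s3 A B : cut3 s1 s2 s3 A B -> cut3 s1 s2 s3 B A.
Proof.
case=> sep n a [oA oB] tch; split=> //; first exact: sep_sym.
by move=> s /tch[].
Qed.

Lemma cut3_facts s1 s2 s3 A B : cut3 s1 s2 s3 A B ->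
  [/\ [disjoint A & B], forall x, [|| (x == s1) || (x == s2) || (x == s3), x \in A | x \in B],
      [/\ s1 \notin A, s2 \notin A & s3 \notin A],
      [/\ s1 \notin B, s2 \notin B & s3 \notin B] & anticomplete A B].
Proof.
case=> sep _ _ _ _; have cov := sep_cover sep; have nS := sep_notin sep.
have [] : [/\ s1 \in [set s1; s2; s3], s2 \in [set s1; s2; s3] & s3 \in [set s1; s2; s3]].
  by rewrite !inE !eqxx !orbT.
move=> /nS[? ?] /nS[? ?] /nS[? ?]; split=> //; [by case: sep| |exact: anti_sep sep].
by move=> x; at_dec x.
Qed.

Lemma cut3_A s1 s2 s3 A B : cut3 s1 s2 s3 A B -> exists2 a, a \in A & s1 -- a.
Proof. by case=> _ _ _ _ /(_ s1); rewrite !inE eqxx => /(_ isT)[]. Qed.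

Lemma cut3_claw s1 s2 s3 A B x : cut3 s1 s2 s3 A B -> s1 -- x -> s2 -- x -> s3 -- x -> False.
Proof.
case=> _ [n12 n13 n23] [a12 a13 a23] _ _ s1x s2x s3x.
have [x1 x2 x3] : [/\ x -- s1, x -- s2 & x -- s3] by rewrite ![x -- _]adjC.
by have := claw3 HG x1 x2 x3 n12 n13 n23 a12 a13; rewrite (negbTE a23).
Qed.

(** A single vertex would be adjacent to all three cut vertices and be the centre of a claw. *)
Lemma cut3_gt1 s1 s2 s3 A B : cut3 s1 s2 s3 A B -> 1 < #|A|.
Proof.
move=> c3; have c3' := cut3_rot c3; have c3'' := cut3_rot c3'.
rewrite ltnNge; apply/negP => A1; have [oA _] := cut3_odd c3.
have [a Aa] : exists a, A = [set a] by apply/cards1P; move: A1 oA; case: #|A| => [|[]].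
rewrite Aa in c3 c3' c3''.
have [x /set1P-> sx] := cut3_A c3; have [y /set1P-> sy] := cut3_A c3'.
have [z /set1P-> sz] := cut3_A c3''.
exact: cut3_claw c3 sx sy sz.
Qed.

(** Otherwise x is the only neighbour of both in A. It is not adjacent to [s1], as there is no claw,
    and {[s1], x} would separate the rest of A. *)
Lemma cut3_distinct s1 s2 s3 A B : cut3 s1 s2 s3 A B ->
  exists x y, [/\ x \in A, y \in A, x != y, s2 -- x & s3 -- y].
Proof.
move=> c3; have [dAB cov [s1A s2A s3A] [s1B s2B s3B] aAB] := cut3_facts c3.
have [x xA sx] := cut3_A (cut3_rot c3).
have [y yA sy] := cut3_A (cut3_rot (cut3_rot c3)).
have [xy|xy] := eqVneq x y; last by exists x, y.
subst y.
have [/exists_inP[z zA /andP[zx /orP[s2z|s3z]]]|nx] :=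
   boolP [exists z in A, (z != x) && ((s2 -- z) || (s3 -- z))].
- by exists z, x.
- by exists x, z; rewrite eq_sym.
have s1x : ~~ (s1 -- x) by apply/negP => s1x; exact: cut3_claw c3 s1x sx sy.
have s1_x : s1 != x by mem_dec.
have [z zAx] : exists z, z \in A :\ x.
  by apply/card_gt0P; have := cut3_gt1 c3; rewrite (cardsD1 x) xA.
have [n12 n13 n23] := cut3_neq c3.
suff E : A :\ x = ~: [set s1; x].
  have : s2 \in A :\ x by rewrite E; mem_dec.
  by rewrite !inE (negbTE s2A) andbF.
apply: (@H22 s1 x s1_x s1x z) => //; first by set_dec.
apply/adj_closedP => u v /setD1P[ux uA] vS uv; apply/setD1P; split; first by mem_dec.
have := cov v; case/or3P => [/orP[/orP[]|]/eqP E|//|vB].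
- by move: vS; rewrite E !inE eqxx.
- by case/negP: nx; apply/exists_inP; exists u; rewrite // ux adjC -E uv.
- by case/negP: nx; apply/exists_inP; exists u; rewrite // ux (adjC s3) -E uv orbT.
- by rewrite (negbTE (aAB u v uA vB)) in uv.
Qed.

(** [s1] is matched to p and the other two to distinct vertices of A, whose remainder is odd. *)
Lemma cut3_good s1 s2 s3 A B p D : cut3 s1 s2 s3 A B -> p \in B -> s1 -- p ->
  iscomp (B :\ p) D -> good D.
Proof.
move=> c3 pB sp; have [dAB cov [s1A s2A s3A] [s1B s2B s3B] aAB] := cut3_facts c3.
have [n12 n13 n23] := cut3_neq c3; have [oA oB] := cut3_odd c3.
have [x [y [xA yA xy sx sy]]] := cut3_distinct c3.
have [||||_ gB] := isolating_matching cf (crit_defect HG) (Z := A :\ x :\ y) (U := B :\ p).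
- pm_edge s1 p.
  pm_edge s2 x.
  pm_edge s3 y.
  by apply: pm0; set_dec.
- by set_dec.
- by rewrite odd_D2.
- by move=> u v uA vB; apply: aAB; mem_dec.
- exact: gB.
Qed.

(** In the exceptional case of [near_clique] the only attachment vertices are the non-adjacent p and
    q, which would form a 2-cut. *)
Lemma cut3_complete s1 s2 s3 A B : cut3 s1 s2 s3 A B -> clique B.
Proof.
move=> c3; have [dAB cov [s1A s2A s3A] [s1B s2B s3B] aAB] := cut3_facts c3.
have [n12 n13 n23] := cut3_neq c3; have [oA oB] := cut3_odd c3.
have [_ [BS B0 clB coB] _ _] := cut3_sep c3.
pose P := [set x in B | [|| s1 -- x, s2 -- x | s3 -- x]].
have PB : P \subset B by apply/subsetP => x; rewrite inE => /andP[].
have inP x : x \in B -> x \notin P -> [/\ ~~ (s1 -- x), ~~ (s2 -- x) & ~~ (s3 -- x)].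
  by move=> xB; rewrite inE xB /= !negb_or => /and3P.
have gP p D : p \in P -> iscomp (B :\ p) D -> good D.
  rewrite inE => /andP[pB /or3P[sp|sp|sp]].
  - exact: cut3_good c3 pB sp.
  - exact: cut3_good (cut3_rot c3) pB sp.
  - exact: cut3_good (cut3_rot (cut3_rot c3)) pB sp.
have reach D u v : D \subset B -> u \in D -> [disjoint D & P] -> u -- v -> v \in B.
  move=> DB uD dDP uv; have uB := subsetP DB u uD.
  have /(inP u uB)[e1 e2 e3] : u \notin P by rewrite (disjointFr dDP uD).
  case/or3P: (cov v) => [/orP[/orP[]|]/eqP E|vA|//].
  - by rewrite adjC E (negbTE e1) in uv.
  - by rewrite adjC E (negbTE e2) in uv.
  - by rewrite adjC E (negbTE e3) in uv.
  - by rewrite adjC (negbTE (aAB v u vA uB)) in uv.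
have meet p D : p \in P -> iscomp (B :\ p) D -> exists2 q, q \in D & q \in P.
  move=> pP [DB [d dD] /adj_closedP clD coD]; have pB := subsetP PB p pP.
  have [dDP|] := boolP [disjoint D & P]; last first.
    by rewrite -setI_eq0 => /set0Pn[q /setIP[qD qP]]; exists q.
  have DB' : D \subset B by apply: subset_trans DB (subsetDl _ _).
  have sD : s1 \notin D by apply/negP => /(subsetP DB'); rewrite (negbTE s1B).
  suff E : D = ~: [set p].
    by case/negP: sD; rewrite E !inE; apply: contraTneq pB => <-.
  apply: (@H2 p _ _ dD).
    by apply: subset_trans DB _; apply/subsetP => z; rewrite !inE => /andP[].
  apply/adj_closedP => u v uD; rewrite !inE => vp uv; apply: (clD u) => //.
  by rewrite !inE vp (reach D u v).
have hg p D : p \in P -> iscomp (B :\ p) D -> good D /\ exists2 q, q \in D & q \in P.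
  by move=> pP cD; split; [exact: gP cD|exact: meet cD].
have nP p x y : p \in P -> x \in B -> y \in B -> p -- x -> p -- y -> x != y ->
     x \notin P -> y \notin P -> x -- y.
  rewrite [p \in P]inE => /andP[pB psp] xB yB px py xy /(inP x xB)[x1 x2 x3] /(inP y yB)[y1 y2 y3].
  have go s : s \notin B -> s -- p -> ~~ (s -- x) -> ~~ (s -- y) -> x -- y.
    move=> sB; rewrite adjC => ps sx sy.
    by apply: (claw3 HG ps px py) => //; [apply: contraNneq sB => ->|apply: contraNneq sB => ->].
  by case/or3P: psp => sp; [apply: (go s1)|apply: (go s2)|apply: (go s3)].
have [b bB sb] := cut3_A (cut3_flip c3).
have bP : b \in P by rewrite inE bB sb.
case: (near_clique coB PB hg nP (ex_intro _ b bP)) => // -[p [q [PE pq npq adj]]].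
exfalso; have [pP qP] : p \in P /\ q \in P by rewrite PE !inE !eqxx orbT.
have [pB qB] := (subsetP PB p pP, subsetP PB q qP).
have [z zQ] : exists z, z \in B :\ p :\ q by apply: odd_nonempty; rewrite odd_D2.
have dQP : [disjoint B :\ p :\ q & P] by rewrite PE; set_dec.
have QB : B :\ p :\ q \subset B by set_dec.
have sQ : s1 \notin B :\ p :\ q by apply/negP => /(subsetP QB); rewrite (negbTE s1B).
suff E : B :\ p :\ q = ~: [set p; q].
  case/negP: sQ; rewrite E !inE negb_or.
  by apply/andP; split; apply: contraNneq s1B => ->.
apply: (H22 pq npq zQ).
  by apply/subsetP => u; rewrite !inE negb_or => /and3P[-> ->].
apply/adj_closedP => u v uQ; rewrite !inE negb_or => /andP[vp vq] uv.
by rewrite vp vq (reach _ u v QB).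
Qed.

(** If both missed x, they would form a triple with it; [s3] is matched into B and even cliques
    remain. *)
Lemma cut3_cover s1 s2 s3 A B x : cut3 s1 s2 s3 A B -> x \in A -> (s1 -- x) || (s2 -- x).
Proof.
move=> c3 xA; have [dAB cov [s1A s2A s3A] [s1B s2B s3B] aAB] := cut3_facts c3.
have [n12 n13 n23] := cut3_neq c3; have [oA oB] := cut3_odd c3; have [a12 _ _] := cut3_nadj c3.
have cA := cut3_complete (cut3_flip c3); have cB := cut3_complete c3.
apply/negPn/negP; rewrite negb_or => /andP[x1 x2].
apply: (no_triple HG n12 a12 x1 x2).
have [b bB sb] := cut3_A (cut3_flip (cut3_rot (cut3_rot c3))).
pm_edge s3 b.
have -> : (~: [set s1; s2; x]) :\ s3 :\ b = (A :\ x) :|: (B :\ b) by set_dec.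
apply: pmU; last by set_dec.
  by pm_subclique cA; rewrite odd_D1 // oA.
by pm_subclique cB; rewrite odd_D1 // oB.
Qed.

Lemma cut3_no_sdr s1 s2 s3 A B a b x y : cut3 s1 s2 s3 A B -> a \in A -> b \in B ->
  ~~ (s1 -- a) -> ~~ (s1 -- b) -> x \in A -> y \in A -> x != a -> y != a ->
  s2 -- x -> s3 -- y -> x = y.
Proof.
move=> c3 aA bB sa sb xA yA xa ya sx sy.
have [dAB cov [s1A s2A s3A] [s1B s2B s3B] aAB] := cut3_facts c3.
have [n12 n13 n23] := cut3_neq c3; have [oA oB] := cut3_odd c3.
have cA := cut3_complete (cut3_flip c3); have cB := cut3_complete c3.
apply/eqP/negPn/negP => xy; have s1a : s1 != a by mem_dec.
have ab := aAB a b aA bB.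
apply: (no_triple HG s1a sa sb ab).
pm_edge s2 x.
pm_edge s3 y.
have -> : (~: [set s1; a; b]) :\ s2 :\ x :\ s3 :\ y = (A :\ x :\ y :\ a) :|: (B :\ b) by set_dec.
apply: pmU; last by set_dec.
  apply: clique_pm; first by apply: cliqueS cA; set_dec.
  have aXY : a \in A :\ x :\ y by mem_dec.
  by rewrite odd_D1 // odd_D2 // oA.
by pm_subclique cB; rewrite odd_D1 // oB.
Qed.

(** By [cut3_no_sdr], [s2] and [s3] have no distinct neighbours in [A :\ a]. If both had one, it
    would be a single common vertex, but a third vertex of A is adjacent to one of them. *)
Lemma cut3_other s1 s2 s3 A B a b : cut3 s1 s2 s3 A B -> a \in A -> b \in B ->
  ~~ (s1 -- a) -> ~~ (s1 -- b) ->
  {in A, forall x, x != a -> ~~ (s2 -- x)} \/ {in A, forall x, x != a -> ~~ (s3 -- x)}.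
Proof.
move=> c3 aA bB sa sb; have [oA _] := cut3_odd c3.
have [/exists_inP[x xA /andP[xa sx]]|n2] := boolP [exists x in A, (x != a) && (s2 -- x)]; last first.
  by left=> x xA xa; apply: contra n2 => sx; apply/exists_inP; exists x; rewrite // xa.
have [/exists_inP[y yA /andP[ya sy]]|n3] := boolP [exists x in A, (x != a) && (s3 -- x)]; last first.
  by right=> y yA ya; apply: contra n3 => sy; apply/exists_inP; exists y; rewrite // ya.
exfalso; have [z zQ] : exists z, z \in A :\ a :\ x.
  by apply: odd_nonempty; rewrite odd_D2 // eq_sym.
have [zx za zA] : [/\ z != x, z != a & z \in A] by move: zQ; rewrite !inE => /and3P.
have E := cut3_no_sdr c3 aA bB sa sb xA yA xa ya sx sy.
case/orP: (cut3_cover (cut3_rot c3) zA) => [sz|sz].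
  have E' := cut3_no_sdr c3 aA bB sa sb zA yA za ya sz sy.
  by rewrite E' E eqxx in zx.
have E' := cut3_no_sdr c3 aA bB sa sb xA zA xa za sx sz.
by rewrite E' eqxx in zx.
Qed.

(** [s3], [s2], [s1] play the first, second and third vertex of the family; by [cut3_cover] each
    missing adjacency forces those of the other two. *)
Lemma cut3_G3 s1 s2 s3 A B a b : cut3 s1 s2 s3 A B -> a \in A -> b \in B ->
  ~~ (s1 -- a) -> ~~ (s1 -- b) ->
  {in A, forall x, x != a -> ~~ (s2 -- x)} -> {in B, forall x, x != b -> ~~ (s3 -- x)} ->
  inG3 G.
Proof.
move=> c3 aA bB sa sb sA sB.
have [dAB cov [s1A s2A s3A] [s1B s2B s3B] aAB] := cut3_facts c3.
have [n12 n13 n23] := cut3_neq c3; have [oA oB] := cut3_odd c3; have [a12 a13 a23] := cut3_nadj c3.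
have cA := cut3_complete (cut3_flip c3); have cB := cut3_complete c3.
have covA := fun x (xA : x \in A) => cut3_cover c3 xA.
have covB := fun x (xB : x \in B) => cut3_cover (cut3_swap (cut3_flip c3)) xB.
have covA3 := fun x (xA : x \in A) => cut3_cover (cut3_rot c3) xA.
have covB2 := fun x (xB : x \in B) => cut3_cover (cut3_rot (cut3_flip c3)) xB.
have covA' := fun x (xA : x \in A) => cut3_cover (cut3_swap c3) xA.
have covB' := fun x (xB : x \in B) => cut3_cover (cut3_flip c3) xB.
have sa2 : s2 -- a by have := covA a aA; rewrite (negbTE sa).
have sb3 : s3 -- b by have := covB b bB; rewrite (negbTE sb).
have s3all x : x \in A -> s3 -- x.
  move=> xA; have [->|xa] := eqVneq x a; first by have := covA' a aA; rewrite (negbTE sa).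
  by have := covA3 x xA; rewrite (negbTE (sA x xA xa)).
have s2all x : x \in B -> s2 -- x.
  move=> xB; have [->|xb] := eqVneq x b; first by have := covB' b bB; rewrite (negbTE sb).
  by have := covB2 x xB; rewrite (negbTE (sB x xB xb)) orbF.
have three K : odd #|K| -> 1 < #|K| -> 2 < #|K| by case: #|K| => [|[|[|]]].
have E : [set s3; s2; s1] = [set s1; s2; s3] by set_dec.
exists s3, s2, s1, A, B; split.
- split; last first.
    by rewrite E; apply: independent3.
  by rewrite /= !inE !negb_or [s3 == s2]eq_sym [s3 == s1]eq_sym [s2 == s1]eq_sym n12 n13 n23.
- by rewrite E; apply/separationP; case: c3.
- by split=> //; [apply/complete_inducedP|apply: three => //; apply: cut3_gt1 c3].
- by split=> //; [apply/complete_inducedP|apply: three => //; apply: cut3_gt1 (cut3_flip c3)].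
exists a, b; split=> //.
- apply/setP => x; rewrite !inE; apply/idP/idP.
    move=> sx; case/or3P: (cov x) => [/orP[/orP[]|]/eqP xE|->//|xB].
    + by rewrite xE adjC (negbTE a13) in sx.
    + by rewrite xE adjC (negbTE a23) in sx.
    + by rewrite xE sedge_irrefl in sx.
    + by apply/orP; right; apply: contraTT sx; apply: sB.
  by case/orP => [/s3all|/eqP->].
- apply/setP => x; rewrite !inE; apply/idP/idP.
    move=> sx; case/or3P: (cov x) => [/orP[/orP[]|]/eqP xE|xA|->//].
    + by rewrite xE adjC (negbTE a12) in sx.
    + by rewrite xE sedge_irrefl in sx.
    + by rewrite xE (negbTE a23) in sx.
    + by apply/orP; right; apply: contraTT sx; apply: sA.
  by case/orP => [/s2all|/eqP->].
- apply/setP => x; rewrite !inE; apply/idP/idP.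
    move=> sx; rewrite negb_or; have -> : x != a by apply: contraTneq sx => ->.
    have -> /= : x != b by apply: contraTneq sx => ->.
    case/or3P: (cov x) => [/orP[/orP[]|]/eqP xE|->//|->]; rewrite ?orbT //.
    + by rewrite xE sedge_irrefl in sx.
    + by rewrite xE (negbTE a12) in sx.
    + by rewrite xE (negbTE a13) in sx.
  rewrite negb_or => /andP[/andP[xa xb] /orP[xA|xB]].
    by have := covA x xA; rewrite (negbTE (sA x xA xa)) orbF.
  by have := covB x xB; rewrite (negbTE (sB x xB xb)) orbF.
Qed.

(** [s2] misses some a' and b', so [cut3_other] applies to it and makes [s1] or [s3] miss a third
    vertex z of A. As [s2] misses z too, this contradicts [cut3_cover]. *)
Lemma cut3_not_both s1 s2 s3 A B a b : cut3 s1 s2 s3 A B -> a \in A -> b \in B ->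
  ~~ (s1 -- a) -> ~~ (s1 -- b) ->
  {in A, forall x, x != a -> ~~ (s2 -- x)} -> {in B, forall x, x != b -> ~~ (s2 -- x)} ->
  False.
Proof.
move=> c3 aA bB sa sb sA sB; have [oA oB] := cut3_odd c3.
have [a' /setD1P[a'a a'A]] : exists a', a' \in A :\ a.
  by apply/card_gt0P; have := cut3_gt1 c3; rewrite (cardsD1 a) aA.
have [b' /setD1P[b'b b'B]] : exists b', b' \in B :\ b.
  by apply/card_gt0P; have := cut3_gt1 (cut3_flip c3); rewrite (cardsD1 b) bB.
have [z zQ] : exists z, z \in A :\ a :\ a' by apply: odd_nonempty; rewrite odd_D2 // eq_sym.
have [za' za zA] : [/\ z != a', z != a & z \in A] by move: zQ; rewrite !inE => /and3P.
have := cut3_other (cut3_rot c3) a'A b'B (sA a' a'A a'a) (sB b' b'B b'b).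
case=> /(_ z zA za') sz.
  by have := cut3_cover (cut3_rot c3) zA; rewrite (negbTE sz) orbF (negbTE (sA z zA za)).
by have := cut3_cover c3 zA; rewrite (negbTE sz) (negbTE (sA z zA za)).
Qed.

Lemma cut3_pair s1 s2 s3 A B a b : cut3 s1 s2 s3 A B -> a \in A -> b \in B ->
  ~~ (s1 -- a) -> ~~ (s1 -- b) -> inG3 G.
Proof.
move=> c3 aA bB sa sb.
case: (cut3_other c3 aA bB sa sb) => hA; case: (cut3_other (cut3_flip c3) bB aA sb sa) => hB.
- by case: (cut3_not_both c3 aA bB sa sb hA hB).
- exact: cut3_G3 c3 aA bB sa sb hA hB.
- exact: cut3_G3 (cut3_swap c3) aA bB sa sb hA hB.
- by case: (cut3_not_both (cut3_swap c3) aA bB sa sb hA hB).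
Qed.

Lemma cut3_not_full s1 s2 s3 A B : cut3 s1 s2 s3 A B ->
  ~~ ([forall x in A, s1 -- x] && [forall x in A, s2 -- x]).
Proof.
move=> c3; apply/negP => /andP[/forall_inP f1 /forall_inP f2].
have [x xA sx] := cut3_A (cut3_rot (cut3_rot c3)).
exact: cut3_claw c3 (f1 x xA) (f2 x xA) sx.
Qed.

(** On each side at most one of the three is complete, so one of them is complete to neither side
    and [cut3_pair] applies. *)
Lemma cut3_family s1 s2 s3 A B : cut3 s1 s2 s3 A B -> inG3 G.
Proof.
move=> c3; have c3' := cut3_rot c3; have c3'' := cut3_rot c3'.
have fin t1 t2 t3 : cut3 t1 t2 t3 A B ->
    ~~ [forall x in A, t1 -- x] -> ~~ [forall x in B, t1 -- x] -> inG3 G.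
  move=> c; rewrite !negb_forall_in => /exists_inP[a aA ta] /exists_inP[b bB tb].
  exact: cut3_pair c aA bB ta tb.
move: (cut3_not_full c3) (cut3_not_full c3') (cut3_not_full c3'').
move: (cut3_not_full (cut3_flip c3)) (cut3_not_full (cut3_flip c3')) (cut3_not_full (cut3_flip c3'')).
move: (fin _ _ _ c3) (fin _ _ _ c3') (fin _ _ _ c3'').
case: [forall x in A, s1 -- x]; case: [forall x in B, s1 -- x];
case: [forall x in A, s2 -- x]; case: [forall x in B, s2 -- x];
case: [forall x in A, s3 -- x]; case: [forall x in B, s3 -- x] => //= h1 h2 h3 *; by auto.
Qed.

(** The complement of an independent triple has even order and no perfect matching, so it has an odd
    component, and by parity a second one; a third component would give a claw. *)
Lemma three_cut : inG3 G.
Proof.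
have [s1 [s2 [s3 [n12 n13 n23 [a12 a13 a23]]]]] := crit_triple HG.
set T0 := [set s1; s2; s3].
have T0E : T0 = [set s1; s2; s3] by [].
have oS : ~~ odd #|~: T0|.
  by rewrite (odd_setC HG) /T0 -!setUA !cardsU1 cards1 !inE !negb_or n12 n13 n23.
have [A cA oA] := @odd_comp _ cf _ (no_triple HG n12 a12 a13 a23).
rewrite -/T0 in cA; have [AS A0 clA coA] := cA.
have [|B cB' oB] := @odd_comp _ cf (~: T0 :\: A).
  by move/pm_even; rewrite odd_set_sub // oA addbT oS.
have cB := iscompD cA cB'; have [BS B0 clB coB] := cB; have [BR _ _ _] := cB'.
clearbody T0.
have tch X i j k : iscomp (~: T0) X -> T0 = [set i; j; k] -> i != j -> i != k -> j != k -> ~~ (j -- k) ->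
    exists2 x, x \in X & i -- x.
  move=> [XS X0 clX coX] E ij ik jk njk.
  have iX : i \notin X by apply/negP => /(subsetP XS); rewrite E !inE eqxx.
  apply: (touch (H22 jk njk)) => //.
  - by rewrite !inE negb_or ij ik.
  - by apply: subset_trans XS _; rewrite E; set_dec.
  - by have <- : ~: T0 = ~: [set j; k] :\ i by rewrite E; set_dec.
have tchall X s : iscomp (~: T0) X -> s \in T0 -> exists2 x, x \in X & s -- x.
  move=> cX; rewrite T0E !inE -orbA => /or3P[]/eqP->.
  - exact: (tch X s1 s2 s3).
  - apply: (tch X s2 s3 s1) => //; [by rewrite T0E; set_dec|by rewrite eq_sym|by rewrite eq_sym|by rewrite adjC].
  - by apply: (tch X s3 s1 s2) => //; [rewrite T0E; set_dec|rewrite eq_sym|rewrite eq_sym].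
suff cov : ~: T0 = A :|: B.
  apply: (@cut3_family s1 s2 s3 A B); split; rewrite -?T0E //.
    by split=> //; set_dec.
  by move=> s sT; split; apply: tchall.
have s1T : s1 \in T0 by rewrite T0E !inE eqxx.
have [b bB] := B0; have bR := subsetP BR b bB.
have sep := two_comps HG cA (ex_intro _ b bR) (fun C cC => tchall C s1 cC s1T).
by have := comp_unique (sep_r sep) bR; rewrite (comp_unique cB bB) => E; set_dec.
Qed.
End ThreeCuts.

Lemma critical_family (G : sgraph) : critical G ->
  [\/ inG1 G, two_connected_family G | inG3 G].
Proof.
move=> HG.
have [h1|] := boolP [forall v : G, connb (~: [set v])]; last first.
  by rewrite negb_forall => /existsP[v /connP nc]; apply: Or31; apply: cut_vertex nc.
have H2 (v : G) : conn (~: [set v]) by apply/connP; apply: (forallP h1).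
have [h2|] := boolP [forall s : G, forall t : G, (s != t) && ~~ (s -- t) ==> connb (~: [set s; t])].
  apply: Or33; apply: three_cut => // s t st nst.
  by have /forallP/(_ t)/implyP h := forallP h2 s; apply/connP/h/andP.
rewrite negb_forall => /existsP[s]; rewrite negb_forall => /existsP[t].
rewrite negb_imply => /andP[/andP[st nst] /connP nc].
by apply: Or32; apply: two_cut_family st nst nc.
Qed.

(** * Matchings as perfectly matchable sets *)

Section Matchings.
Variable G : sgraph.
Implicit Types (x y z : G) (S T U : {set G}) (M N : {set {set G}}).

Lemma edgesP (e : {set G}) :
  reflect (exists x y, x -- y /\ e = [set x; y]) (e \in edges G).
Proof.
rewrite inE; apply: (iffP existsP) => [[x /existsP[y /andP[xy /eqP]]]|[x [y [xy ->]]]].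
  by exists x, y.
by exists x; apply/existsP; exists y; rewrite xy eqxx.
Qed.

Lemma pm_matching U : pm U -> exists2 M, matching M & cover M = U.
Proof.
elim=> [|x y {}U xU yU xy _ [M /andP[ME tM] cM]].
  exists set0; last by rewrite /cover big_set0.
  by rewrite /matching sub0set /trivIset /cover !big_set0 cards0.
exists ([set x; y] |: M).
  apply/andP; split.
    by apply/subsetP => e /setU1P[->|/(subsetP ME)//]; apply/edgesP; exists x, y.
  rewrite setUC; apply: trivIsetU => //; first exact: trivIset1.
  by rewrite cover1 cM; set_dec.
rewrite /cover bigcup_setU big_set1 -/(cover M) cM; apply/setP => z; rewrite !inE.
have [->|zx] := eqVneq z x; first by rewrite xU.
by have [->|zy] := eqVneq z y; rewrite ?yU.
Qed.

Lemma matching_pm M : matching M -> pm (cover M) /\ #|cover M| = #|M|.*2.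
Proof.
have [n] := ubnP #|M|; elim: n M => // n IH M; rewrite ltnS => leMn mM.
have /andP[ME tM] := mM.
have [->|[e eM]] := set_0Vmem M; first by rewrite /cover big_set0 !cards0; split=> //; apply: pm_nil.
have /edgesP[x [y [xy eE]]] := subsetP ME e eM.
have [||pM' cM'] := IH (M :\ e).
- by move: leMn; rewrite (cardsD1 e) eM.
- apply/andP; split; first by apply: subset_trans ME; apply: subsetDl.
  by apply: trivIsetS tM; apply: subsetDl.
rewrite coverD1 // in pM' cM'.
have eC : e \subset cover M by apply: bigcup_sup.
have [xC yC] : x \in cover M /\ y \in cover M by split; apply: (subsetP eC); rewrite eE !inE eqxx ?orbT.
have E : cover M :\: e = cover M :\ x :\ y.
  by rewrite eE; apply/setP => z; rewrite !inE negb_or; case: (z == x); case: (z == y).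
rewrite E in pM' cM'; split; first exact: pm_cons xy pM'.
by rewrite (cardD2 xC yC (adj_neq xy)) cM' (cardsD1 e M) eM doubleS.
Qed.

Lemma maximal_matchingP M :
  maximal_matching M <-> matching M /\ independent (~: cover M).
Proof.
split=> [/maxsetP[mM maxM]|[mM iM]].
  split=> //; apply/independentP => x y; rewrite !inE => xM yM; apply/negP => xy.
  have /andP[ME tM] := mM.
  have N : matching ([set x; y] |: M).
    apply/andP; split.
      by apply/subsetP => e /setU1P[->|/(subsetP ME)//]; apply/edgesP; exists x, y.
    rewrite setUC; apply: trivIsetU => //; first exact: trivIset1.
    by rewrite cover1; set_dec.
  have E := maxM _ N (subsetUr _ _).
  have : x \in cover M by apply/bigcupP; exists [set x; y]; [rewrite -E|]; rewrite !inE eqxx.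
  by rewrite (negbTE xM).
apply/maxsetP; split=> // N mN MN; apply/eqP; rewrite eq_sym eqEsubset MN; apply/subsetP => e eN.
have /andP[NE tN] := mN; have /edgesP[x [y [xy eE]]] := subsetP NE e eN.
have: (x \in cover M) || (y \in cover M).
  by apply: contraTT xy; rewrite negb_or => /andP[xM yM]; apply: (independentP _ iM); rewrite inE.
have common z : z \in e -> z \in cover M -> e \in M.
  move=> ze /bigcupP[f fM zf]; suff -> : e = f by [].
  apply/eqP/negPn/negP => ef.
  have := trivIsetP tN e f eN (subsetP MN f fM) ef.
  by rewrite -setI_eq0 => /eqP/setP/(_ z); rewrite !inE ze zf.
by case/orP; apply: common; rewrite eE !inE eqxx ?orbT.
Qed.

Lemma equimatchable_defect : equimatchable G -> forall S T,
  independent S -> independent T -> pm (~: S) -> pm (~: T) -> #|S| = #|T|.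
Proof.
move=> eq S T iS iT /pm_matching[M mM cM] /pm_matching[N mN cN].
have [_ hM] := matching_pm mM; have [_ hN] := matching_pm mN.
have E : #|M| = #|N|.
  by apply: eq; apply/maximal_matchingP; rewrite ?cM ?cN setCK.
have : #|~: S| = #|~: T| by rewrite -cM -cN hM hN E.
by move=> h; apply/eqP; rewrite -(eqn_add2r #|~: S|) cardsC h cardsC.
Qed.

(** A maximal matching misses at most one vertex, so its size is half of the order, rounded down. *)
Lemma defect_equimatchable :
  (forall T, independent T -> pm (~: T) -> #|T| <= 1) -> equimatchable G.
Proof.
move=> H; suff E M : maximal_matching M -> #|M| = #|G|./2.
  by move=> M N mM mN; rewrite E // E.
move=> /maximal_matchingP[mM iM]; have [pM cM] := matching_pm mM.
have := H _ iM; rewrite setCK => /(_ pM).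
rewrite -(cardsC (cover M)) cM.
by case: #|~: _| => [|[|]] // _; rewrite ?addn0 ?doubleK // addn1 /= uphalf_double.
Qed.

Lemma connected_conn : connected G -> conn [set: G].
Proof.
case=> _ cG x C xC _ clC; apply/eqP; rewrite eqEsubset subsetT; apply/subsetP => y _.
apply: (closed_connect xC clC).
rewrite (@eq_connect _ _ (@sedge G)) ?cG // => u v.
by rewrite /rst /= !inE.
Qed.

Lemma claw_freeP : claw_free G <-> no_claw G.
Proof.
split=> [cf c x y z cx cy cz xy xz yz|nc [S /induced_isoP[g [gI gS gE]]]].
  apply/negPn/negP; rewrite !negb_or => /and3P[nxy nxz nyz].
  apply: cf; exists [set c; x; y; z]; apply/induced_isoP.
  pose g (u : biclique_graph 1 3) : G := match u with inl _ => c | inr i => tnth [tuple x; y; z] i end.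
  have [c_x c_y c_z] := And3 (adj_neq cx) (adj_neq cy) (adj_neq cz).
  exists g; split.
  - move=> [i|[[|[|[|//]]] i]] [j|[[|[|[|//]]] j]]; rewrite /g /= ?(tnth_nth c) /=;
    try by [move=> _; congr inl; rewrite !ord1 | move=> _; congr inr; apply: val_inj];
    by move/eqP; rewrite 1?eq_sym ?(negbTE c_x) ?(negbTE c_y) ?(negbTE c_z) ?(negbTE xy) ?(negbTE xz) ?(negbTE yz) // eq_sym
      ?(negbTE c_x) ?(negbTE c_y) ?(negbTE c_z) ?(negbTE xy) ?(negbTE xz) ?(negbTE yz).
  - move=> u; rewrite !inE -!orbA; apply/idP/codomP.
      case/or4P => /eqP->.
      + by exists (inl ord0).
      + by exists (inr (inord 0)); rewrite /g (tnth_nth c) inordK.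
      + by exists (inr (inord 1)); rewrite /g (tnth_nth c) inordK.
      + by exists (inr (inord 2)); rewrite /g (tnth_nth c) inordK.
    by case=> -[i|[[|[|[|//]]] i]] ->; rewrite /g ?(tnth_nth c) /= eqxx ?orbT.
  - move=> [i|[[|[|[|//]]] i]] [j|[[|[|[|//]]] j]]; rewrite /g /= ?(tnth_nth c) /= /biclique_rel /=;
    by rewrite ?sedge_irrefl ?cx ?cy ?cz ?(negbTE nxy) ?(negbTE nxz) ?(negbTE nyz) // adjC
      ?cx ?cy ?cz ?(negbTE nxy) ?(negbTE nxz) ?(negbTE nyz).
have neq (i j : 'I_3) : i != j -> g (inr i) != g (inr j).
  by apply: contra => /eqP/gI [->].
have := @nc (g (inl ord0)) (g (inr (inord 0))) (g (inr (inord 1))) (g (inr (inord 2))).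
rewrite !gE /= /biclique_rel /= !neq -?val_eqE /= ?inordK //.
by move/(_ isT isT isT isT isT isT).
Qed.

End Matchings.

Lemma equimatchable_families (G : sgraph) : connected G -> claw_free G -> equimatchable G ->
  (isomorphic G (cycle_graph 4) \/
   (exists2 p, 1 <= p & isomorphic G (complete_graph (2 * p))) \/
   (odd #|G| /\ alpha G <= 2) \/
   inG1 G \/ two_connected_family G \/ inG3 G).
Proof.
move=> connG /claw_freeP cf eq; have cG := connected_conn connG.
have [T0 [_ T01]] := near_perfect cf cG; rewrite setTD => pT0.
have iT0 : independent T0.
  by apply/independentP => x y xT yT; rewrite (card_le1_eqP T01 x y xT yT) sedge_irrefl.
(* Equimatchability gives every maximal matching the defect of the near-perfect one, which misses
   [T0]. *)
have defect (T : {set G}) : independent T -> pm (~: T) -> #|T| <= 1.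
  by move=> iT pT; rewrite (equimatchable_defect eq iT iT0 pT pT0).
have [oG|eG] := boolP (odd #|G|); last first.
  have pG : pm [set: G] by apply: conn_pm; rewrite ?cardsT.
  have rG : randomly_matchable [set: G].
    move=> x y _ _ xy nxy; have -> : [set: G] :\ x :\ y = ~: [set x; y].
      by apply/setP => z; rewrite !inE negb_or andbT andbC.
    by move/(defect _ (independent2 nxy)); rewrite cards2 xy.
  have [_ [clG|c4]] := randomly_matchable_good cf cG pG rG; last first.
    by left; apply/isomorphicT/iso_C4P.
  right; left; have [x] : exists x : G, x \in [set: G].
    by apply/card_gt0P; rewrite cardsT; case: connG.
  move=> xG; have [|p p1 /isomorphicT] := iso_even clG _ (ex_intro _ x xG); first by rewrite cardsT.
  by exists p.
have [aG|] := boolP [forall S : {set G}, independent S ==> (#|S| <= 2)].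
  right; right; left; split=> //; apply/bigmax_leqP => S iS.
  by have /forallP/(_ S)/implyP := aG; apply.
rewrite negb_forall => /existsP[S]; rewrite negb_imply -ltnNge => /andP[/independentP iS].
case/card_gt2P => x [y [z [[xS yS zS] [xy yz zx]]]].
have crit : critical G.
  split=> //; exists x, y, z; rewrite xy [x == z]eq_sym zx yz !iS //.
by do 3 right; case: (critical_family crit) => h; [left|right; left|right; right].
Qed.

(** * The families are claw-free and equimatchable *)

Section Converse.
Variable G : sgraph.
Implicit Types (x y z s t u v w a b c d : G) (S T U A B C D H K L : {set G}).

Definition claw_at c := forall x y z, c -- x -> c -- y -> c -- z ->
  x != y -> x != z -> y != z -> [|| x -- y, x -- z | y -- z].

Lemma two_cliques_claw c K L : clique K -> clique L ->
  (forall x, c -- x -> (x \in K) || (x \in L)) -> claw_at c.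
Proof.
move=> cK cL cov x y z cx cy cz xy xz yz.
by case/orP: (cov x cx) => hx; case/orP: (cov y cy) => hy; case/orP: (cov z cz) => hz;
  solve [rewrite (cK x y)//|rewrite (cL x y)//|rewrite (cK x z) ?orbT//|rewrite (cL x z) ?orbT//
    |rewrite (cK y z) ?orbT//|rewrite (cL y z) ?orbT//].
Qed.

Lemma clique1 x : clique [set x].
Proof. by move=> u v /set1P-> /set1P->; rewrite eqxx. Qed.

Lemma clique_add s A : clique A -> {in A, forall x, s -- x} -> clique (s |: A).
Proof.
move=> cA sA x y /setU1P[->|xA] /setU1P[->|yA] xy.
- by rewrite eqxx in xy.
- exact: sA.
- by rewrite adjC sA.
- exact: cA.
Qed.

(** The complement of T has even order, so T is odd and only sizes of at least three have to be
    excluded. *)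
Lemma odd_defect : odd #|G| ->
  (forall T, independent T -> pm (~: T) -> 2 < #|T| -> False) -> equimatchable G.
Proof.
move=> oG H; apply: defect_equimatchable => T iT pT.
have := H T iT pT; have := pm_even pT.
rewrite -setTD odd_set_sub ?subsetT // cardsT oG.
by case: #|T| => [|[|[|n]]] // _ /(_ isT).
Qed.

Lemma no_isolated T d : pm (~: T) -> d \notin T -> (forall u, d -- u -> u \in T) -> False.
Proof.
move=> pT dT H; have [|u] := pm_isolated pT (x := d); first by rewrite inE.
by rewrite inE => uT /H; rewrite (negbTE uT).
Qed.

(** C is a union of components of the complement of T and would be matched within itself. *)
Lemma no_odd_block T C : pm (~: T) -> (forall u, u \in C -> u \in T -> False) ->
  (forall u v, u \in C -> v \notin T -> u -- v -> v \in C) -> odd #|C| -> False.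
Proof.
move=> pT dCT clC oC; have := @pm_even _ C; rewrite oC => H; suff: ~~ true by []; apply: H.
apply: (pm_closed pT); first by apply/subsetP => u uC; rewrite inE; apply/negP/dCT.
by apply/adj_closedP => u v uC; rewrite inE => vT; apply: clC.
Qed.

Lemma independent_edge T u w : independent T -> u \in T -> w \in T -> u -- w -> False.
Proof. by move=> /independentP iT uT wT; apply/negP; apply: iT. Qed.

Lemma independent_clique T K x y : independent T -> clique K ->
  x \in T -> y \in T -> x \in K -> y \in K -> x = y.
Proof.
move=> /independentP iT cK xT yT xK yK; apply/eqP/negPn/negP => xy.
by have := iT x y xT yT; rewrite cK.
Qed.

Lemma C4_neighbour D c1 c2 c3 c4 u : C4_at D c1 c2 c3 c4 -> u \in D -> c1 -- u -> u = c2 \/ u = c4.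
Proof.
case=> -> _ _ [b13 _]; rewrite !inE -!orbA => /or4P[]/eqP->; rewrite ?sedge_irrefl ?(negbTE b13) //.
  by left.
by right.
Qed.

Lemma C4_card D : isC4 D -> #|D| = 4.
Proof.
case=> c1 [c2 [c3 [c4 [-> [n12 n13 n14 [n23 n24 n34]] _ _]]]].
by rewrite -!setUA !cardsU1 cards1 !inE !negb_or n12 n13 n14 n23 n24 n34.
Qed.

Lemma C4_claw D c : isC4 D -> c \in D -> (forall x, c -- x -> x \in D) -> claw_at c.
Proof.
move=> c4 cD ND; have [c2 [c3 [c4' h]]] := C4_from c4 cD.
refine (two_cliques_claw (@clique1 c2) (@clique1 c4') _) => x cx; rewrite !inE.
by case: (C4_neighbour h (ND x cx) cx) => ->; rewrite eqxx ?orbT.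
Qed.

Lemma C4_converse : isC4 [set: G] -> no_claw G /\ equimatchable G.
Proof.
move=> c4; split=> [c|]; first by apply: (C4_claw c4) => *; rewrite inE.
apply: defect_equimatchable => T iT pT; rewrite leqNgt; apply/negP.
case/card_gt1P => x [y [xT yT xy]].
have xG : x \in [set: G] by rewrite inE.
have [c2 [c3 [c5 h]]] := C4_from c4 xG; have [e _ [a12 a23 _ a41] _] := h.
have nT z : x -- z -> z \notin T by move=> xz; apply/negP => zT; move/independentP: iT => /(_ x z xT zT); rewrite xz.
have E : y = c3.
  have : y \in [set: G] by rewrite inE.
  rewrite e !inE -!orbA => /or4P[]/eqP// yE.
  - by rewrite yE eqxx in xy.
  - by move: yT; rewrite yE (negbTE (nT c2 a12)).
  - by move: yT; rewrite yE (negbTE (nT c5 _)) // adjC.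
apply: (no_isolated pT (nT c2 a12)) => u cu.
have [] := C4_neighbour (C4_rot h) (_ : u \in [set: G]) cu; rewrite ?inE // => ->; rewrite -?E //.
Qed.

Lemma clique_converse : clique [set: G] -> no_claw G /\ equimatchable G.
Proof.
move=> cG; split=> [c x y z _ _ _ xy _ _|]; first by rewrite cG ?inE.
apply: defect_equimatchable => T iT _; apply/card_le1_eqP => x y xT yT.
by apply: (independent_clique iT cG); rewrite ?inE.
Qed.

Lemma alpha_converse : odd #|G| -> alpha G <= 2 -> no_claw G /\ equimatchable G.
Proof.
move=> oG /bigmax_leqP al; split.
  move=> c x y z _ _ _ xy xz yz; apply/negPn/negP; rewrite !negb_or => /and3P[nxy nxz nyz].
  have := al _ (independent3 nxy nxz nyz).
  by rewrite -setUA !cardsU1 cards1 !inE negb_or xy xz yz.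
by apply: odd_defect => // T iT _; rewrite ltnNge al.
Qed.

(** For a 4-cycle, two vertices of T in A are opposite. The other two are non-adjacent, so v, which
    sees exactly two adjacent vertices, misses one of them; that one is isolated outside T. *)
Lemma G1_side v A B : separation [set v] A B -> G1_component v A ->
  [/\ ~~ odd #|A|, {in A &, forall x y, x != y -> v -- x -> v -- y -> x -- y},
      {in A, forall c, claw_at c} &
      forall T x y, independent T -> pm (~: T) -> x \in A -> y \in A -> x \in T -> y \in T -> x = y].
Proof.
move=> sAB [shape nbr]; have [vA vB] := sep_notin sAB (set11 v).
have aAB := anti_sep sAB; have cov := sep_cover sAB.
have NA c x : c \in A -> c -- x -> x \in v |: A.
  move=> cA cx; apply/negPn/negP => xvA; have xB : x \in B by mem_dec.
  by rewrite (negbTE (aAB c x cA xB)) in cx.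
case: shape => [[/complete_inducedP cA eA]|c4'].
  split=> //.
  - by move=> x y xA yA xy _ _; apply: cA.
  - move=> c cA'; refine (two_cliques_claw (@clique1 v) cA _) => x /(NA c x cA').
    by rewrite !inE.
  - move=> T x y iT _ xA yA xT yT; exact: (independent_clique iT cA).
have [p [q [pq Npq]]] := nbr c4'; have c4 : isC4 A by apply/iso_C4P.
have vN x : x \in A -> v -- x -> x = p \/ x = q.
  by move=> xA vx; apply/set2P; rewrite -Npq !inE vx.
split=> //; first by rewrite C4_card.
- move=> x y xA yA xy vx vy; move: xy.
  by case: (vN x xA vx) => ->; case: (vN y yA vy) => ->; rewrite ?eqxx // adjC.
- move=> c cA; have [c2 [c3 [c5 h]]] := C4_from c4 cA; have [e _ [a12 _ _ a41] _] := h.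
  have Nc x : c -- x -> [\/ x = v, x = c2 | x = c5].
    move=> cx; case/setU1P: (NA c x cA cx) => [->|xA]; first by apply: Or31.
    by case: (C4_neighbour h xA cx) => ->; [apply: Or32|apply: Or33].
  have [vc|vc] := boolP (v -- c); last first.
    refine (two_cliques_claw (@clique1 c2) (@clique1 c5) _) => x cx; rewrite !inE.
    by case: (Nc x cx) => xE; rewrite xE ?eqxx ?orbT //; rewrite xE adjC (negbTE vc) in cx.
  have [d [dA cd vd]] : exists d, [/\ d \in A, c -- d & v -- d].
    have [pN qN] : p \in neighborhood_in A v /\ q \in neighborhood_in A v.
      by rewrite Npq !inE !eqxx orbT.
    move: pN qN; rewrite !inE => /andP[vp pA] /andP[vq qA].
    by case: (vN c cA vc) => ->; [exists q|exists p]; split; rewrite // adjC.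
  have [e' [e'E cE]] : exists e', d \in [set c2; c5] /\ forall x, c -- x -> [\/ x = v, x = d | x = e'].
    case: (C4_neighbour h dA cd) => ->; [exists c5|exists c2].
      by rewrite !inE eqxx; split=> // x /Nc.
    rewrite !inE eqxx orbT; split=> // x /Nc[]->; [exact: Or31|exact: Or33|exact: Or32].
  refine (two_cliques_claw (clique2 vd) (@clique1 e') _) => x /cE[]->; rewrite !inE ?eqxx ?orbT //.
- move=> T x y iT pT xA yA xT yT; apply/eqP/negPn/negP => xy.
  have [c2 [c3 [c5 h]]] := C4_from c4 xA; have [e [n12 n13 n14 [n23 n24 n34]] [a12 a23 a34 a41] [b13 b24]] := h.
  have nT z : x -- z -> z \notin T by move=> xz; apply/negP => zT; move/independentP: iT => /(_ x z xT zT); rewrite xz.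
  have E : y = c3.
    move: (yA); rewrite e !inE -!orbA => /or4P[]/eqP// yE.
    - by rewrite yE eqxx in xy.
    - by move: yT; rewrite yE (negbTE (nT c2 a12)).
    - by move: yT; rewrite yE (negbTE (nT c5 _)) // adjC.
  have [c2A c5A] : c2 \in A /\ c5 \in A by rewrite e !inE !eqxx !orbT.
  have alone d : d \in A -> x -- d -> (forall u, u \in A -> d -- u -> u \in T) -> ~~ (v -- d) -> False.
    move=> dA xd dT vd; apply: (no_isolated pT (nT d xd)) => u du.
    case/setU1P: (NA d u dA du) => [uE|uA]; last exact: dT.
    by rewrite uE adjC (negbTE vd) in du.
  have c3T : c3 \in T by rewrite -E.
  have [v2|v2] := boolP (v -- c2); last first.
    by apply: (alone c2) => // u uA /(C4_neighbour (C4_rot h) uA)[]->.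
  have [v5|v5] := boolP (v -- c5); last first.
    apply: (alone c5) => // [|u uA]; first by rewrite adjC.
    by move/(C4_neighbour (C4_rot (C4_rot (C4_rot h))) uA) => []->.
  move: b24 n24; case: (vN c2 c2A v2) => ->; case: (vN c5 c5A v5) => ->; rewrite ?eqxx ?pq // adjC ?pq //.
Qed.

Lemma G1_converse : inG1 G -> no_claw G /\ equimatchable G.
Proof.
case=> v [A [B [/separationP sAB gA gB _]]]; have sBA := sep_sym sAB.
have [eA clA clawA TA] := G1_side sAB gA; have [eB clB clawB TB] := G1_side sBA gB.
have cov := sep_cover sAB; have dAB := sep_disj sAB; have aAB := anti_sep sAB.
have [vA vB] := sep_notin sAB (set11 v).
have whr x : [|| x == v, x \in A | x \in B] by at_dec x.
split.
  move=> c; case/or3P: (whr c) => [/eqP->|/clawA//|/clawB//].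
  apply: (@two_cliques_claw v [set x in A | v -- x] [set x in B | v -- x]).
  - by move=> x y; rewrite !inE => /andP[xA vx] /andP[yA vy] xy; apply: clA.
  - by move=> x y; rewrite !inE => /andP[xA vx] /andP[yA vy] xy; apply: clB.
  - move=> x vx; rewrite !inE vx !andbT; case/or3P: (whr x) => [/eqP E|->//|->]; last by rewrite orbT.
    by rewrite E sedge_irrefl in vx.
apply: odd_defect => [|T iT pT].
  have : odd #|~: [set v]| = false by rewrite cov odd_disjU // (negbTE eA) (negbTE eB).
  by rewrite -setTD odd_set_sub ?subsetT // cardsT cards1 addbT => /negbFE.
case/card_gt2P => x [y [z [[xT yT zT] [xy yz zx]]]].
(* T contains v and only u from A, so [A :\ u] is an odd union of components of the complement. *)
have fin u : v \in T -> u \in T -> u \in A -> False.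
  move=> vT uT uA; apply: (@no_odd_block T (A :\ u) pT); last by rewrite odd_D1.
    by move=> w /setD1P[wu wA] wT; move: wu; rewrite (TA T w u iT pT wA uA wT uT) eqxx.
  move=> w r /setD1P[wu wA] rT wr; apply/setD1P; split; first by apply: contraNneq rT => ->.
  case/or3P: (whr r) => [/eqP E|//|rB]; first by rewrite E vT in rT.
  by rewrite (negbTE (aAB w r wA rB)) in wr.
have finA u w : u \in T -> w \in T -> u \in A -> w \in A -> u != w -> False.
  by move=> uT wT uA wA; rewrite (TA T u w) ?eqxx.
have finB u w : u \in T -> w \in T -> u \in B -> w \in B -> u != w -> False.
  by move=> uT wT uB wB; rewrite (TB T u w) ?eqxx.
by case/or3P: (whr x) => [/eqP xE|xE|xE]; case/or3P: (whr y) => [/eqP yE|yE|yE];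
   case/or3P: (whr z) => [/eqP zE|zE|zE]; subst;
   first [by rewrite eqxx in xy|by rewrite eqxx in yz|by rewrite eqxx in zx
    |by apply: (finA x y)|by apply: (finA y z)|by apply: (finA z x)
    |by apply: (finB x y)|by apply: (finB y z)|by apply: (finB z x)
    |by apply: (fin x)|by apply: (fin y)|by apply: (fin z)].
Qed.

(** T meets the clique [V1] at most once. It meets the 4-cycle at most once too, since [v1], [v3]
    would isolate [v4], and [v2], [v4] would isolate [v3]. *)
Lemma G21_converse : inG21 G -> no_claw G /\ equimatchable G.
Proof.
case=> V1 [V2 [V12 dV [q q1 /iso_completeP[c1 o1]] [v1 [v2 [v3 [v4 [[uv V2E] [[a12 a23 a34 a41] [b13 b24]] N12 _ [N3 N4]]]]]]]].
have oV1 : odd #|V1| by rewrite o1 addn1 /= mul2n odd_double.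
have whr x : [|| x \in V1, x == v1, x == v2 | (x == v3) || (x == v4)].
  by have := in_setT x; rewrite -V12 V2E !inE -!orbA.
have M x : x \in V1 -> (v1 -- x) = (v2 -- x).
  by move=> xV; have /setP/(_ x) := N12; rewrite !inE xV !andbT.
have M3 x : x \in V1 -> ~~ (v3 -- x).
  by move=> xV; have /setP/(_ x) := N3; rewrite !inE xV andbT => ->.
have M4 x : x \in V1 -> ~~ (v4 -- x).
  by move=> xV; have /setP/(_ x) := N4; rewrite !inE xV andbT => ->.
have nv3 x : v3 -- x -> x = v2 \/ x = v4.
  move=> vx; case/or4P: (whr x) vx => [/M3/negbTE->//|/eqP->|/eqP->|/orP[]/eqP->]; rewrite ?sedge_irrefl //.
  - by rewrite adjC (negbTE b13).
  - by left.
  - by right.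
have nv4 x : v4 -- x -> x = v1 \/ x = v3.
  move=> vx; case/or4P: (whr x) vx => [/M4/negbTE->//|/eqP->|/eqP->|/orP[]/eqP->]; rewrite ?sedge_irrefl //.
  - by left.
  - by rewrite adjC (negbTE b24).
  - by right.
have cN : clique [set x in V1 | v1 -- x] by apply: cliqueS c1; apply/subsetP => x; rewrite inE => /andP[].
split.
  move=> c; case/or4P: (whr c) => [cV|/eqP->|/eqP->|/orP[]/eqP->].
  - refine (two_cliques_claw c1 (clique2 a12) _) => x cx; rewrite !inE.
    case/or4P: (whr x) => [->//|->|->|/orP[]/eqP E]; rewrite ?orbT //.
      by rewrite E adjC (negbTE (M3 c cV)) in cx.
    by rewrite E adjC (negbTE (M4 c cV)) in cx.
  - have cK : clique (v2 |: [set x in V1 | v1 -- x]).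
      by apply: clique_add => // x; rewrite inE => /andP[xV]; rewrite M.
    refine (two_cliques_claw cK (@clique1 v4) _) => x vx; rewrite !inE vx andbT.
    case/or4P: (whr x) => [->|/eqP E|->|/orP[/eqP E|->]]; rewrite ?orbT //.
      by rewrite E sedge_irrefl in vx.
    by rewrite E (negbTE b13) in vx.
  - have cK : clique (v1 |: [set x in V1 | v1 -- x]).
      by apply: clique_add => // x; rewrite inE => /andP[].
    refine (two_cliques_claw cK (@clique1 v3) _) => x vx; rewrite !inE.
    case/or4P: (whr x) => [xV|->|/eqP E|/orP[->|/eqP E]]; rewrite ?orbT //.
      by rewrite xV M // vx orbT.
      by rewrite E sedge_irrefl in vx.
    by rewrite E (negbTE b24) in vx.
  - refine (two_cliques_claw (@clique1 v2) (@clique1 v4) _) => x /nv3[]->; by rewrite !inE eqxx ?orbT.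
  - refine (two_cliques_claw (@clique1 v1) (@clique1 v3) _) => x /nv4[]->; by rewrite !inE eqxx ?orbT.
apply: odd_defect => [|T iT pT].
  rewrite -cardsT -V12 odd_disjU // oV1 V2E -!setUA !cardsU1 cards1.
  by move: uv; rewrite /= !inE !negb_or -!andbA => /and5P[-> -> -> -> /and3P[-> -> _]].
case/card_gt2P => x [y [z [[xT yT zT] [xy yz zx]]]].
have nadj u w := @independent_edge T u w iT.
have k13 : v1 \in T -> v3 \in T -> False.
  move=> v1T v3T; apply: (@no_isolated T v4 pT); first by apply/negP => v4T; apply: (nadj v3 v4).
  by move=> u /nv4[]->.
have k24 : v2 \in T -> v4 \in T -> False.
  move=> v2T v4T; apply: (@no_isolated T v3 pT); first by apply/negP => v3T; apply: (nadj v3 v4).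
  by move=> u /nv3[]->.
have inV2 u w : u \in T -> w \in T -> u \notin V1 -> w \notin V1 -> u = w.
  move=> uT wT uV wV; apply/eqP/negPn/negP => uw.
  by case/or4P: (whr u) => [uE|/eqP uE|/eqP uE|/orP[]/eqP uE];
   case/or4P: (whr w) => [wE|/eqP wE|/eqP wE|/orP[]/eqP wE];
   first [by rewrite uE in uV|by rewrite wE in wV|by rewrite uE wE eqxx in uw
    |rewrite uE in uT; rewrite wE in wT;
     first [exact: k13|exact: k24|exact: (nadj v1 v2)|exact: (nadj v2 v3)|exact: (nadj v3 v4)|exact: (nadj v4 v1)]].
have inV1 u w : u \in T -> w \in T -> u \in V1 -> w \in V1 -> u = w by apply: independent_clique.
by case: (boolP (x \in V1)) => xV; case: (boolP (y \in V1)) => yV; case: (boolP (z \in V1)) => zV;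
  first [by rewrite (inV1 x y) ?eqxx in xy|by rewrite (inV1 y z) ?eqxx in yz|by rewrite (inV1 z x) ?eqxx in zx
  |by rewrite (inV2 x y) ?eqxx in xy|by rewrite (inV2 y z) ?eqxx in yz|by rewrite (inV2 z x) ?eqxx in zx].
Qed.
End Converse.

Section Converse2.
Variable G : sgraph.
Implicit Types (x y z s t u v w a b c d : G) (S T U A B C D H K L : {set G}).

Lemma three_in s t A B T : clique A -> clique B ->
  (forall x, [|| x == s, x == t, x \in A | x \in B]) -> independent T -> 2 < #|T| ->
  (s \in T /\ t \in T /\ exists2 x, x \in T & (x \in A) || (x \in B)) \/
  (exists a b, [/\ a \in A, b \in B, a \in T, b \in T & (s \in T) || (t \in T)]).
Proof.
move=> cA cB whr iT /card_gt2P[x [y [z [[xT yT zT] [xy yz zx]]]]].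
have inA u w : u \in T -> w \in T -> u \in A -> w \in A -> u = w by apply: independent_clique.
have inB u w : u \in T -> w \in T -> u \in B -> w \in B -> u = w by apply: independent_clique.
have L u : s \in T -> t \in T -> u \in T -> (u \in A) || (u \in B) ->
  (s \in T /\ t \in T /\ exists2 x, x \in T & (x \in A) || (x \in B)) by move=> *; split=> //; split=> //; exists u.
have R u w : u \in A -> w \in B -> u \in T -> w \in T -> (s \in T) || (t \in T) ->
  exists a b, [/\ a \in A, b \in B, a \in T, b \in T & (s \in T) || (t \in T)] by move=> *; exists u, w.
case/or4P: (whr x) => [/eqP xE|/eqP xE|xE|xE];
case/or4P: (whr y) => [/eqP yE|/eqP yE|yE|yE];
case/or4P: (whr z) => [/eqP zE|/eqP zE|zE|zE];
  try (rewrite xE in xT xy zx); try (rewrite yE in yT xy yz); try (rewrite zE in zT yz zx);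
  rewrite ?eqxx // in xy yz zx;
  first [by rewrite (inA x y) ?eqxx in xy|by rewrite (inA y z) ?eqxx in yz|by rewrite (inA z x) ?eqxx in zx
  |by rewrite (inB x y) ?eqxx in xy|by rewrite (inB y z) ?eqxx in yz|by rewrite (inB z x) ?eqxx in zx
  |by left; apply: (L x); rewrite ?xE ?orbT|by left; apply: (L y); rewrite ?yE ?orbT
  |by left; apply: (L z); rewrite ?zE ?orbT
  |right; first [by apply: (R x y); rewrite ?xT ?yT ?zT ?orbT|by apply: (R y x); rewrite ?xT ?yT ?zT ?orbT|by apply: (R x z); rewrite ?xT ?yT ?zT ?orbT|by apply: (R z x); rewrite ?xT ?yT ?zT ?orbT|by apply: (R y z); rewrite ?xT ?yT ?zT ?orbT|by apply: (R z y); rewrite ?xT ?yT ?zT ?orbT]].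
Qed.

(** If T contains both cut vertices, B is an odd block of the complement; otherwise T contains a cut
    vertex and a vertex of B, which are adjacent. *)
Lemma G22_converse : inG22 G -> no_claw G /\ equimatchable G.
Proof.
case=> s [t [A [B [[st nst] [/separationP sAB eA oB] [p p1 /iso_completeP[cA _]] [q /iso_completeP[cB _]]
  [sB tB _ disj]]]]].
have cov := sep_cover sAB; have dAB := sep_disj sAB; have aAB := anti_sep sAB.
have [[sA sB'] [tA tB']] := (sep_notin sAB (set21 s t), sep_notin sAB (set22 s t)).
have whr x : [|| x == s, x == t, x \in A | x \in B] by at_dec x.
have stA x : x \in A -> s -- x -> t -- x -> False.
  by move=> xA sx tx; have /setP/(_ x) := disj; rewrite !inE sx tx xA.
split.
  move=> c; case/or4P: (whr c) => [/eqP->|/eqP->|cA'|cB'].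
  - apply: (@two_cliques_claw _ s [set x in A | s -- x] B) => //.
      move=> x y; rewrite !inE => /andP[xA sx] /andP[yA sy] xy; exact: cA.
    move=> x sx; rewrite inE sx andbT; case/or4P: (whr x) => [/eqP E|/eqP E|->//|->]; rewrite ?orbT //.
      by rewrite E sedge_irrefl in sx.
    by rewrite E (negbTE nst) in sx.
  - apply: (@two_cliques_claw _ t [set x in A | t -- x] B) => //.
      move=> x y; rewrite !inE => /andP[xA sx] /andP[yA sy] xy; exact: cA.
    move=> x sx; rewrite inE sx andbT; case/or4P: (whr x) => [/eqP E|/eqP E|->//|->]; rewrite ?orbT //.
      by rewrite E adjC (negbTE nst) in sx.
    by rewrite E sedge_irrefl in sx.
  - have [r rP] : exists r, forall x, c -- x -> (x \in A) || (x \in [set r]).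
      have NA x : c -- x -> [|| x == s, x == t | x \in A].
        move=> cx; case/or4P: (whr x) => [->|->|->|xB]; rewrite ?orbT //.
        by rewrite (negbTE (aAB c x cA' xB)) in cx.
      have [sc|sc] := boolP (s -- c).
        exists s => x cx; rewrite inE; case/or3P: (NA x cx) => [->|/eqP xE|->]; rewrite ?orbT //.
        by case: (stA c cA' sc); rewrite -xE adjC.
      exists t => x cx; rewrite inE; case/or3P: (NA x cx) => [/eqP xE|->|->]; rewrite ?orbT //.
      by rewrite xE adjC (negbTE sc) in cx.
    exact: two_cliques_claw cA (@clique1 _ r) rP.
  - apply: (@two_cliques_claw _ c (s |: B) [set t]); [exact: clique_add|exact: clique1|].
    move=> x cx; rewrite !inE; case/or4P: (whr x) => [->|->|xA|->]; rewrite ?orbT //.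
    by rewrite adjC (negbTE (aAB x c xA cB')) in cx.
apply: odd_defect => [|T iT pT T2].
  have : odd #|~: [set s; t]| by rewrite cov odd_disjU // (negbTE eA) oB.
  by rewrite -setTD odd_set_sub ?subsetT // cardsT cards2 st addbF.
have nadj u w := @independent_edge _ T u w iT.
case: (three_in cA cB whr iT T2) => [[sT [tT _]]|[a [b [aA bB aT bT /orP[sT|tT]]]]].
- apply: (no_odd_block pT _ _ oB).
    by move=> x xB xT; apply: (nadj s x) => //; apply: sB.
  move=> u v uB vT uv; case/or4P: (whr v) => [/eqP E|/eqP E|vA|//].
  + by rewrite E sT in vT.
  + by rewrite E tT in vT.
  + by rewrite adjC (negbTE (aAB v u vA uB)) in uv.
- by apply: (nadj s b) => //; apply: sB.
- by apply: (nadj t b) => //; apply: tB.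
Qed.

(** In any other non-adjacent position of s and t on the path, the remaining two vertices are
    non-adjacent, but A is an edge. *)
Lemma P4_ends s t A : s != t -> ~~ (s -- t) -> s \notin A -> t \notin A -> clique A -> #|A| = 2 ->
  (exists c1 c2 c3 c4, P4_at ([set s; t] :|: A) c1 c2 c3 c4) ->
  exists a b, [/\ A = [set a; b], a -- b, s -- a /\ ~~ (s -- b) & t -- b /\ ~~ (t -- a)].
Proof.
move=> st nst sA tA cA A2 [c1 [c2 [c3 [c4 [e [n12 n13 n14 [n23 n24 n34]] [a12 a23 a34] [b13 b24 b14]]]]]].
have inA x : x \in [set c1; c2; c3; c4] -> x != s -> x != t -> x \in A.
  by rewrite -e !inE -orbA => /or3P[->|->|].
have pair x y : x \in A -> y \in A -> x != y -> A = [set x; y].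
  move=> xA yA xy; apply/eqP; rewrite eq_sym eqEcard cards2 xy A2 andbT.
  by apply/subsetP => u /set2P[]->.
have [sU tU] : s \in [set c1; c2; c3; c4] /\ t \in [set c1; c2; c3; c4].
  by rewrite -e !inE !eqxx !orbT.
have [i1 i2 i3 i4] : [/\ c1 \in [set c1; c2; c3; c4], c2 \in [set c1; c2; c3; c4], c3 \in [set c1; c2; c3; c4] & c4 \in [set c1; c2; c3; c4]].
  by rewrite !inE !eqxx !orbT.
have absurd x y : x \in [set c1; c2; c3; c4] -> y \in [set c1; c2; c3; c4] ->
    x != s -> x != t -> y != s -> y != t -> x != y -> ~~ (x -- y) -> False.
  by move=> xU yU xs xt ys yt xy /negP[]; apply: cA => //; apply: inA.
have [m21 m31 m41] : [/\ c2 != c1, c3 != c1 & c4 != c1] by rewrite ![_ == c1]eq_sym.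
have [m32 m42 m43] : [/\ c3 != c2, c4 != c2 & c4 != c3] by rewrite ![_ == c2]eq_sym [c4 == _]eq_sym.
have [p21 p32 p43] : [/\ c2 -- c1, c3 -- c2 & c4 -- c3] by split; rewrite adjC.
have [k31 k42 k41] : [/\ ~~ (c3 -- c1), ~~ (c4 -- c2) & ~~ (c4 -- c1)] by split; rewrite adjC.
move: sU; rewrite !inE -!orbA => /or4P[]/eqP sE; move: tU; rewrite !inE -!orbA => /or4P[]/eqP tE;
  rewrite sE tE in st nst absurd inA *;
  first [by rewrite eqxx in st|by rewrite a12 in nst|by rewrite a23 in nst|by rewrite a34 in nst
   |by rewrite p21 in nst|by rewrite p32 in nst|by rewrite p43 in nst
   |by exfalso; apply: (absurd c1 c3)|by exfalso; apply: (absurd c2 c4)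
   |by exists c2, c3; split=> //; apply: pair => //; apply: inA
   |by exists c3, c2; split=> //; apply: pair => //; apply: inA].
Qed.

(** s and t together dominate A and B. With s alone in T, the vertex of T in A is b, which isolates
    a; the case of t is symmetric. *)
Lemma G23_converse : inG23 G -> no_claw G /\ equimatchable G.
Proof.
case=> s [t [A [B [[st nst] [/separationP sAB eA oB] [/iso_completeP[cA A2] /iso_P4P p4]
  [q q1 /iso_completeP[cB _]] stB]]]].
have cov := sep_cover sAB; have dAB := sep_disj sAB; have aAB := anti_sep sAB.
have [[sA sB'] [tA tB']] := (sep_notin sAB (set21 s t), sep_notin sAB (set22 s t)).
have whr x : [|| x == s, x == t, x \in A | x \in B] by at_dec x.
have inB x : x \in B -> (s -- x) || (t -- x).
  by move=> xB; have /setP/(_ x) := stB; rewrite !inE xB !andbT.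
have [a [b [Ae ab [sa sb] [tb ta]]]] := P4_ends st nst sA tA cA A2 p4.
have [aA bA] : a \in A /\ b \in A by rewrite Ae !inE !eqxx orbT.
have Aab x : x \in A -> x = a \/ x = b by rewrite Ae => /set2P.
have Na x : a -- x -> x = s \/ x = b.
  move=> ax; case/or4P: (whr x) => [/eqP->|/eqP E|/Aab[E|->]|xB]; [by left| | |by right|].
  - by rewrite E adjC (negbTE ta) in ax.
  - by rewrite E sedge_irrefl in ax.
  - by rewrite (negbTE (aAB a x aA xB)) in ax.
have Nb x : b -- x -> x = t \/ x = a.
  move=> ax; case/or4P: (whr x) => [/eqP E|/eqP->|/Aab[->|E]|xB]; [|by left|by right| |].
  - by rewrite E adjC (negbTE sb) in ax.
  - by rewrite E sedge_irrefl in ax.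
  - by rewrite (negbTE (aAB b x bA xB)) in ax.
have cN u : clique [set x in B | u -- x] by apply: cliqueS cB; apply/subsetP => x; rewrite inE => /andP[].
have cN' u : clique (u |: [set x in B | u -- x]).
  by apply: clique_add => // x; rewrite inE => /andP[].
split.
  move=> c; case/or4P: (whr c) => [/eqP->|/eqP->|/Aab[]->|cB'].
  - apply: (@two_cliques_claw _ s [set a] [set x in B | s -- x]); [exact: clique1|exact: cN|].
    move=> x sx; rewrite !inE sx andbT; case/or4P: (whr x) => [/eqP E|/eqP E|/Aab[E|E]|->]; rewrite ?orbT //.
    + by rewrite E sedge_irrefl in sx.
    + by rewrite E (negbTE nst) in sx.
    + by rewrite E eqxx.
    + by rewrite E (negbTE sb) in sx.
  - apply: (@two_cliques_claw _ t [set b] [set x in B | t -- x]); [exact: clique1|exact: cN|].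
    move=> x sx; rewrite !inE sx andbT; case/or4P: (whr x) => [/eqP E|/eqP E|/Aab[E|E]|->]; rewrite ?orbT //.
    + by rewrite E adjC (negbTE nst) in sx.
    + by rewrite E sedge_irrefl in sx.
    + by rewrite E (negbTE ta) in sx.
    + by rewrite E eqxx.
  - apply: (@two_cliques_claw _ a [set s] [set b]); [exact: clique1|exact: clique1|].
    by move=> x /Na[]->; rewrite !inE eqxx ?orbT.
  - apply: (@two_cliques_claw _ b [set t] [set a]); [exact: clique1|exact: clique1|].
    by move=> x /Nb[]->; rewrite !inE eqxx ?orbT.
  - apply: (@two_cliques_claw _ c (s |: [set x in B | s -- x]) (t |: [set x in B | t -- x])) => //.
    move=> x cx; rewrite !inE; case/or4P: (whr x) => [->|->|xA|xB]; rewrite ?orbT //.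
      by rewrite adjC (negbTE (aAB x c xA cB')) in cx.
    by rewrite xB /=; case/orP: (inB x xB) => ->; rewrite ?orbT.
apply: odd_defect => [|T iT pT T2].
  have : odd #|~: [set s; t]| by rewrite cov odd_disjU // (negbTE eA) oB.
  by rewrite -setTD odd_set_sub ?subsetT // cardsT cards2 st addbF.
have nadj u w := @independent_edge _ T u w iT.
case: (three_in cA cB whr iT T2) => [[sT [tT [x xT]]]|[c [d [cA' dB cT dT /orP[sT|tT]]]]].
- case/orP => [/Aab[]E|/inB/orP[sx|tx]]; rewrite ?E in xT.
  + exact: (nadj s a).
  + exact: (nadj t b).
  + exact: (nadj s x).
  + exact: (nadj t x).
- have bT : b \in T by case: (Aab c cA') cT => -> // aT; case: (nadj s a).
  apply: (@no_isolated _ T a pT) => [|u /Na[]->//].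
  by apply/negP => aT; apply: (nadj a b).
- have aT : a \in T by case: (Aab c cA') cT => -> // bT; case: (nadj t b).
  apply: (@no_isolated _ T b pT) => [|u /Nb[]->//].
  by apply/negP => bT; apply: (nadj a b).
Qed.

(** Adjacency of $C_7$ on natural numbers, so that statements over all triples can be evaluated. *)
Definition cyc7 (i j : nat) := (i != j) && ((i.+1 == j %[mod 7]) || (j.+1 == i %[mod 7])).

Lemma cyc7_claw : all (fun c : nat => all (fun x : nat => all (fun y : nat => all (fun z : nat =>
    [&& cyc7 c x, cyc7 c y, cyc7 c z, x != y, x != z & y != z] ==>
    [|| cyc7 x y, cyc7 x z | cyc7 y z])
  (iota 0 7)) (iota 0 7)) (iota 0 7)) (iota 0 7).
Proof. by vm_compute. Qed.

(** The gaps of an independent triple in $C_7$ are 2, 2, 3, and the vertex d inside a gap of 2 gets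
    isolated. The first conjunct keeps d out of any independent set that contains the triple. *)
Lemma cyc7_isolated : all (fun x : nat => all (fun y : nat => all (fun z : nat =>
    [&& x != y, y != z, z != x, ~~ cyc7 x y, ~~ cyc7 y z & ~~ cyc7 z x] ==>
    has (fun d : nat => (cyc7 d x || cyc7 d y || cyc7 d z) &&
      all (fun u : nat => cyc7 d u ==> [|| u == x, u == y | u == z]) (iota 0 7)) (iota 0 7))
  (iota 0 7)) (iota 0 7)) (iota 0 7).
Proof. by vm_compute. Qed.

Lemma C7_converse : isomorphic G (cycle_graph 7) -> no_claw G /\ equimatchable G.
Proof.
case=> f fb fE; have [g fK gK] := fb.
have adj x y : (x -- y) = cyc7 (f x) (f y) by rewrite -fE.
have neq x y : (x != y) = (f x != f y :> nat) by rewrite val_eqE (inj_eq (can_inj fK)).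
have fi x : (f x : nat) \in iota 0 7 by rewrite mem_iota /=; apply: ltn_ord.
split.
  move=> c x y z; rewrite !adj !neq => cx cy cz xy xz yz.
  have := allP (allP (allP (allP cyc7_claw _ (fi c)) _ (fi x)) _ (fi y)) _ (fi z).
  by move/implyP; apply; rewrite cx cy cz xy xz yz.
apply: odd_defect => [|T iT pT]; first by rewrite (bij_eq_card fb) card_ord.
case/card_gt2P => x [y [z [[xT yT zT] [xy yz zx]]]].
have nadj u w : u \in T -> w \in T -> ~~ cyc7 (f u) (f w).
  by move=> uT wT; rewrite -adj; apply: (independentP _ iT).
have /implyP := allP (allP (allP cyc7_isolated _ (fi x)) _ (fi y)) _ (fi z).
case/(_ _)/hasP => [|d' d7 /andP[d1 /allP d2]]; first by rewrite -!neq xy yz zx !nadj.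
rewrite mem_iota /= in d7.
pose d := g (Ordinal d7 : cycle_graph 7).
have dE : f d = d' :> nat by rewrite gK.
rewrite -dE in d1 d2.
apply: (@no_isolated _ T d pT).
  by apply/negP => dT; move: d1; rewrite !(negbTE (nadj _ _ _ _)).
move=> u; rewrite adj => du; have := d2 _ (fi u); rewrite du /=.
by rewrite -[_ == _]negbK -[_ == f y :> nat]negbK -[_ == f z :> nat]negbK -!neq !negbK => /or3P[]/eqP->.
Qed.

Lemma G3_converse : inG3 G -> no_claw G /\ equimatchable G.
Proof.
case=> s1 [s2 [s3 [A [B [[us iS] /separationP sAB [/complete_inducedP cA oA _] [/complete_inducedP cB oB _]
  [a [b [aA bB N1 N2 N3]]]]]]]].
have cov := sep_cover sAB; have dAB := sep_disj sAB; have aAB := anti_sep sAB.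
have [i1 i2 i3] : [/\ s1 \in [set s1; s2; s3], s2 \in [set s1; s2; s3] & s3 \in [set s1; s2; s3]].
  by rewrite !inE !eqxx !orbT.
have [[s1A s1B] [s2A s2B] [s3A s3B]] := And3 (sep_notin sAB i1) (sep_notin sAB i2) (sep_notin sAB i3).
have whr x : [|| x \in A, x \in B, x == s1 | (x == s2) || (x == s3)] by at_dec x.
have e1 x : (s1 -- x) = (x \in A) || (x == b) by have /setP/(_ x) := N1; rewrite !inE.
have e2 x : (s2 -- x) = (x \in B) || (x == a) by have /setP/(_ x) := N2; rewrite !inE.
have e3 x : (s3 -- x) = [&& x != a, x != b & (x \in A) || (x \in B)].
  by have /setP/(_ x) := N3; rewrite !inE negb_or -andbA.
have cA1 : clique (s1 |: A) by apply: clique_add => // x xA; rewrite e1 xA.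
have cB2 : clique (s2 |: B) by apply: clique_add => // x xB; rewrite e2 xB.
have nAB x : x \in A -> x \in B -> False by move=> xA xB; rewrite (disjointFr dAB xA) in xB.
have nab : a != b by apply: contraTneq aA => ->; apply/negP => /nAB; apply.
have NA x y : x \in A -> x -- y -> [|| y \in A, y == s1 | (y == s2) && (x == a) || (y == s3) && (x != a)].
  move=> xA xy; case/or4P: (whr y) => [->//|yB|->|/orP[]/eqP yE]; rewrite ?orbT //.
  - by rewrite (negbTE (aAB x y xA yB)) in xy.
  - move: xy; rewrite yE adjC e2 eqxx => /orP[/(nAB _ xA)//|->]; by rewrite /= !orbT.
  - by move: xy; rewrite yE adjC e3 eqxx => /and3P[-> _ _]; rewrite !orbT.
have NB x y : x \in B -> x -- y -> [|| y \in B, y == s2 | (y == s1) && (x == b) || (y == s3) && (x != b)].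
  move=> xB xy; case/or4P: (whr y) => [yA|->//|/eqP yE|/orP[->|/eqP yE]]; rewrite ?orbT //.
  - by rewrite adjC (negbTE (aAB y x yA xB)) in xy.
  - move: xy; rewrite yE adjC e1 eqxx => /orP[xA|->]; [by case: (nAB x)|by rewrite /= !orbT].
  - by move: xy; rewrite yE adjC e3 eqxx => /and3P[_ -> _]; rewrite !orbT.
split.
  move=> c; case/or4P: (whr c) => [cA'|cB'|/eqP->|/orP[]/eqP->].
  - have [ca|ca] := boolP (c == a).
      apply: (two_cliques_claw cA1 (@clique1 _ s2)) => x /(NA c x cA').
      by rewrite !inE ca andbF orbF andbT => /or3P[]->; rewrite ?orbT.
    apply: (two_cliques_claw cA1 (@clique1 _ s3)) => x /(NA c x cA').
    by rewrite !inE (negbTE ca) andbF /= andbT => /or3P[]->; rewrite ?orbT.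
  - have [ca|ca] := boolP (c == b).
      apply: (two_cliques_claw cB2 (@clique1 _ s1)) => x /(NB c x cB').
      by rewrite !inE ca andbF orbF andbT => /or3P[]->; rewrite ?orbT.
    apply: (two_cliques_claw cB2 (@clique1 _ s3)) => x /(NB c x cB').
    by rewrite !inE (negbTE ca) andbF /= andbT => /or3P[]->; rewrite ?orbT.
  - by apply: (two_cliques_claw cA (@clique1 _ b)) => x; rewrite e1 inE.
  - by apply: (two_cliques_claw cB (@clique1 _ a)) => x; rewrite e2 inE.
  - by apply: (two_cliques_claw cA cB) => x; rewrite e3 => /and3P[].
have [n12 n13 n23] : [/\ s1 != s2, s1 != s3 & s2 != s3].
  by move: us; rewrite /= !inE negb_or -andbA => /and4P[-> -> ->].
apply: odd_defect => [|T iT pT].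
  have : odd #|~: [set s1; s2; s3]| = false by rewrite cov odd_disjU // oA oB.
  rewrite -setTD odd_set_sub ?subsetT // cardsT -setUA !cardsU1 cards1 !inE !negb_or n12 n13 n23 /=.
  by rewrite addbT => /negbFE.
case/card_gt2P => x [y [z [[xT yT zT] [xy yz zx]]]].
have nadj u w := @independent_edge _ T u w iT.
have inA u w : u \in T -> w \in T -> u \in A -> w \in A -> u = w by apply: independent_clique.
have inB u w : u \in T -> w \in T -> u \in B -> w \in B -> u = w by apply: independent_clique.
have x1A u : s1 \in T -> u \in T -> u \in A -> False.
  by move=> sT uT uA; apply: (nadj s1 u); rewrite // e1 uA.
have x2B u : s2 \in T -> u \in T -> u \in B -> False.
  by move=> sT uT uB; apply: (nadj s2 u); rewrite // e2 uB.
have x3A u : s3 \in T -> u \in T -> u \in A -> u = a.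
  move=> sT uT uA; apply/eqP/negPn/negP => ua; apply: (nadj s3 u); rewrite // e3 ua uA /= andbT.
  by apply: contraTneq uA => ->; apply/negP => /nAB; apply.
have x3B u : s3 \in T -> u \in T -> u \in B -> u = b.
  move=> sT uT uB; apply/eqP/negPn/negP => ub; apply: (nadj s3 u); rewrite // e3 ub uB orbT /= andbT.
  by apply: contraTneq uB => ->; apply/negP => /(nAB _ aA).
have x13B u : s1 \in T -> s3 \in T -> u \in T -> u \in B -> False.
  by move=> s1T s3T uT uB; apply: (nadj s1 u); rewrite // e1 (x3B u) ?eqxx ?orbT.
have x23A u : s2 \in T -> s3 \in T -> u \in T -> u \in A -> False.
  by move=> s2T s3T uT uA; apply: (nadj s2 u); rewrite // e2 (x3A u) ?eqxx ?orbT.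
have x123 : s1 \in T -> s2 \in T -> s3 \in T -> False.
  move=> s1T s2T s3T; apply: (no_odd_block pT _ _ oA).
    by move=> u uA uT; exact: (x1A u).
  move=> u v uA vT /(NA u v uA)/or3P[//|/eqP E|/orP[]/andP[/eqP E _]]; by rewrite E ?s1T ?s2T ?s3T in vT.
(* T contains [s3], a and b, so [s1] together with [A :\ a] is an odd block of the complement. *)
have x3AB u w : s3 \in T -> u \in T -> w \in T -> u \in A -> w \in B -> False.
  move=> s3T uT wT uA wB; have ua := x3A u s3T uT uA; have wb := x3B w s3T wT wB; subst u w.
  have s1T : s1 \notin T by apply/negP => s1T; apply: (x1A a).
  have s2T : s2 \notin T by apply/negP => s2T; apply: (x2B b).
  apply: (@no_odd_block _ T (s1 |: (A :\ a)) pT).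
  - move=> u /setU1P[->|/setD1P[ua uA']] uT'; first by rewrite (negbTE s1T) in uT'.
    by rewrite (inA u a) ?eqxx in ua.
  - move=> u v /setU1P[->|/setD1P[ua uA']] vT uv; rewrite !inE.
      move: uv; rewrite e1 => /orP[vA|/eqP E]; last by rewrite E wT in vT.
      by rewrite vA andbT; apply/orP; right; apply: contraNneq vT => ->.
    have := NA u v uA' uv; rewrite (negbTE ua) andbF /= andbT.
    case/or3P => [vA|->//|/eqP E]; last by rewrite E s3T in vT.
    by rewrite vA andbT; apply/orP; right; apply: contraNneq vT => ->.
  - by rewrite cardsU1 !inE (negbTE s1A) andbF /= odd_D1 // oA.
by case/or4P: (whr x) => [xE|xE|/eqP xE|/orP[]/eqP xE];
case/or4P: (whr y) => [yE|yE|/eqP yE|/orP[]/eqP yE];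
case/or4P: (whr z) => [zE|zE|/eqP zE|/orP[]/eqP zE];
  try (rewrite xE in xT xy zx); try (rewrite yE in yT xy yz); try (rewrite zE in zT yz zx);
  first [by rewrite eqxx in xy|by rewrite eqxx in yz|by rewrite eqxx in zx
  |by rewrite (inA x y) ?eqxx in xy|by rewrite (inA y z) ?eqxx in yz|by rewrite (inA z x) ?eqxx in zx
  |by rewrite (inB x y) ?eqxx in xy|by rewrite (inB y z) ?eqxx in yz|by rewrite (inB z x) ?eqxx in zx
  |exact: x123
  |exact: (x1A x)|exact: (x1A y)|exact: (x1A z)|exact: (x2B x)|exact: (x2B y)|exact: (x2B z)
  |exact: (x13B x)|exact: (x13B y)|exact: (x13B z)|exact: (x23A x)|exact: (x23A y)|exact: (x23A z)
  |exact: (x3AB x y)|exact: (x3AB y x)|exact: (x3AB x z)|exact: (x3AB z x)|exact: (x3AB y z)|exact: (x3AB z y)].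
Qed.
End Converse2.

Theorem theorem1 (G : sgraph) (connG : connected G) :
  claw_free G /\ equimatchable G <->
  (isomorphic G (cycle_graph 4) \/
   (exists2 p, 1 <= p & isomorphic G (complete_graph (2 * p))) \/
   (odd #|G| /\ alpha G <= 2) \/
   inG1 G \/
   (inG21 G \/ inG22 G \/ inG23 G \/ isomorphic G (cycle_graph 7)) \/
   inG3 G).
Proof.
split=> [[cf eq]|H]; first exact: equimatchable_families.
suff [nc eq] : no_claw G /\ equimatchable G by split=> //; apply/claw_freeP.
case: H => [/isomorphicT/iso_C4P|[[p _ /isomorphicT/iso_completeP[cG _]]|[[oG aG]|[|[[|[|[]]]|]]]]].
- exact: C4_converse.
- exact: clique_converse.
- exact: alpha_converse.
- exact: G1_converse.
- exact: G21_converse.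
- exact: G22_converse.
- exact: G23_converse.
- exact: C7_converse.
- exact: G3_converse.
Qed.
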